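(* Let $\mu,\nu\in\mathbf{R}$, let $n$ be a positive integer, and put $\rho=\frac{1+i\mu}{(1+i\nu)n^2}$. Consider the equation $$-U''-U=\rho\,(r-|U|^2)\,U,\qquad x\in\mathbf{R},\qquad (\mathrm{E})$$ for $(r,U)\in\mathbf{C}\times C^2(\mathbf{R})$, and let $\Gamma$ be the set of all $(r,U)\in\mathbf{C}\times C^2(\mathbf{R})$ with $U\not\equiv 0$ such that $(r,U)$ satisfies (E) and $U(x)=v(x)\cos x$ for all $x\in\mathbf{R}$ for some bounded $v\in C(\mathbf{R})$. Then the point $(0,0)\in\mathbf{C}\times C^2(\mathbf{R})$ is a bifurcation point for (E). Moreover, there exist an open neighborhood $\mathcal{O}$ of $(0,0)$ in $\mathbf{C}\times C^2(\mathbf{R})$, a positive constant $\delta$, and continuous functions $\varphi:[0,\delta)\to\mathbf{C}$ and $\Phi:[0,\delta)\times\mathbf{R}\to\mathbf{C}$ such that the set $\Gamma\cap\mathcal{O}$ coincides with the set of all $(r,U)\in\mathbf{C}\times C^2(\mathbf{R})$ having the representation $$r=\tfrac34|\varepsilon|^2\bigl(1+|\varepsilon|^2\varphi(|\varepsilon|^2)\bigr),\qquad U(x)=\varepsilon\bigl(1+|\varepsilon|^2\Phi(|\varepsilon|^2,x)\bigr)\cos x,\quad x\in\mathbf{R},$$ where $\varepsilon$ is an arbitrary complex parameter with $0<|\varepsilon|^2<\delta$, and the following conditions hold: (i) $(r,U)\in\Gamma$ (for every such $\varepsilon$); (ii) $\Phi(s,\cdot)\in C^2(\mathbf{R})$ and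 $\int_{-\pi/2}^{\pi/2}\Phi(s,x)\cos^2x\,\mathrm{d}x=0$ for every $s\in(0,\delta)$; (iii) the real and imaginary parts of $\varphi$ and $\Phi$ are real-analytic functions of their arguments.
   Context: All functions are complex-valued; $C^2(\mathbf{R})$ denotes the space of complex-valued $C^2$-functions on $\mathbf{R}$, with its usual topology, and $C(\mathbf{R})$ the continuous complex-valued functions. Equation (E) has the trivial solutions $(r,0)$, $r\in\mathbf{C}$. That $(0,0)$ is a bifurcation point means that every neighborhood of $(0,0)$ in $\mathbf{C}\times C^2(\mathbf{R})$ contains a solution $(r,U)$ of (E) with $U\not\equiv0$. Equation (E) arises from the complex Ginzburg-Landau equation $u_t=(1+i\nu)u_{xx}+(R-(1+i\mu)|u|^2)u$ by seeking solutions $u(x,t)=U(nx)e^{-i\omega t}$ with $R,\omega\in\mathbf{R}$, in which case $r=\frac{R+i\omega-(1+i\nu)n^2}{1+i\mu}$; in the statement $r$ is an arbitrary complex number. *)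

(* Defs.v *)
From Stdlib Require Import Reals Lra Psatz.
From Coquelicot Require Import Coquelicot.

Open Scope R_scope.

(* In Coquelicot the canonical module structure on [C] is over the scalar field
   [C]; functions of a real variable need the structure over [R], hence the
   explicit [C_R_NormedModule]. *)

(* Total derivative operator for complex-valued functions of a real variable,
   meaningful where [ex_derive] holds. *)
Definition CDerive (U : R -> C) (x : R) : C :=
  (Derive (fun t => Re (U t)) x, Derive (fun t => Im (U t)) x).

Lemma CDerive_correct (U : R -> C) (x : R) :
  ex_derive (V := C_R_NormedModule) U x ->
  is_derive (V := C_R_NormedModule) U x (CDerive U x).
Proof.
intros [l Hl].
assert (H1 : is_derive (fun t => Re (U t)) x (Re l)).
{ apply (filterdiff_comp U (fun z : C_R_NormedModule => fst z)
           _ (fun z : C_R_NormedModule => fst z) Hl).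
  apply filterdiff_linear, (is_linear_fst (K := R_AbsRing)
    (U := R_NormedModule) (V := R_NormedModule)). }
assert (H2 : is_derive (fun t => Im (U t)) x (Im l)).
{ apply (filterdiff_comp U (fun z : C_R_NormedModule => snd z)
           _ (fun z : C_R_NormedModule => snd z) Hl).
  apply filterdiff_linear, (is_linear_snd (K := R_AbsRing)
    (U := R_NormedModule) (V := R_NormedModule)). }
apply is_derive_unique in H1, H2.
replace (CDerive U x) with (l : C); [exact Hl|].
destruct l as [a b]; symmetry; exact (f_equal2 pair H1 H2).
Qed.

Definition is_C2 (U : R -> C) : Prop :=
  (forall x, ex_derive (V := C_R_NormedModule) U x) /\
  (forall x, ex_derive (V := C_R_NormedModule) (CDerive U) x) /\
  (forall x, continuous (CDerive (CDerive U)) x).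

Record C2R := mkC2R { C2R_fun :> R -> C; C2R_prop : is_C2 C2R_fun }.

Lemma is_C2_zero : is_C2 (fun _ => RtoC 0).
Proof.
assert (H : forall a : C, CDerive (fun _ => a) = (fun _ => RtoC 0)).
{ intros a; apply FunctionalExtensionality.functional_extensionality; intros x.
  unfold CDerive; rewrite !Derive_const; reflexivity. }
split; [|split]; intros x; rewrite ?H.
- apply ex_derive_const.
- apply ex_derive_const.
- apply continuous_const.
Qed.

Definition C2R_zero : C2R := mkC2R (fun _ => RtoC 0) is_C2_zero.

(* The usual topology of C^2(R): locally uniform convergence of the function
   and of its first two derivatives.  The uniformity is that of a Frechet
   metric: the ball of radius [e] controls the interval [-1/e, 1/e] with
   tolerance [e]. *)
Definition C2R_ball (U : C2R) (e : R) (V : C2R) : Prop :=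
  0 < e /\
  forall x, e * Rabs x <= 1 ->
    Cmod (U x - V x)%C < e /\
    Cmod (CDerive U x - CDerive V x)%C < e /\
    Cmod (CDerive (CDerive U) x - CDerive (CDerive V) x)%C < e.

Lemma C2R_ball_center (U : C2R) (e : posreal) : C2R_ball U e U.
Proof.
split; [apply cond_pos|].
assert (H : forall z : C, Cmod (z - z)%C < e).
{ intros z; replace (z - z)%C with (RtoC 0) by ring.
  rewrite Cmod_0; apply cond_pos. }
intros x _; repeat split; apply H.
Qed.

Lemma C2R_ball_sym (U V : C2R) (e : R) : C2R_ball U e V -> C2R_ball V e U.
Proof.
assert (H : forall y z : C, Cmod (y - z)%C < e -> Cmod (z - y)%C < e).
{ intros y z Hyz; replace (z - y)%C with (- (y - z))%C by ring.
  now rewrite Cmod_opp. }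
intros [He HUV]; split; [exact He|].
intros x Hx; destruct (HUV x Hx) as (H0 & H1 & H2).
repeat split; apply H; assumption.
Qed.

Lemma C2R_ball_triangle (U V W : C2R) (e1 e2 : R) :
  C2R_ball U e1 V -> C2R_ball V e2 W -> C2R_ball U (e1 + e2) W.
Proof.
assert (H : forall y z w : C, Cmod (y - z)%C < e1 -> Cmod (z - w)%C < e2 ->
                              Cmod (y - w)%C < e1 + e2).
{ intros y z w Hyz Hzw.
  replace (y - w)%C with ((y - z) + (z - w))%C by ring.
  eapply Rle_lt_trans; [apply Cmod_triangle | lra]. }
intros [He1 HUV] [He2 HVW]; split; [lra|].
intros x Hx; pose proof (Rabs_pos x) as Hx0.
destruct (HUV x) as (H0 & H1 & H2); [nra|].
destruct (HVW x) as (K0 & K1 & K2); [nra|].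
repeat split; eapply H; eassumption.
Qed.

Definition C2R_UniformSpace_mixin : UniformSpace.mixin_of C2R :=
  UniformSpace.Mixin C2R C2R_zero C2R_ball
    C2R_ball_center C2R_ball_sym C2R_ball_triangle.

Canonical C2R_UniformSpace : UniformSpace :=
  UniformSpace.Pack C2R C2R_UniformSpace_mixin C2R.

Definition rho (mu nu : R) (n : nat) : C :=
  ((1 + Ci * mu) / ((1 + Ci * nu) * RtoC (INR n ^ 2)))%C.

Definition solves_E (mu nu : R) (n : nat) (r : C) (U : C2R) : Prop :=
  forall x : R,
    (- CDerive (CDerive U) x - U x
     = rho mu nu n * (r - RtoC (Cmod (U x) ^ 2)) * U x)%C.

Definition nontrivial (U : C2R) : Prop := exists x : R, U x <> RtoC 0.

Definition bifurcation_point_origin (mu nu : R) (n : nat) : Prop :=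
  forall P : C * C2R -> Prop,
    locally ((RtoC 0, C2R_zero) : C * C2R) P ->
    exists (r : C) (U : C2R), P (r, U) /\ solves_E mu nu n r U /\ nontrivial U.

Definition Gamma (mu nu : R) (n : nat) (r : C) (U : C2R) : Prop :=
  nontrivial U /\ solves_E mu nu n r U /\
  exists v : R -> C,
    (forall x, continuous v x) /\
    (exists M : R, forall x, Cmod (v x) <= M) /\
    (forall x, U x = (v x * RtoC (cos x))%C).

(* Real-analyticity on a set that need not be open: around every point of [D],
   [f] agrees on [D] with the sum of a convergent power series. *)
Definition analytic_on (D : R -> Prop) (f : R -> R) : Prop :=
  forall s0, D s0 ->
  exists (a : nat -> R) (d : R), 0 < d /\
    forall s, D s -> Rabs (s - s0) < d -> is_pseries a (s - s0) (f s).

(* Absolutely convergent double power series with sum [l]. *)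
Definition is_pseries2 (a : nat -> nat -> R) (h k l : R) : Prop :=
  (exists M : R, forall N : nat,
     sum_n (fun i => sum_n (fun j => Rabs (a i j * h ^ i * k ^ j)) N) N <= M) /\
  is_lim_seq
    (fun N => sum_n (fun i => sum_n (fun j => a i j * h ^ i * k ^ j) N) N) l.

Definition analytic2_on (D : R * R -> Prop) (f : R * R -> R) : Prop :=
  forall p0, D p0 ->
  exists (a : nat -> nat -> R) (d : R), 0 < d /\
    forall p, D p -> Rabs (fst p - fst p0) < d -> Rabs (snd p - snd p0) < d ->
      is_pseries2 a (fst p - fst p0) (snd p - snd p0) (f p).

Definition branch_r (phi : R -> C) (eps : C) : C :=
  (RtoC (3 / 4 * Cmod eps ^ 2)
   * (1 + RtoC (Cmod eps ^ 2) * phi (Cmod eps ^ 2)%R))%C.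

Definition branch_U (Phi : R * R -> C) (eps : C) (x : R) : C :=
  (eps * (1 + RtoC (Cmod eps ^ 2) * Phi ((Cmod eps ^ 2)%R, x))
   * RtoC (cos x))%C.

(* Main.v *)
(** Writing [U = eps w] and [s = |eps|^2], equation (E) becomes
    [- w'' - w = rho s (R - |w|^2) w] with [r = s R].  Solve it by power series in
    [s]: every coefficient of [w] is [cos x] times a polynomial in [cos^2 x], a
    class stable under the cubic nonlinearity and on which [- d^2/dx^2 - 1] is
    bidiagonal; solvability (orthogonality to [cos]) determines the coefficients
    of [R].  The inverse is bounded by 1 in a weighted l^1 norm of the
    coefficients, so for small [s] the series converge in a norm that
    dominates the Taylor coefficients in [(s, x)] at every point; hence [phi] and
    [Phi] are analytic, and the division by [cos x] is built in.

    Conversely, membership in Gamma forces [U (+-pi/2) = 0].  A solution of this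
    boundary value problem satisfies [|U - eps cos| <= C |- U'' - U|] on
    [[-pi/2, pi/2]], where [eps = (2/pi) int U cos].  For small solutions with a
    common [eps <> 0] this estimate, together with the orthogonality condition
    (which controls the difference of the two values of [r]), is a contraction,
    so they agree on [[-pi/2, pi/2]], hence on [R] by uniqueness for the initial
    value problem. *)

Require Import Defs.
From Stdlib Require Import Reals Lra Psatz List Lia Factorial FunctionalExtensionality Classical.
From Coquelicot Require Import Coquelicot.
Import ListNotations.

Open Scope R_scope.

(** * Polynomials in [cos^2 x] and the formal solution *)

(** Equation (E) is invariant under U -> exp(i theta) U, so w and r can be taken to depend on |eps|
    alone. Normalising the mean of w against cos x to 1 makes eps the mean of U, readable off any
    solution. It also makes the formal recursion explicit: the k-th coefficient of R is the mean of
    the k-th coefficient of the cubic term.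

    On cos^(2j+1) x the operator has the diagonal entry 4j(j+1) and the entry -2j(2j+1) one step
    lower. Its back substitution therefore collapses: 4j(j+1) times the j-th unknown is a mean of
    the coefficients from j on, computed by Wallis ratios, and row 0 is the solvability condition.
    This is what bounds the inverse in the l^1 norm.

    In the comparison of two solutions the delicate term is (r - r') U: orthogonality controls only
    (r - r') eps, and eps may be arbitrarily small. The bound |U| <= 2 |eps| absorbs it without
    dividing by eps, so that one neighbourhood serves all amplitudes. *)

Fixpoint peval (p : list R) (y : R) : R :=
  match p with [] => 0 | c :: q => c + y * peval q y end.

(** The weight gives the norm two tasks: for [Y >= 1] it bounds values on [0, 1], the range of
    cos^2, and for [Y] large enough also the Taylor coefficients of p(cos^2 x). *)
Fixpoint pnorm (Y : R) (p : list R) : R :=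
  match p with [] => 0 | c :: q => Rabs c + Y * pnorm Y q end.

Fixpoint padd (p q : list R) : list R :=
  match p, q with
  | [], _ => q
  | _, [] => p
  | c :: p', d :: q' => (c + d) :: padd p' q'
  end.

Definition pscal (c : R) (p : list R) : list R := map (Rmult c) p.

Fixpoint pmul (p q : list R) : list R :=
  match p with [] => [] | c :: p' => padd (pscal c q) (0 :: pmul p' q) end.

Fixpoint psum (f : nat -> list R) (n : nat) : list R :=
  match n with O => f O | S m => padd (psum f m) (f (S m)) end.

Definition conv (f g : nat -> list R) (k : nat) : list R :=
  psum (fun i => pmul (f i) (g (k - i)%nat)) k.

Lemma peval_add p q y : peval (padd p q) y = peval p y + peval q y.
Proof.
revert q; induction p as [|c p IH]; intros [|d q]; simpl; try lra.
rewrite IH; ring.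
Qed.

Lemma peval_scal c p y : peval (pscal c p) y = c * peval p y.
Proof. induction p as [|d p IH]; simpl; [ring|]. rewrite IH; ring. Qed.

Lemma peval_mul p q y : peval (pmul p q) y = peval p y * peval q y.
Proof.
induction p as [|c p IH]; simpl; [ring|].
rewrite peval_add, peval_scal; simpl; rewrite IH; ring.
Qed.

Lemma peval_sum f n y : peval (psum f n) y = sum_f_R0 (fun i => peval (f i) y) n.
Proof. induction n as [|n IH]; simpl; [easy|]. now rewrite peval_add, IH. Qed.

Lemma peval_conv f g k y :
  peval (conv f g k) y
  = sum_f_R0 (fun i => peval (f i) y * peval (g (k - i)%nat) y) k.
Proof.
unfold conv; rewrite peval_sum; apply sum_eq; intros i _; apply peval_mul.
Qed.

Section Norm.

Variable Y : R.
Hypothesis HY : 1 <= Y.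

Lemma pnorm_pos p : 0 <= pnorm Y p.
Proof.
induction p as [|c p IH]; simpl; [lra|].
pose proof (Rabs_pos c); nra.
Qed.

Lemma pnorm_add p q : pnorm Y (padd p q) <= pnorm Y p + pnorm Y q.
Proof.
revert q; induction p as [|c p IH]; intros [|d q]; simpl; try lra.
pose proof (IH q); pose proof (Rabs_triang c d); nra.
Qed.

Lemma pnorm_scal c p : pnorm Y (pscal c p) = Rabs c * pnorm Y p.
Proof.
induction p as [|d p IH]; simpl; [ring|].
fold (pscal c p); rewrite IH, Rabs_mult; ring.
Qed.

Lemma pnorm_mul p q : pnorm Y (pmul p q) <= pnorm Y p * pnorm Y q.
Proof.
induction p as [|c p IH]; simpl; [lra|].
pose proof (pnorm_add (pscal c q) (0 :: pmul p q)) as H.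
simpl in H; rewrite pnorm_scal, Rabs_R0 in H; nra.
Qed.

Lemma pnorm_sum f n : pnorm Y (psum f n) <= sum_f_R0 (fun i => pnorm Y (f i)) n.
Proof.
induction n as [|n IH]; simpl; [lra|].
pose proof (pnorm_add (psum f n) (f (S n))); lra.
Qed.

Lemma peval_le_pnorm p y : Rabs y <= Y -> Rabs (peval p y) <= pnorm Y p.
Proof.
intros Hy; induction p as [|c p IH]; simpl; [rewrite Rabs_R0; lra|].
eapply Rle_trans; [apply Rabs_triang|].
rewrite Rabs_mult.
pose proof (Rabs_pos y); pose proof (Rabs_pos (peval p y)); nra.
Qed.

End Norm.

(** * Cauchy products and the truncated norm of a series in s *)

Lemma sum_f_R0_conv (u v : nat -> R) (K : nat) :
  sum_f_R0 (fun k => sum_f_R0 (fun i => u i * v (k - i)%nat) k) K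
  = sum_f_R0 (fun i => u i * sum_f_R0 v (K - i)) K.
Proof.
induction K as [|K IH]; [easy|].
cbn [sum_f_R0]; rewrite IH, Nat.sub_diag; cbn [sum_f_R0].
rewrite <- Rplus_assoc; f_equal.
rewrite <- plus_sum; apply sum_eq; intros i Hi.
rewrite Nat.sub_succ_l by lia; cbn [sum_f_R0]; ring.
Qed.

(** The left side runs over the triangle i + j <= K, the right side over the square that contains
    it. *)
Lemma sum_f_R0_conv_le (u v : nat -> R) (K : nat) :
  (forall i, 0 <= u i) -> (forall i, 0 <= v i) ->
  sum_f_R0 (fun k => sum_f_R0 (fun i => u i * v (k - i)%nat) k) K
  <= sum_f_R0 u K * sum_f_R0 v K.
Proof.
intros Hu Hv; rewrite sum_f_R0_conv.
rewrite Rmult_comm, scal_sum.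
apply sum_Rle; intros i Hi.
apply Rmult_le_compat_l; [apply Hu|].
assert (Hm : forall a b, (a <= b)%nat -> sum_f_R0 v a <= sum_f_R0 v b).
{ intros a b Hab; induction Hab; [lra|]. simpl; pose proof (Hv (S m)); lra. }
apply Hm; lia.
Qed.

(** Truncation at order [K] keeps the norm finite before any convergence is known, so that the a
    priori bound can be proved by induction on [K]. *)
Definition snorm (Y rad : R) (f : nat -> list R) (K : nat) : R :=
  sum_f_R0 (fun k => rad ^ k * pnorm Y (f k)) K.

Section SNorm.

Variables Y rad : R.
Hypothesis HY : 1 <= Y.
Hypothesis HS : 0 < rad.

Lemma snorm_pos f K : 0 <= snorm Y rad f K.
Proof.
apply cond_pos_sum; intros i.
apply Rmult_le_pos; [apply pow_le; lra | now apply pnorm_pos].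
Qed.

Lemma snorm_le f g K :
  (forall k, pnorm Y (f k) <= pnorm Y (g k)) -> snorm Y rad f K <= snorm Y rad g K.
Proof.
intros H; apply sum_Rle; intros k _.
apply Rmult_le_compat_l; [apply pow_le; lra | apply H].
Qed.

Lemma snorm_add f g K :
  snorm Y rad (fun k => padd (f k) (g k)) K <= snorm Y rad f K + snorm Y rad g K.
Proof.
unfold snorm; rewrite <- plus_sum; apply sum_Rle; intros k _.
rewrite <- Rmult_plus_distr_l.
apply Rmult_le_compat_l; [apply pow_le; lra | now apply pnorm_add].
Qed.

Lemma snorm_scal c f K :
  snorm Y rad (fun k => pscal c (f k)) K = Rabs c * snorm Y rad f K.
Proof.
unfold snorm; rewrite scal_sum; apply sum_eq; intros k _.
rewrite pnorm_scal; ring.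
Qed.

Lemma snorm_cons0 f K : snorm Y rad (fun k => 0 :: f k) K = Y * snorm Y rad f K.
Proof.
unfold snorm; rewrite scal_sum; apply sum_eq; intros k _.
simpl; rewrite Rabs_R0; ring.
Qed.

Lemma snorm_conv f g K :
  snorm Y rad (conv f g) K <= snorm Y rad f K * snorm Y rad g K.
Proof.
unfold snorm at 2 3.
eapply Rle_trans; [|apply sum_f_R0_conv_le].
- apply sum_Rle; intros k _.
  eapply Rle_trans.
  { apply Rmult_le_compat_l; [apply pow_le; lra | apply pnorm_sum, HY]. }
  rewrite scal_sum; apply sum_Rle; intros i Hi.
  replace (rad ^ i * pnorm Y (f i) * (rad ^ (k - i) * pnorm Y (g (k - i)%nat)))
    with (pnorm Y (f i) * pnorm Y (g (k - i)%nat) * (rad ^ i * rad ^ (k - i))) by ring.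
  rewrite <- pow_add.
  replace (i + (k - i))%nat with k by lia.
  apply Rmult_le_compat_r; [apply pow_le; lra | now apply pnorm_mul].
- intros i; apply Rmult_le_pos; [apply pow_le; lra | now apply pnorm_pos].
- intros i; apply Rmult_le_pos; [apply pow_le; lra | now apply pnorm_pos].
Qed.

End SNorm.

(** Wallis's ratio: the integral of cos^(2j+4) divided by that of cos^(2j+2), over [-pi/2, pi/2]. *)
Definition wallis (j : nat) : R := (2 * INR j + 3) / (2 * INR j + 4).

Lemma wallis_bounds j : 0 < wallis j < 1.
Proof.
unfold wallis; pose proof (pos_INR j); split.
- apply Rdiv_lt_0_compat; lra.
- apply Rlt_div_l; lra.
Qed.

(* [lam j p] is the mean of [p(cos^2 x)] for the weight [cos^(2j+2) x] on
   [[-pi/2, pi/2]]. *)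
Fixpoint lam (j : nat) (p : list R) : R :=
  match p with [] => 0 | c :: q => c + wallis j * lam (S j) q end.

Lemma lam_add j p q : lam j (padd p q) = lam j p + lam j q.
Proof.
revert j q; induction p as [|c p IH]; intros j [|d q]; simpl; try lra.
rewrite IH; ring.
Qed.

Lemma lam_scal j c p : lam j (pscal c p) = c * lam j p.
Proof.
revert j; induction p as [|d p IH]; intros j; simpl; [ring|].
fold (pscal c p); rewrite IH; ring.
Qed.

Lemma lam_sum j f n : lam j (psum f n) = sum_f_R0 (fun i => lam j (f i)) n.
Proof. induction n as [|n IH]; simpl; [easy|]. now rewrite lam_add, IH. Qed.

Lemma lam_le_pnorm Y j p : 1 <= Y -> Rabs (lam j p) <= pnorm Y p.
Proof.
intros HY; revert j; induction p as [|c p IH]; intros j; simpl;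
  [rewrite Rabs_R0; lra|].
eapply Rle_trans; [apply Rabs_triang|].
rewrite Rabs_mult; pose proof (wallis_bounds j) as Hw.
rewrite (Rabs_pos_eq (wallis j)) by lra.
pose proof (IH (S j)); pose proof (Rabs_pos (lam (S j) p)); nra.
Qed.

(* Back substitution for the bidiagonal matrix of [-d^2/dx^2 - 1] in the basis
   [cos^(2j+1) x]; division by zero at [j = 0], which is never used. *)
Fixpoint backsolve (j : nat) (p : list R) : list R :=
  match p with
  | [] => []
  | c :: q => lam j p / (4 * INR j * (INR j + 1)) :: backsolve (S j) q
  end.

(* The coefficient of [cos x] is free; it is fixed by orthogonality to
   [cos x]. *)
Definition psolve (p : list R) : list R :=
  match p with
  | [] => []
  | c :: q => let t := backsolve 1 q in (- wallis 0 * lam 1 t) :: t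
  end.

Lemma lam_psolve p : lam 0 (psolve p) = 0.
Proof. destruct p; simpl; [easy|ring]. Qed.

(** With m for [INR (S j)], the bound reproduces itself because 1/(4m(m+1)) + 1/(4(m+1)) = 1/(4m):
    the head costs the first term, and the tail, by induction at the next index, the second. *)
Lemma pnorm_backsolve Y j p :
  1 <= Y -> pnorm Y (backsolve (S j) p) <= pnorm Y p / (4 * INR (S j)).
Proof.
intros HY; revert j; induction p as [|c p IH]; intros j.
{ simpl pnorm; unfold Rdiv; rewrite Rmult_0_l; lra. }
cbn [backsolve]; change (pnorm Y (?a :: ?q)) with (Rabs a + Y * pnorm Y q) at 1.
assert (Hj : 0 < INR (S j)) by apply lt_0_INR, Nat.lt_0_succ.
assert (H1 := lam_le_pnorm Y (S j) (c :: p) HY).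
assert (H2 := IH (S j)).
assert (H3 : Y * pnorm Y p <= pnorm Y (c :: p)).
{ simpl; pose proof (Rabs_pos c); lra. }
rewrite (S_INR (S j)) in H2.
unfold Rdiv at 1; rewrite Rabs_mult, Rabs_inv.
rewrite (Rabs_pos_eq (4 * INR (S j) * (INR (S j) + 1))) by nra.
set (x := INR (S j)) in *.
apply Rle_trans with (pnorm Y (c :: p) * / (4 * x * (x + 1))
                      + pnorm Y (c :: p) * / (4 * (x + 1))).
- apply Rplus_le_compat.
  + apply Rmult_le_compat_r; [|exact H1].
    apply Rlt_le, Rinv_0_lt_compat; nra.
  + apply Rle_trans with (Y * (pnorm Y p / (4 * (x + 1)))).
    * apply Rmult_le_compat_l; lra.
    * unfold Rdiv; rewrite <- Rmult_assoc.
      apply Rmult_le_compat_r; [|exact H3].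
      apply Rlt_le, Rinv_0_lt_compat; nra.
- apply Req_le; field; lra.
Qed.

(** Back substitution starts at index 1, where it gains a factor 1/4. This pays for the coefficient
    of cos x, which costs at most the norm of the rest once more. *)
Lemma pnorm_psolve Y p : 1 <= Y -> pnorm Y (psolve p) <= pnorm Y p.
Proof.
intros HY; destruct p as [|c p]; simpl; [lra|].
pose proof (pnorm_backsolve Y 0 p HY) as H; simpl INR in H.
pose proof (lam_le_pnorm Y 1 (backsolve 1 p) HY) as H1.
pose proof (wallis_bounds 0) as Hw.
rewrite Rabs_mult, Rabs_Ropp, (Rabs_pos_eq (wallis 0)) by lra.
pose proof (Rabs_pos (lam 1 (backsolve 1 p))); pose proof (Rabs_pos c).
pose proof (pnorm_pos Y HY p).
pose proof (pnorm_pos Y HY (backsolve 1 p)).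
assert (pnorm Y (backsolve 1 p) <= pnorm Y p / 4) by lra.
nra.
Qed.

(** * The formal power series solution in s *)

Lemma causal_fixpoint (A : Type) (T : (nat -> A) -> nat -> A) (X0 : nat -> A) :
  (forall X X' k, (forall i, (i < k)%nat -> X i = X' i) -> T X k = T X' k) ->
  exists X, forall k, X k = T X k.
Proof.
intros HT.
pose (Z := fun n => Nat.iter n T X0).
(* By causality the iterates stabilise, whatever the start [X0]: entry k is final from iterate k + 1
   on. The diagonal of the iterates is then the solution. *)
assert (H1 : forall n k, (k < n)%nat -> Z (S n) k = Z n k).
{ induction n as [|n IH]; intros k Hk; [lia|].
  change (T (Z (S n)) k = T (Z n) k); apply HT; intros i Hi; apply IH; lia. }
assert (H2 : forall n k, (k < n)%nat -> Z n k = Z (S k) k).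
{ intros n k Hk; induction Hk as [|m Hm IH]; [easy|].
  rewrite H1 by lia; exact IH. }
exists (fun k => Z (S k) k); intros k.
change (T (Z k) k = T (fun k => Z (S k) k) k).
apply HT; intros i Hi; now apply H2.
Qed.

Lemma psum_ext f g n : (forall i, (i <= n)%nat -> f i = g i) -> psum f n = psum g n.
Proof.
induction n as [|n IH]; intros H; simpl; [apply H; lia|].
rewrite IH, H; [easy|lia|intros; apply H; lia].
Qed.

Lemma conv_ext f f' g g' k :
  (forall i, (i <= k)%nat -> f i = f' i) ->
  (forall i, (i <= k)%nat -> g i = g' i) -> conv f g k = conv f' g' k.
Proof.
intros Hf Hg; apply psum_ext; intros i Hi; rewrite Hf, Hg by lia; easy.
Qed.

(* If [a + i b] is the power series in [s] of [w / cos x], as a function of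
   [cos^2 x], this is the real ([c = a]) or imaginary ([c = b]) part of the
   series of [|w|^2 w / cos x]. *)
Definition cubic (a b c : nat -> list R) (k : nat) : list R :=
  0 :: conv (fun i => padd (conv a a i) (conv b b i)) c k.

(** Coefficient of R, real or imaginary part, forced by the orthogonality of R w - |w|^2 w to cos x:
    w has mean 1 at order 0 and mean 0 at all later orders, so the mean of R w at order k is the
    k-th coefficient of R. It is a constant, stored as a polynomial so that it can enter [conv]. *)
Definition resc (a b c : nat -> list R) (k : nat) : list R :=
  [lam 0 (cubic a b c k)].

(** Real part of the coefficients of (R - |w|^2) w / cos x, before multiplication by rho s; [rhs_im]
    is the imaginary part. *)
Definition rhs_re (a b : nat -> list R) (k : nat) : list R :=
  padd (padd (conv (resc a b a) a k) (pscal (-1) (conv (resc a b b) b k)))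
       (pscal (-1) (cubic a b a k)).

Definition rhs_im (a b : nat -> list R) (k : nat) : list R :=
  padd (padd (conv (resc a b a) b k) (conv (resc a b b) a k))
       (pscal (-1) (cubic a b b k)).

Lemma cubic_ext a a' b b' c c' k :
  (forall i, (i <= k)%nat -> a i = a' i) ->
  (forall i, (i <= k)%nat -> b i = b' i) ->
  (forall i, (i <= k)%nat -> c i = c' i) -> cubic a b c k = cubic a' b' c' k.
Proof.
intros Ha Hb Hc; unfold cubic; f_equal; apply conv_ext; [|easy].
intros i Hi; f_equal; apply conv_ext; intros; [apply Ha|apply Ha|apply Hb|apply Hb]; lia.
Qed.

Lemma resc_ext a a' b b' c c' k :
  (forall i, (i <= k)%nat -> a i = a' i) ->
  (forall i, (i <= k)%nat -> b i = b' i) ->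
  (forall i, (i <= k)%nat -> c i = c' i) -> resc a b c k = resc a' b' c' k.
Proof.
intros Ha Hb Hc; unfold resc; now rewrite (cubic_ext a a' b b' c c').
Qed.

Lemma rhs_ext a a' b b' k :
  (forall i, (i <= k)%nat -> a i = a' i) ->
  (forall i, (i <= k)%nat -> b i = b' i) ->
  rhs_re a b k = rhs_re a' b' k /\ rhs_im a b k = rhs_im a' b' k.
Proof.
intros Ha Hb; unfold rhs_re, rhs_im.
rewrite (cubic_ext a a' b b' a a'), (cubic_ext a a' b b' b b') by assumption.
assert (H : forall c c' d d',
  (forall i, (i <= k)%nat -> c i = c' i) -> (forall i, (i <= k)%nat -> d i = d' i) ->
  conv (resc a b c) d k = conv (resc a' b' c') d' k).
{ intros c c' d d' Hc Hd; apply conv_ext; [|assumption].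
  intros i Hi; apply resc_ext; intros; [apply Ha|apply Hb|apply Hc]; lia. }
now rewrite (H a a' a a'), (H b b' b b'), (H a a' b b'), (H b b' a a').
Qed.

(** The factor s in front of the nonlinearity shifts the index: order k + 1 is solved from the
    orders up to k, starting from w = cos x at order 0. *)
Lemma profile_exists (rho1 rho2 : R) :
  exists a b : nat -> list R,
    a O = [1] /\ b O = [] /\
    (forall k, a (S k) = psolve (padd (pscal rho1 (rhs_re a b k))
                                      (pscal (- rho2) (rhs_im a b k)))) /\
    (forall k, b (S k) = psolve (padd (pscal rho1 (rhs_im a b k))
                                      (pscal rho2 (rhs_re a b k)))).
Proof.
pose (T := fun (X : nat -> list R * list R) (k : nat) =>
  match k with
  | O => ([1], [])
  | S k =>
    let f1 := rhs_re (fun i => fst (X i)) (fun i => snd (X i)) k in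
    let f2 := rhs_im (fun i => fst (X i)) (fun i => snd (X i)) k in
    (psolve (padd (pscal rho1 f1) (pscal (- rho2) f2)),
     psolve (padd (pscal rho1 f2) (pscal rho2 f1)))
  end).
destruct (causal_fixpoint _ T (fun _ => ([], []))) as [X HX].
{ intros X X' [|k] H; [easy|]; unfold T.
  destruct (rhs_ext (fun i => fst (X i)) (fun i => fst (X' i))
                    (fun i => snd (X i)) (fun i => snd (X' i)) k) as [H1 H2].
  - intros i Hi; now rewrite H by lia.
  - intros i Hi; now rewrite H by lia.
  - now rewrite H1, H2. }
exists (fun i => fst (X i)), (fun i => snd (X i)).
split; [now rewrite HX|]. split; [now rewrite HX|].
split; intros k; now rewrite (HX (S k)).
Qed.

(** * Solvability and a priori bounds for the formal solution *)

Section Profile.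

Variables (rho1 rho2 : R) (a b : nat -> list R).
Hypothesis Ha0 : a O = [1].
Hypothesis Hb0 : b O = [].
Hypothesis HaS : forall k,
  a (S k) = psolve (padd (pscal rho1 (rhs_re a b k)) (pscal (- rho2) (rhs_im a b k))).
Hypothesis HbS : forall k,
  b (S k) = psolve (padd (pscal rho1 (rhs_im a b k)) (pscal rho2 (rhs_re a b k))).

Lemma lam_a k : lam 0 (a (S k)) = 0.
Proof. now rewrite HaS, lam_psolve. Qed.

Lemma lam_b k : lam 0 (b k) = 0.
Proof. destruct k; [now rewrite Hb0|]. now rewrite HbS, lam_psolve. Qed.

Lemma lam_pmul_const j c p : lam j (pmul [c] p) = c * lam j p.
Proof. simpl; rewrite lam_add, lam_scal; simpl; ring. Qed.

Lemma lam_conv_resc_b c k : lam 0 (conv (resc a b c) b k) = 0.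
Proof.
unfold conv; rewrite lam_sum; apply sum_eq_R0; intros i _.
unfold resc; rewrite lam_pmul_const, lam_b; ring.
Qed.

(** All terms of the Cauchy product have mean 0 except the one that pairs order k of [resc] with [a
    O = [1]]. *)
Lemma lam_conv_resc_a c k :
  lam 0 (conv (resc a b c) a k) = lam 0 (cubic a b c k).
Proof.
unfold conv; rewrite lam_sum.
assert (Hk : lam 0 (pmul (resc a b c k) (a (k - k)%nat)) = lam 0 (cubic a b c k)).
{ rewrite Nat.sub_diag, Ha0; unfold resc; rewrite lam_pmul_const; simpl; ring. }
destruct k as [|k]; [exact Hk|].
cbn [sum_f_R0]; rewrite Hk, sum_eq_R0; [ring|].
intros i Hi; unfold resc; rewrite lam_pmul_const.
replace (S k - i)%nat with (S (k - i)) by lia.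
rewrite lam_a; ring.
Qed.

Lemma lam_rhs_re k : lam 0 (rhs_re a b k) = 0.
Proof.
unfold rhs_re; rewrite !lam_add, !lam_scal, lam_conv_resc_a, lam_conv_resc_b; ring.
Qed.

Lemma lam_rhs_im k : lam 0 (rhs_im a b k) = 0.
Proof.
unfold rhs_im; rewrite !lam_add, !lam_scal, lam_conv_resc_a, lam_conv_resc_b; ring.
Qed.

Variables Y rad : R.
Hypothesis HY : 1 <= Y.
Hypothesis HS : 0 < rad.
Hypothesis Hsmall : rad * (160 * Y * (Rabs rho1 + Rabs rho2)) <= 1.

Lemma snorm_cubic_le c K :
  snorm Y rad a K + snorm Y rad b K <= 2 -> snorm Y rad c K <= 2 ->
  snorm Y rad (cubic a b c) K <= 8 * Y * snorm Y rad c K.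
Proof.
intros H Hc; unfold cubic; rewrite snorm_cons0.
pose proof (snorm_pos Y rad HY HS a K); pose proof (snorm_pos Y rad HY HS b K).
pose proof (snorm_pos Y rad HY HS c K).
assert (Hqc := snorm_conv Y rad HY HS
  (fun i => padd (conv a a i) (conv b b i)) c K).
assert (Hq2 := snorm_add Y rad HY HS (conv a a) (conv b b) K).
pose proof (snorm_conv Y rad HY HS a a K); pose proof (snorm_conv Y rad HY HS b b K).
set (q := snorm Y rad (fun i => padd (conv a a i) (conv b b i)) K) in *.
assert (Hq : q <= 8) by nra.
assert (q * snorm Y rad c K <= 8 * snorm Y rad c K) by nra.
nra.
Qed.

Lemma snorm_resc_le c K :
  snorm Y rad a K + snorm Y rad b K <= 2 -> snorm Y rad c K <= 2 ->
  snorm Y rad (resc a b c) K <= 8 * Y * snorm Y rad c K.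
Proof.
intros H Hc; eapply Rle_trans; [|now apply snorm_cubic_le].
apply snorm_le; [exact HS|]; intros k; unfold resc.
cbn [pnorm]; rewrite Rmult_0_r, Rplus_0_r; now apply lam_le_pnorm.
Qed.

(** 80 Y = 32 Y + 32 Y + 16 Y: two products of a factor at most 16 Y with one at most 2, and a cubic
    term. In the recursion both components together gain at most rad (|rho1| + |rho2|) 160 Y, hence
    the constant in [Hsmall]. *)
Lemma snorm_rhs_le K :
  snorm Y rad a K + snorm Y rad b K <= 2 ->
  snorm Y rad (rhs_re a b) K <= 80 * Y /\ snorm Y rad (rhs_im a b) K <= 80 * Y.
Proof.
intros H.
pose proof (snorm_pos Y rad HY HS a K); pose proof (snorm_pos Y rad HY HS b K).
assert (Ha : snorm Y rad a K <= 2) by lra.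
assert (Hb : snorm Y rad b K <= 2) by lra.
pose proof (snorm_resc_le a K H Ha) as Ra; pose proof (snorm_resc_le b K H Hb) as Rb.
pose proof (snorm_cubic_le a K H Ha) as Ca; pose proof (snorm_cubic_le b K H Hb) as Cb.
pose proof (snorm_pos Y rad HY HS (resc a b a) K).
pose proof (snorm_pos Y rad HY HS (resc a b b) K).
assert (Hc : forall c d, snorm Y rad c K <= 16 * Y -> 0 <= snorm Y rad c K ->
   snorm Y rad d K <= 2 -> 0 <= snorm Y rad d K ->
   snorm Y rad (conv c d) K <= 32 * Y).
{ intros c d Hc1 Hc2 Hd1 Hd2; pose proof (snorm_conv Y rad HY HS c d K); nra. }
assert (Ra' : snorm Y rad (resc a b a) K <= 16 * Y) by nra.
assert (Rb' : snorm Y rad (resc a b b) K <= 16 * Y) by nra.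
assert (Ca' : snorm Y rad (cubic a b a) K <= 16 * Y) by nra.
assert (Cb' : snorm Y rad (cubic a b b) K <= 16 * Y) by nra.
assert (E1 : Rabs (-1) = 1) by (rewrite Rabs_left; lra).
split.
- unfold rhs_re; eapply Rle_trans; [now apply snorm_add|].
  eapply Rle_trans; [apply Rplus_le_compat_r; now apply snorm_add|].
  rewrite !snorm_scal, E1.
  pose proof (Hc (resc a b a) a); pose proof (Hc (resc a b b) b); lra.
- unfold rhs_im; eapply Rle_trans; [now apply snorm_add|].
  eapply Rle_trans; [apply Rplus_le_compat_r; now apply snorm_add|].
  rewrite !snorm_scal, E1.
  pose proof (Hc (resc a b a) b); pose proof (Hc (resc a b b) a); lra.
Qed.

Lemma snorm_succ f g K :
  (forall k, pnorm Y (f (S k)) <= pnorm Y (g k)) ->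
  snorm Y rad f (S K) <= pnorm Y (f O) + rad * snorm Y rad g K.
Proof.
intros H; unfold snorm; rewrite decomp_sum by lia; simpl pred.
simpl pow at 1; rewrite Rmult_1_l; apply Rplus_le_compat_l.
rewrite scal_sum; apply sum_Rle; intros k _.
rewrite <- tech_pow_Rmult.
replace (rad ^ k * pnorm Y (g k) * rad) with (rad * rad ^ k * pnorm Y (g k)) by ring.
apply Rmult_le_compat_l; [|apply H].
apply Rmult_le_pos; [lra|apply pow_le; lra].
Qed.

(* The partial sums satisfy [n_(K+1) <= 1 + rad C n_K^4], so for small [rad] they
   never exceed [2]. *)
Lemma snorm_profile K : snorm Y rad a K + snorm Y rad b K <= 2.
Proof.
induction K as [|K IH].
{ unfold snorm; simpl; rewrite Ha0, Hb0; simpl; rewrite Rabs_R1; lra. }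
destruct (snorm_rhs_le K IH) as [Hr1 Hr2].
assert (HL : forall c d, snorm Y rad (fun k => padd (pscal c (rhs_re a b k))
                                       (pscal d (rhs_im a b k))) K
                   <= (Rabs c + Rabs d) * (80 * Y)).
{ intros c d; eapply Rle_trans; [apply snorm_add; assumption|].
  rewrite !snorm_scal.
  pose proof (Rabs_pos c); pose proof (Rabs_pos d); nra. }
assert (HL' : forall c d, snorm Y rad (fun k => padd (pscal c (rhs_im a b k))
                                       (pscal d (rhs_re a b k))) K
                   <= (Rabs c + Rabs d) * (80 * Y)).
{ intros c d; eapply Rle_trans; [apply snorm_add; assumption|].
  rewrite !snorm_scal.
  pose proof (Rabs_pos c); pose proof (Rabs_pos d); nra. }
assert (HA := snorm_succ a (fun k => padd (pscal rho1 (rhs_re a b k))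
                            (pscal (- rho2) (rhs_im a b k))) K).
assert (HB := snorm_succ b (fun k => padd (pscal rho1 (rhs_im a b k))
                            (pscal rho2 (rhs_re a b k))) K).
rewrite Ha0 in HA; rewrite Hb0 in HB; simpl pnorm in HA, HB.
rewrite Rabs_R1 in HA.
specialize (HL rho1 (- rho2)); specialize (HL' rho1 rho2).
rewrite Rabs_Ropp in HL.
specialize (HA ltac:(intros k; rewrite HaS; now apply pnorm_psolve)).
specialize (HB ltac:(intros k; rewrite HbS; now apply pnorm_psolve)).
nra.
Qed.
End Profile.

(** * Power series with summable coefficients *)

Lemma ex_series_dom (u M : nat -> R) :
  (forall n, Rabs (u n) <= M n) -> ex_series M -> ex_series u.
Proof. intros H HM; now apply (@ex_series_le R_AbsRing R_CompleteNormedModule u M). Qed.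

Lemma Series_dom (u M : nat -> R) :
  (forall n, Rabs (u n) <= M n) -> ex_series M -> Rabs (Series u) <= Series M.
Proof.
intros H HM.
assert (HA : ex_series (fun n => Rabs (u n))).
{ apply ex_series_dom with M; [|exact HM].
  intros n; rewrite Rabs_Rabsolu; apply H. }
eapply Rle_trans; [now apply Series_Rabs|].
apply Series_le; [|exact HM].
intros n; split; [apply Rabs_pos|apply H].
Qed.

Lemma Series_sum_f_R0 (v : nat -> nat -> R) (N : nat) :
  (forall i, (i <= N)%nat -> ex_series (fun n => v n i)) ->
  ex_series (fun n => sum_f_R0 (v n) N) /\
  Series (fun n => sum_f_R0 (v n) N) = sum_f_R0 (fun i => Series (fun n => v n i)) N.
Proof.
induction N as [|N IH]; intros H; simpl; [split; [apply H; lia|easy]|].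
destruct IH as [IH1 IH2]; [intros i Hi; apply H; lia|].
split.
- apply (ex_series_plus (V := R_NormedModule)); [exact IH1|apply H; lia].
- rewrite Series_plus; [now rewrite IH2|exact IH1|apply H; lia].
Qed.

Lemma ex_series_nonneg_bounded (u : nat -> R) (M : R) :
  (forall n, 0 <= u n) -> (forall N, sum_f_R0 u N <= M) -> ex_series u.
Proof.
intros Hu HM.
assert (Hi : forall n, sum_n u n <= sum_n u (S n)).
{ intros n; rewrite sum_Sn; unfold plus; simpl; pose proof (Hu (S n)); lra. }
destruct (ex_finite_lim_seq_incr (sum_n u) M) as [l Hl]; [exact Hi| |].
- intros n; rewrite sum_n_Reals; apply HM.
- exists l; exact Hl.
Qed.

Lemma is_lim_seq_sum_f_R0 (v : nat -> nat -> R) (l : nat -> R) (K : nat) :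
  (forall i, is_lim_seq (v i) (l i)) ->
  is_lim_seq (fun N => sum_f_R0 (fun i => v i N) K) (sum_f_R0 l K).
Proof.
intros H; induction K as [|K IH]; simpl; [apply H|].
apply (is_lim_seq_plus' _ _ _ _ IH (H (S K))).
Qed.

Lemma is_lim_seq_Rabs_le (u : nat -> R) (l M : R) :
  is_lim_seq u l -> (forall n, Rabs (u n) <= M) -> Rabs l <= M.
Proof.
intros Hu HM.
apply (is_lim_seq_le (fun n => Rabs (u n)) (fun _ => M) (Rabs l) M HM).
- apply (is_lim_seq_abs u l Hu).
- apply is_lim_seq_const.
Qed.

(** Dominated convergence for series. It allows the sum over the orders in s to be exchanged with
    the limit of the partial sums of Taylor series. *)
Lemma tannery (u : nat -> nat -> R) (l M : nat -> R) :
  ex_series M -> (forall n N, Rabs (u n N) <= M n) ->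
  (forall n, is_lim_seq (u n) (l n)) ->
  is_lim_seq (fun N => Series (fun n => u n N)) (Series l).
Proof.
intros HM Hu Hl.
assert (HlM : forall n, Rabs (l n) <= M n).
{ intros n; apply (is_lim_seq_Rabs_le (u n)); [apply Hl|apply Hu]. }
assert (HM0 : forall n, 0 <= M n).
{ intros n; eapply Rle_trans; [apply Rabs_pos|apply (HlM n)]. }
apply is_lim_seq_spec; intros eps; simpl.
assert (HT : is_lim_seq (sum_n M) (Series M)) by apply Series_correct, HM.
(* A quarter of [eps] for the tail of [M], because the tail of the differences is at most twice as
   large; the other half goes to the finite head. *)
apply is_lim_seq_spec in HT; destruct (HT (pos_div_2 (pos_div_2 eps))) as [K HK].
specialize (HK K (Nat.le_refl _)); rewrite sum_n_Reals in HK; simpl in HK.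
assert (HF : is_lim_seq (fun N => sum_f_R0 (fun n => Rabs (u n N - l n)) K) 0).
{ replace 0 with (sum_f_R0 (fun _ => 0) K) by (apply sum_eq_R0; easy).
  apply is_lim_seq_sum_f_R0; intros n.
  replace (Finite 0) with (Rbar_abs (l n - l n)) by (simpl; f_equal; rewrite Rminus_diag; apply Rabs_R0).
  apply is_lim_seq_abs, (is_lim_seq_minus' _ _ _ _ (Hl n)), is_lim_seq_const. }
apply is_lim_seq_spec in HF; destruct (HF (pos_div_2 eps)) as [N0 HN0].
exists N0; intros N HN; specialize (HN0 N HN); simpl in HN0.
rewrite <- Series_minus.
2: { apply ex_series_dom with M; auto. }
2: { apply ex_series_dom with M; auto. }
assert (HD : forall n, Rabs (u n N - l n) <= 2 * M n).
{ intros n; unfold Rminus; eapply Rle_trans; [apply Rabs_triang|].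
  rewrite Rabs_Ropp; pose proof (Hu n N); pose proof (HlM n); lra. }
assert (H2M : ex_series (fun n => 2 * M n)).
{ apply (ex_series_scal (V := R_NormedModule) 2 M HM). }
assert (HA : ex_series (fun n => Rabs (u n N - l n))).
{ apply ex_series_dom with (fun n => 2 * M n); [|exact H2M].
  intros n; rewrite Rabs_Rabsolu; apply HD. }
eapply Rle_lt_trans; [now apply Series_Rabs|].
assert (HI := Series_incr_n _ (S K) ltac:(lia) HA); simpl pred in HI.
eapply Rle_lt_trans; [apply Req_le, HI|].
rewrite (Series_incr_n M (S K) ltac:(lia) HM) in HK; simpl pred in HK.
assert (HR : Series (fun k => Rabs (u (S K + k)%nat N - l (S K + k)%nat))
   <= Series (fun k => 2 * M (S K + k)%nat)).
{ apply Series_le.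
  - intros n; split; [apply Rabs_pos|apply HD].
  - now apply (ex_series_incr_n (fun n => 2 * M n) (S K)). }
rewrite Series_scal_l in HR.
rewrite Rminus_0_r in HN0.
rewrite Rabs_pos_eq in HN0 by (apply cond_pos_sum; intros; apply Rabs_pos).
destruct (Rabs_def2 _ _ HK) as [HK1 HK2]; simpl in HR, HK2 |- *; lra.
Qed.

Lemma is_pseries_lim (a : nat -> R) (h l : R) :
  is_pseries a h l <-> is_lim_seq (fun N => sum_f_R0 (fun i => a i * h ^ i) N) l.
Proof.
assert (H : forall N, sum_n (fun k => scal (pow_n h k) (a k)) N
            = sum_f_R0 (fun i => a i * h ^ i) N).
{ intros N; rewrite sum_n_Reals; apply sum_eq; intros i _.
  rewrite pow_n_pow; unfold scal; simpl; unfold mult; simpl; ring. }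
split; intros K.
- apply (is_lim_seq_ext (sum_n (fun k => scal (pow_n h k) (a k)))); [exact H|exact K].
- apply (is_lim_seq_ext _ (sum_n (fun k => scal (pow_n h k) (a k)))) in K;
    [exact K|intros; symmetry; apply H].
Qed.

(** An expansion at [x0] together with a bound on the l^1 norm of its coefficients at radius [d].
    The bound is multiplicative, and carrying it along makes countable sums of expansions
    possible. *)
Definition pser (x0 d M : R) (a : nat -> R) (f : R -> R) : Prop :=
  (forall N, sum_f_R0 (fun i => Rabs (a i) * d ^ i) N <= M) /\
  (forall h, Rabs h < d -> is_pseries a h (f (x0 + h))).

Section Pser.

Variables x0 d : R.
Hypothesis Hd : 0 < d.

Lemma sum_f_R0_term_le (u : nat -> R) (i N : nat) :
  (forall k, 0 <= u k) -> (i <= N)%nat -> u i <= sum_f_R0 u N.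
Proof.
intros Hu Hi; induction Hi as [|N Hi IH].
- destruct i; simpl; [lra|].
  pose proof (cond_pos_sum u i Hu); lra.
- simpl; pose proof (Hu (S N)); lra.
Qed.

Lemma pser_coef_le M a f i : pser x0 d M a f -> Rabs (a i) * d ^ i <= M.
Proof.
intros [H _]; eapply Rle_trans; [|apply (H i)].
apply (sum_f_R0_term_le (fun i => Rabs (a i) * d ^ i)); [|lia].
intros k; apply Rmult_le_pos; [apply Rabs_pos|apply pow_le; lra].
Qed.

Lemma pser_sum_le M a f h N : pser x0 d M a f -> Rabs h <= d ->
  sum_f_R0 (fun i => Rabs (a i * h ^ i)) N <= M.
Proof.
intros [H _] Hh; eapply Rle_trans; [|apply (H N)].
apply sum_Rle; intros i _; rewrite Rabs_mult, <- RPow_abs.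
apply Rmult_le_compat_l; [apply Rabs_pos|].
apply pow_incr; split; [apply Rabs_pos|exact Hh].
Qed.

Lemma pser_radius M a f h :
  pser x0 d M a f -> Rabs h < d -> Rbar_lt (Rabs h) (CV_radius a).
Proof.
intros H Hh; destruct (CV_radius_bounded a) as [HU _].
apply Rbar_lt_le_trans with d; [exact Hh|].
apply HU; exists M; intros n; rewrite Rabs_mult, <- RPow_abs, (Rabs_pos_eq d) by lra.
now apply (pser_coef_le M a f).
Qed.

Lemma pser_le M M' a f : M <= M' -> pser x0 d M a f -> pser x0 d M' a f.
Proof. intros HM [H1 H2]; split; [|exact H2]. intros N; specialize (H1 N); lra. Qed.

Lemma pser_ext M a f g : (forall x, f x = g x) -> pser x0 d M a f -> pser x0 d M a g.
Proof. intros E [H1 H2]; split; [exact H1|]. intros h Hh; rewrite <- E; auto. Qed.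

Lemma pser_const c :
  pser x0 d (Rabs c) (fun i => match i with O => c | _ => 0 end) (fun _ => c).
Proof.
assert (H : forall (u : nat -> R) N, (forall i, u (S i) = 0) -> sum_f_R0 u N = u O).
{ intros u N Hu; induction N as [|N IH]; simpl; [easy|]. rewrite IH, Hu; ring. }
split.
- intros N; rewrite H; [simpl; lra|]. intros i; rewrite Rabs_R0; ring.
- intros h _; apply is_pseries_lim.
  apply (is_lim_seq_ext (fun _ => c)); [|apply is_lim_seq_const].
  intros N; rewrite H; [simpl; ring|]. intros; ring.
Qed.

Lemma pser_plus M M' a a' f f' :
  pser x0 d M a f -> pser x0 d M' a' f' ->
  pser x0 d (M + M') (fun i => a i + a' i) (fun x => f x + f' x).
Proof.
intros [H1 H2] [H1' H2']; split.
- intros N; eapply Rle_trans; [|apply Rplus_le_compat; [apply (H1 N)|apply (H1' N)]].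
  rewrite <- plus_sum; apply sum_Rle; intros i _.
  rewrite <- Rmult_plus_distr_r; apply Rmult_le_compat_r; [apply pow_le; lra|].
  apply Rabs_triang.
- intros h Hh; apply is_pseries_lim.
  apply (is_lim_seq_ext (fun N => sum_f_R0 (fun i => a i * h ^ i) N
                                + sum_f_R0 (fun i => a' i * h ^ i) N)).
  + intros N; rewrite <- plus_sum; apply sum_eq; intros; ring.
  + apply is_lim_seq_plus'; apply is_pseries_lim; auto.
Qed.

Lemma pser_scal M a f c :
  pser x0 d M a f -> pser x0 d (Rabs c * M) (fun i => c * a i) (fun x => c * f x).
Proof.
intros [H1 H2]; split.
- intros N; eapply Rle_trans; [|apply Rmult_le_compat_l; [apply Rabs_pos|apply (H1 N)]].
  rewrite scal_sum; apply sum_Rle; intros i _; rewrite Rabs_mult; lra.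
- intros h Hh; apply is_pseries_lim.
  apply (is_lim_seq_ext (fun N => c * sum_f_R0 (fun i => a i * h ^ i) N)).
  + intros N; rewrite scal_sum; apply sum_eq; intros; ring.
  + apply (is_lim_seq_scal_l _ c (f (x0 + h))); apply is_pseries_lim; auto.
Qed.

Lemma pser_mult M M' a a' f f' :
  pser x0 d M a f -> pser x0 d M' a' f' ->
  pser x0 d (M * M') (PS_mult a a') (fun x => f x * f' x).
Proof.
intros H H'; split.
- intros N.
  assert (HM : 0 <= M).
  { eapply Rle_trans; [|apply (proj1 H O)]; simpl; rewrite Rmult_1_r; apply Rabs_pos. }
  eapply Rle_trans; [|apply Rmult_le_compat; [| |apply (proj1 H N)|apply (proj1 H' N)]].
  2, 3: apply cond_pos_sum; intros; apply Rmult_le_pos;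
          [apply Rabs_pos|apply pow_le; lra].
  eapply Rle_trans; [|apply sum_f_R0_conv_le].
  2, 3: intros; apply Rmult_le_pos; [apply Rabs_pos|apply pow_le; lra].
  apply sum_Rle; intros k _; unfold PS_mult.
  eapply Rle_trans.
  { apply Rmult_le_compat_r; [apply pow_le; lra|apply Rsum_abs]. }
  rewrite Rmult_comm, scal_sum; apply sum_Rle; intros i Hi.
  replace (d ^ k) with (d ^ i * d ^ (k - i)) by (rewrite <- pow_add; f_equal; lia).
  rewrite Rabs_mult; apply Req_le; ring.
- intros h Hh; apply is_pseries_mult.
  + now apply (proj2 H).
  + now apply (proj2 H').
  + now apply (pser_radius M a f).
  + now apply (pser_radius M' a' f').
Qed.

(** The zero series is written in the shape that [pser_const] gives to a constant, so that the empty
    list matches it literally. *)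
Fixpoint peval_coef (a : nat -> R) (p : list R) : nat -> R :=
  match p with
  | [] => fun i => match i with O => 0 | _ => 0 end
  | c :: q => fun i => match i with O => c | _ => 0 end + PS_mult a (peval_coef a q) i
  end.

(** Horner's scheme: each step multiplies by an expansion of norm at most [M <= Y], and this is how
    the weight in [pnorm] absorbs the norm of the inner function. *)
Lemma pser_peval Y M a f p : 1 <= Y -> M <= Y -> pser x0 d M a f ->
  pser x0 d (pnorm Y p) (peval_coef a p) (fun x => peval p (f x)).
Proof.
intros HY HM Hf; induction p as [|c p IH]; simpl.
- pose proof (pser_const 0) as H0; rewrite Rabs_R0 in H0; exact H0.
- apply pser_plus; [apply pser_const|].
  apply pser_le with (M * pnorm Y p); [|now apply pser_mult].
  apply Rmult_le_compat_r; [now apply pnorm_pos|exact HM].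
Qed.

Fixpoint pow_coef (a : nat -> R) (k : nat) : nat -> R :=
  match k with
  | O => fun i => match i with O => 1 | _ => 0 end
  | S k => PS_mult a (pow_coef a k)
  end.

Lemma pser_pow M a f k : pser x0 d M a f ->
  pser x0 d (M ^ k) (pow_coef a k) (fun x => f x ^ k).
Proof.
intros Hf; induction k as [|k IH]; simpl.
- pose proof (pser_const 1) as H1; rewrite Rabs_R1 in H1; exact H1.
- now apply pser_mult.
Qed.

Lemma pser_id : exists a, pser x0 d (Rabs x0 + d) a (fun x => x).
Proof.
exists (fun i => match i with O => x0 | S O => 1 | _ => 0 end).
assert (H : forall (u : nat -> R) N, (forall i, u (S (S i)) = 0) ->
   sum_f_R0 u (S N) = u O + u (S O)).
{ intros u N Hu; induction N as [|N IH]; [easy|].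
  change (sum_f_R0 u (S N) + u (S (S N)) = u O + u (S O)); rewrite IH, Hu; ring. }
split.
- intros [|N]; [simpl; lra|].
  rewrite H; [simpl; rewrite Rabs_R1; lra|]. intros i; rewrite Rabs_R0; ring.
- intros h _; apply is_pseries_lim, is_lim_seq_incr_1.
  apply (is_lim_seq_ext (fun _ => x0 + h)); [|apply is_lim_seq_const].
  intros N; rewrite H; [simpl; ring|]. intros; ring.
Qed.

Lemma ex_series_coef (a : nat -> nat -> R) (f : nat -> R -> R) (M : nat -> R) i :
  (forall n, pser x0 d (M n) (a n) (f n)) -> ex_series M ->
  ex_series (fun n => Rabs (a n i)).
Proof.
intros H HM.
assert (Hp : 0 < d ^ i) by now apply pow_lt.
apply ex_series_dom with (fun n => / d ^ i * M n).
- intros n; rewrite Rabs_Rabsolu.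
  pose proof (pser_coef_le _ _ _ i (H n)).
  apply Rmult_le_reg_r with (d ^ i); [exact Hp|].
  eapply Rle_trans; [eassumption|]; apply Req_le; field; lra.
- apply (ex_series_scal (V := R_NormedModule) (/ d ^ i) M HM).
Qed.

(** Summability of [M] dominates the partial sums in i uniformly, so [tannery] passes the limit
    under the sum over n. *)
Lemma pser_Series (a : nat -> nat -> R) (f : nat -> R -> R) (M : nat -> R) :
  (forall n, pser x0 d (M n) (a n) (f n)) -> ex_series M ->
  pser x0 d (Series M) (fun i => Series (fun n => a n i))
       (fun x => Series (fun n => f n x)).
Proof.
intros H HM.
assert (HA := fun i => ex_series_coef a f M i H HM).
split.
- intros N; apply Rle_trans with
    (sum_f_R0 (fun i => Series (fun n => Rabs (a n i) * d ^ i)) N).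
  + apply sum_Rle; intros i _; rewrite Series_scal_r.
    apply Rmult_le_compat_r; [apply pow_le; lra|now apply Series_Rabs].
  + destruct (Series_sum_f_R0 (fun n i => Rabs (a n i) * d ^ i) N) as [_ HE].
    { intros i _; apply (ex_series_scal_r (d ^ i) _ (HA i)). }
    rewrite <- HE; apply Series_le; [|exact HM].
    intros n; split; [|apply (proj1 (H n))].
    apply cond_pos_sum; intros; apply Rmult_le_pos; [apply Rabs_pos|apply pow_le; lra].
- intros h Hh; apply is_pseries_lim.
  apply (is_lim_seq_ext
    (fun N => Series (fun n => sum_f_R0 (fun i => a n i * h ^ i) N))).
  + intros N; destruct (Series_sum_f_R0 (fun n i => a n i * h ^ i) N) as [_ HE].
    { intros i _; apply (ex_series_scal_r (h ^ i)), ex_series_Rabs, HA. }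
    rewrite HE; apply sum_eq; intros i _; apply Series_scal_r.
  + apply (tannery _ _ M HM).
    * intros n N; eapply Rle_trans; [apply Rsum_abs|].
      apply (pser_sum_le _ _ _ _ _ (H n)); lra.
    * intros n; apply is_pseries_lim, (proj2 (H n) h Hh).
Qed.

End Pser.

Lemma pser_derive x0 d M a f : 0 < d -> pser x0 d M a f ->
  (forall h, Rabs h < d -> is_derive f (x0 + h) (PSeries (PS_derive a) h)) /\
  (forall h, Rabs h < d -> is_derive (Derive f) (x0 + h)
                             (PSeries (PS_derive (PS_derive a)) h)).
Proof.
intros Hd H.
assert (HR : forall h, Rabs h < d -> Rbar_lt (Rabs h) (CV_radius a)).
{ intros h; now apply (pser_radius x0 d Hd M a f). }
assert (HL : forall h, Rabs h < d ->
  locally (x0 + h) (fun t => Rabs (t - x0) < d)).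
{ intros h Hh; exists (mkposreal (d - Rabs h) ltac:(lra)); intros t Ht.
  change (Rabs (t - (x0 + h)) < d - Rabs h) in Ht.
  replace (t - x0) with ((t - (x0 + h)) + h) by ring.
  eapply Rle_lt_trans; [apply Rabs_triang|lra]. }
assert (HC : forall (g : R -> R) h l, is_derive g h l ->
  is_derive (fun t => g (t - x0)) (x0 + h) l).
{ intros g h l Hg; rewrite <- (Rmult_1_l l).
  apply (is_derive_comp (V := R_NormedModule) g (fun t => t - x0) (x0 + h) l 1).
  - assert (E : (x0 + h - x0)%R = h) by (clear; lra); rewrite E; exact Hg.
  - auto_derive; easy. }
assert (H1 : forall h, Rabs h < d -> is_derive f (x0 + h) (PSeries (PS_derive a) h)).
{ intros h Hh.
  apply (is_derive_ext_loc (fun t => PSeries a (t - x0))).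
  - generalize (HL h Hh); apply filter_imp; intros t Ht.
    rewrite (is_pseries_unique _ _ _ (proj2 H _ Ht)); f_equal; ring.
  - apply HC, is_derive_PSeries, HR, Hh. }
split; [exact H1|].
intros h Hh.
apply (is_derive_ext_loc (fun t => PSeries (PS_derive a) (t - x0))).
- generalize (HL h Hh); apply filter_imp; intros t Ht.
  symmetry; apply is_derive_unique.
  replace t with (x0 + (t - x0)) at 1 by ring; now apply H1.
- apply HC, is_derive_PSeries; rewrite CV_radius_derive; now apply HR.
Qed.

(** Derivatives are read at the centre, where they are a_1 and 2 a_2. As the functions in question
    expand around every point, this covers the whole line. *)
Lemma pser_C2 x0 d M a f : 0 < d -> pser x0 d M a f ->
  is_derive f x0 (a 1%nat) /\ is_derive (Derive f) x0 (2 * a 2%nat) /\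
  continuous (Derive (Derive f)) x0 /\ f x0 = a O.
Proof.
intros Hd H; destruct (pser_derive x0 d M a f Hd H) as [H1 H2].
assert (H0 : Rabs 0 < d) by (rewrite Rabs_R0; lra).
pose proof (H1 0 H0) as D1; pose proof (H2 0 H0) as D2.
rewrite Rplus_0_r, PSeries_0 in D1, D2; unfold PS_derive in D1, D2; simpl in D1, D2.
split; [now rewrite Rmult_1_l in D1|].
split; [rewrite Rmult_1_l in D2; exact D2|].
split.
- apply (continuous_ext_loc _ (fun t => PSeries (PS_derive (PS_derive a)) (t - x0))).
  + exists (mkposreal d Hd); intros t Ht; change (Rabs (t - x0) < d) in Ht.
    symmetry; apply is_derive_unique.
    replace t with (x0 + (t - x0)) at 1 by ring; now apply H2.
  + apply (continuous_comp (fun t => t - x0) (PSeries (PS_derive (PS_derive a)))).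
    * apply (ex_derive_continuous (V := R_NormedModule)); auto_derive; easy.
    * rewrite Rminus_diag; apply continuity_pt_filterlim, PSeries_continuity.
      rewrite !CV_radius_derive; apply (pser_radius x0 d Hd M a f); [exact H|].
      exact H0.
- pose proof (proj2 H 0 H0) as HF; rewrite Rplus_0_r in HF.
  rewrite <- (is_pseries_unique _ _ _ HF); apply PSeries_0.
Qed.

(** * Taylor expansion of the cosine, uniformly in the centre *)

Lemma is_pseries_even (c : nat -> R) (a : nat -> R) (h l : R) :
  (forall n, a (2 * n)%nat = c n) -> (forall n, a (2 * n + 1)%nat = 0) ->
  is_pseries c (h ^ 2) l -> is_pseries a h l.
Proof.
intros H1 H2 Hc; replace l with (l + h * 0) by ring; apply is_pseries_odd_even.
- apply (is_pseries_ext c); [intros; now rewrite H1|exact Hc].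
- apply (is_pseries_ext (fun _ => 0)); [intros; now rewrite H2|].
  apply is_pseries_lim, (is_lim_seq_ext (fun _ => 0)); [|apply is_lim_seq_const].
  intros N; symmetry; apply sum_eq_R0; intros; ring.
Qed.

Lemma is_pseries_odd (c : nat -> R) (a : nat -> R) (h l : R) :
  (forall n, a (2 * n)%nat = 0) -> (forall n, a (2 * n + 1)%nat = c n) ->
  is_pseries c (h ^ 2) l -> is_pseries a h (h * l).
Proof.
intros H1 H2 Hc; replace (h * l) with (0 + h * l) by ring; apply is_pseries_odd_even.
- apply (is_pseries_ext (fun _ => 0)); [intros; now rewrite H1|].
  apply is_pseries_lim, (is_lim_seq_ext (fun _ => 0)); [|apply is_lim_seq_const].
  intros N; symmetry; apply sum_eq_R0; intros; ring.
- apply (is_pseries_ext c); [intros; now rewrite H2|exact Hc].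
Qed.

Lemma sum_inv_fact_le d N : 0 < d <= 1 ->
  sum_f_R0 (fun i => / INR (fact i) * d ^ i) N <= 3.
Proof.
intros Hd; apply Rle_trans with (exp d).
- apply (is_lim_seq_incr_compare (fun N => sum_f_R0 (fun i => / INR (fact i) * d ^ i) N)).
  + apply is_pseries_lim, is_exp_Reals.
  + intros n; cbn [sum_f_R0].
    assert (0 <= / INR (fact (S n)) * d ^ S n); [|lra].
    apply Rmult_le_pos; [apply Rlt_le, Rinv_0_lt_compat, INR_fact_lt_0|apply pow_le; lra].
- pose proof exp_le_3; destruct (Rle_lt_or_eq_dec d 1 (proj2 Hd)) as [H1| ->]; [|lra].
  pose proof (exp_increasing d 1 H1); lra.
Qed.

Definition cos_coef (n : nat) : R :=
  if Nat.even n then (-1) ^ (Nat.div2 n) / INR (fact n) else 0.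

Definition sin_coef (n : nat) : R :=
  if Nat.even n then 0 else (-1) ^ (Nat.div2 n) / INR (fact n).

Lemma cos_sin_coef_le n :
  Rabs (cos_coef n) <= / INR (fact n) /\ Rabs (sin_coef n) <= / INR (fact n).
Proof.
assert (H0 : 0 < / INR (fact n)) by apply Rinv_0_lt_compat, INR_fact_lt_0.
assert (H1 : Rabs ((-1) ^ (Nat.div2 n) / INR (fact n)) <= / INR (fact n)).
{ unfold Rdiv; rewrite Rabs_mult, pow_1_abs, Rabs_pos_eq; lra. }
unfold cos_coef, sin_coef; destruct (Nat.even n); split;
  try exact H1; rewrite Rabs_R0; lra.
Qed.

Lemma is_pseries_cos h : is_pseries cos_coef h (cos h).
Proof.
apply is_pseries_even with cos_n.
- intros n; unfold cos_coef; rewrite Nat.even_mul; simpl Nat.even; simpl orb.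
  now rewrite Nat.div2_double.
- intros n; unfold cos_coef; rewrite Nat.even_add, Nat.even_mul; easy.
- apply is_pseries_lim; unfold cos; destruct (exist_cos (Rsqr h)) as [l Hl].
  unfold cos_in in Hl; apply is_lim_seq_Reals; replace (h ^ 2) with (Rsqr h).
  + exact Hl.
  + unfold Rsqr; ring.
Qed.

Lemma is_pseries_sin h : is_pseries sin_coef h (sin h).
Proof.
unfold sin; destruct (exist_sin (Rsqr h)) as [l Hl].
apply is_pseries_odd with sin_n.
- intros n; unfold sin_coef; rewrite Nat.even_mul; easy.
- intros n; unfold sin_coef; rewrite Nat.even_add, Nat.even_mul; simpl.
  replace (n + (n + 0) + 1)%nat with (S (2 * n)) by lia.
  rewrite Nat.div2_succ_double; unfold sin_n; do 3 f_equal; lia.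
- apply is_pseries_lim; unfold sin_in in Hl; apply is_lim_seq_Reals.
  replace (h ^ 2) with (Rsqr h); [exact Hl|unfold Rsqr; ring].
Qed.

(** By the addition theorem the coefficients at [x0] combine those of cos and sin at 0 with weights
    cos x0 and - sin x0. For d <= 1 each of the two series has norm at most exp(1) <= 3, whence 6
    for every [x0]. *)
Lemma pser_cos x0 d : 0 < d <= 1 -> exists a, pser x0 d 6 a cos.
Proof.
intros Hd.
assert (HC : forall (g : R -> R) u, (forall h, is_pseries u h (g h)) ->
  (forall n, Rabs (u n) <= / INR (fact n)) -> pser x0 d 3 u (fun x => g (x - x0))).
{ intros g u Hu Hn; split.
  - intros N; apply Rle_trans with (2 := sum_inv_fact_le d N Hd).
    apply sum_Rle; intros i _; apply Rmult_le_compat_r; [apply pow_le; lra|apply Hn].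
  - intros h _; replace (x0 + h - x0) with h by ring; apply Hu. }
exists (fun i => cos x0 * cos_coef i + - sin x0 * sin_coef i).
apply (pser_ext _ _ _ _ (fun x => cos x0 * cos (x - x0) + - sin x0 * sin (x - x0))).
- intros x; replace x with (x0 + (x - x0)) at 3 by ring; rewrite cos_plus; ring.
- apply pser_le with (Rabs (cos x0) * 3 + Rabs (- sin x0) * 3).
  + pose proof (COS_bound x0); pose proof (SIN_bound x0).
    rewrite Rabs_Ropp.
    assert (Rabs (cos x0) <= 1) by (apply Rabs_le; lra).
    assert (Rabs (sin x0) <= 1) by (apply Rabs_le; lra).
    lra.
  + apply pser_plus; [lra| |]; apply pser_scal; try lra.
    * apply HC; [apply is_pseries_cos|intros; apply cos_sin_coef_le].
    * apply HC; [apply is_pseries_sin|intros; apply cos_sin_coef_le].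
Qed.

(** * Double series, and trigonometric calculus *)

Definition dsum (u : nat -> nat -> R) (N : nat) : R :=
  sum_f_R0 (fun i => sum_f_R0 (u i) N) N.

Definition pser2 (s0 x0 d M : R) (a : nat -> nat -> R) (F : R -> R -> R) : Prop :=
  (forall N, dsum (fun i j => Rabs (a i j) * d ^ i * d ^ j) N <= M) /\
  (forall h k, Rabs h < d -> Rabs k < d ->
     is_lim_seq (dsum (fun i j => a i j * h ^ i * k ^ j)) (F (s0 + h) (x0 + k))).

Lemma dsum_le u v N : (forall i j, u i j <= v i j) -> dsum u N <= dsum v N.
Proof. intros H; apply sum_Rle; intros i _; apply sum_Rle; intros j _; apply H. Qed.

Lemma dsum_ext u v N : (forall i j, u i j = v i j) -> dsum u N = dsum v N.
Proof. intros H; apply sum_eq; intros i _; apply sum_eq; intros j _; apply H. Qed.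

Lemma dsum_abs u N : Rabs (dsum u N) <= dsum (fun i j => Rabs (u i j)) N.
Proof.
eapply Rle_trans; [apply Rsum_abs|]; apply sum_Rle; intros i _; apply Rsum_abs.
Qed.

Lemma dsum_mult u v N :
  dsum (fun i j => u i * v j) N = sum_f_R0 u N * sum_f_R0 v N.
Proof.
unfold dsum; rewrite Rmult_comm, scal_sum; apply sum_eq; intros i _.
rewrite scal_sum; apply sum_eq; intros; ring.
Qed.

Lemma dsum_nonneg u N : (forall i j, 0 <= u i j) -> 0 <= dsum u N.
Proof. intros H; apply cond_pos_sum; intros; apply cond_pos_sum; intros; apply H. Qed.

Lemma dsum_term_le u i j : (forall i j, 0 <= u i j) -> u i j <= dsum u (i + j).
Proof.
intros H; apply Rle_trans with (sum_f_R0 (u i) (i + j)).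
- apply sum_f_R0_term_le; [intros; apply H|lia].
- apply (sum_f_R0_term_le (fun i0 => sum_f_R0 (u i0) (i + j))); [|lia].
  intros; apply cond_pos_sum; intros; apply H.
Qed.

Lemma Series_dsum (v : nat -> nat -> nat -> R) (N : nat) :
  (forall i j, ex_series (fun n => v n i j)) ->
  Series (fun n => dsum (v n) N) = dsum (fun i j => Series (fun n => v n i j)) N.
Proof.
intros H; unfold dsum.
destruct (Series_sum_f_R0 (fun n i => sum_f_R0 (v n i) N) N) as [_ HE].
{ intros i _; apply (Series_sum_f_R0 (fun n j => v n i j) N); intros; apply H. }
rewrite HE; apply sum_eq; intros i _.
apply (Series_sum_f_R0 (fun n j => v n i j) N); intros; apply H.
Qed.

Section Pser2.

Variables s0 x0 d : R.
Hypothesis Hd : 0 < d.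

Lemma pser2_sum_le M a F h k N : pser2 s0 x0 d M a F -> Rabs h <= d -> Rabs k <= d ->
  dsum (fun i j => Rabs (a i j * h ^ i * k ^ j)) N <= M.
Proof.
intros [H _] Hh Hk; eapply Rle_trans; [|apply (H N)].
apply dsum_le; intros i j; rewrite !Rabs_mult, <- !RPow_abs.
pose proof (Rabs_pos h); pose proof (Rabs_pos k); pose proof (Rabs_pos (a i j)).
apply Rmult_le_compat.
- apply Rmult_le_pos; [easy|now apply pow_le].
- now apply pow_le.
- apply Rmult_le_compat_l; [easy|now apply pow_incr].
- now apply pow_incr.
Qed.

Lemma pser2_le M M' a F : M <= M' -> pser2 s0 x0 d M a F -> pser2 s0 x0 d M' a F.
Proof. intros HM [H1 H2]; split; [|exact H2]. intros N; specialize (H1 N); lra. Qed.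

Lemma pser2_prod M M' a b f g : pser s0 d M a f -> pser x0 d M' b g ->
  pser2 s0 x0 d (M * M') (fun i j => a i * b j) (fun s x => f s * g x).
Proof.
intros [H1 H2] [H1' H2']; split.
- intros N; rewrite (dsum_ext _ (fun i j => (Rabs (a i) * d ^ i) * (Rabs (b j) * d ^ j))).
  2: { intros; rewrite Rabs_mult; ring. }
  rewrite (dsum_mult (fun i => Rabs (a i) * d ^ i) (fun j => Rabs (b j) * d ^ j)).
  apply Rmult_le_compat; [| |apply H1|apply H1'];
    apply cond_pos_sum; intros; apply Rmult_le_pos; try apply Rabs_pos;
    apply pow_le; lra.
- intros h k Hh Hk.
  apply (is_lim_seq_ext (fun N => sum_f_R0 (fun i => a i * h ^ i) N
                                * sum_f_R0 (fun j => b j * k ^ j) N)).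
  + intros N; rewrite <- dsum_mult; apply dsum_ext; intros; ring.
  + apply is_lim_seq_mult'; apply is_pseries_lim; auto.
Qed.

Lemma pser2_Series (a : nat -> nat -> nat -> R) (F : nat -> R -> R -> R) (M : nat -> R) :
  (forall n, pser2 s0 x0 d (M n) (a n) (F n)) -> ex_series M ->
  pser2 s0 x0 d (Series M) (fun i j => Series (fun n => a n i j))
        (fun s x => Series (fun n => F n s x)).
Proof.
intros H HM.
assert (HA : forall i j, ex_series (fun n => Rabs (a n i j))).
{ intros i j.
  assert (Hp : 0 < d ^ i * d ^ j) by (apply Rmult_lt_0_compat; now apply pow_lt).
  apply ex_series_dom with (fun n => / (d ^ i * d ^ j) * M n).
  - intros n; rewrite Rabs_Rabsolu.
    apply Rmult_le_reg_r with (d ^ i * d ^ j); [exact Hp|].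
    apply Rle_trans with (M n); [|apply Req_le; field; nra].
    rewrite <- Rmult_assoc; eapply Rle_trans; [|apply (proj1 (H n) (i + j)%nat)].
    apply (dsum_term_le (fun i j => Rabs (a n i j) * d ^ i * d ^ j)).
    intros; repeat apply Rmult_le_pos; try apply Rabs_pos; apply pow_le; lra.
  - apply (ex_series_scal (V := R_NormedModule) (/ (d ^ i * d ^ j)) M HM). }
split.
- intros N; apply Rle_trans with
    (dsum (fun i j => Series (fun n => Rabs (a n i j) * d ^ i * d ^ j)) N).
  + apply dsum_le; intros i j; rewrite !Series_scal_r.
    apply Rmult_le_compat_r; [apply pow_le; lra|].
    apply Rmult_le_compat_r; [apply pow_le; lra|now apply Series_Rabs].
  + rewrite <- (Series_dsum (fun n i j => Rabs (a n i j) * d ^ i * d ^ j)).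
    2: { intros; apply (ex_series_scal_r (d ^ j)), (ex_series_scal_r (d ^ i)), HA. }
    apply Series_le; [|exact HM].
    intros n; split; [|apply (proj1 (H n))].
    apply dsum_nonneg; intros; repeat apply Rmult_le_pos;
      try apply Rabs_pos; apply pow_le; lra.
- intros h k Hh Hk.
  apply (is_lim_seq_ext
    (fun N => Series (fun n => dsum (fun i j => a n i j * h ^ i * k ^ j) N))).
  + intros N; rewrite (Series_dsum (fun n i j => a n i j * h ^ i * k ^ j)).
    2: { intros; apply (ex_series_scal_r (k ^ j)), (ex_series_scal_r (h ^ i)),
           ex_series_Rabs, HA. }
    apply dsum_ext; intros i j; now rewrite !Series_scal_r.
  + apply (tannery _ _ M HM).
    * intros n N; eapply Rle_trans; [apply dsum_abs|].
      apply (pser2_sum_le _ _ _ _ _ _ (H n)); lra.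
    * intros n; now apply (proj2 (H n)).
Qed.

Lemma pser2_is_pseries2 M a F h k :
  pser2 s0 x0 d M a F -> Rabs h < d -> Rabs k < d ->
  is_pseries2 a h k (F (s0 + h) (x0 + k)).
Proof.
intros H Hh Hk.
assert (HE : forall (u : nat -> nat -> R) N,
  sum_n (fun i => sum_n (fun j => u i j) N) N = dsum u N).
{ intros u N; rewrite sum_n_Reals; apply sum_eq; intros i _; apply sum_n_Reals. }
split.
- exists M; intros N; rewrite HE; apply (pser2_sum_le M a F); [exact H|lra|lra].
- apply (is_lim_seq_ext (dsum (fun i j => a i j * h ^ i * k ^ j))).
  + intros N; symmetry; apply HE.
  + now apply (proj2 H).
Qed.

(* All terms but the constant one carry a factor at most [max(|h|,|k|)/d]. *)
Lemma pser2_lipschitz M a F h k t :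
  pser2 s0 x0 d M a F -> Rabs h <= t -> Rabs k <= t -> t < d ->
  Rabs (F (s0 + h) (x0 + k) - a O O) <= t / d * M.
Proof.
intros H Hh Hk Ht.
assert (Ht0 : 0 <= t) by (pose proof (Rabs_pos h); lra).
set (u := fun i j => match i, j with O, O => 0 | _, _ => a i j * h ^ i * k ^ j end).
assert (HS : forall N, dsum (fun i j => a i j * h ^ i * k ^ j) N - a O O = dsum u N).
{ intros N.
  assert (H0 : dsum (fun i j => match i, j with O, O => a O O | _, _ => 0 end) N = a O O).
  { unfold dsum; destruct N as [|N]; [easy|].
    rewrite decomp_sum by lia; rewrite (decomp_sum _ (S N)) by lia.
    rewrite !sum_eq_R0; [ring| |easy]. intros; apply sum_eq_R0; easy. }
  assert (HP : dsum (fun i j => a i j * h ^ i * k ^ j) N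
    = dsum (fun i j => match i, j with O, O => a O O | _, _ => 0 end) N + dsum u N).
  { unfold dsum; rewrite <- plus_sum; apply sum_eq; intros i _.
    rewrite <- plus_sum; apply sum_eq; intros j _; destruct i, j; simpl; ring. }
  rewrite HP, H0; ring. }
assert (HL : is_lim_seq (dsum u) (F (s0 + h) (x0 + k) - a O O)).
{ apply (is_lim_seq_ext (fun N => dsum (fun i j => a i j * h ^ i * k ^ j) N - a O O)).
  - exact HS.
  - apply is_lim_seq_minus'; [apply (proj2 H); lra|apply is_lim_seq_const]. }
apply (is_lim_seq_Rabs_le _ _ _ HL); intros N.
eapply Rle_trans; [apply dsum_abs|].
assert (Htd : 0 <= t / d) by (apply Rdiv_le_0_compat; lra).
eapply Rle_trans; [|apply Rmult_le_compat_l; [exact Htd|apply (proj1 H N)]].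
unfold dsum at 2; rewrite scal_sum; apply sum_Rle; intros i _.
rewrite Rmult_comm, scal_sum; apply sum_Rle; intros j _.
assert (Hp : forall z n, Rabs z <= t -> Rabs z ^ n <= d ^ n).
{ intros z n Hz; apply pow_incr; split; [apply Rabs_pos|lra]. }
assert (Hp' : forall z n, Rabs z <= t -> Rabs z ^ S n <= t / d * d ^ S n).
{ intros z n Hz; replace (t / d * d ^ S n) with (t * d ^ n) by (simpl; field; lra).
  simpl; apply Rmult_le_compat;
    [apply Rabs_pos|apply pow_le, Rabs_pos|exact Hz|now apply Hp]. }
assert (Hq : forall (z w x y c : R), 0 <= c -> 0 <= z -> 0 <= w -> z <= x -> w <= y ->
   c * z * w <= c * x * y).
{ intros; rewrite !Rmult_assoc; apply Rmult_le_compat_l; [easy|].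
  now apply Rmult_le_compat. }
assert (Hq' : forall z n, 0 <= Rabs z ^ n) by (intros; apply pow_le, Rabs_pos).
unfold u; destruct i as [|i]; [destruct j as [|j]|].
- rewrite Rabs_R0; apply Rmult_le_pos; [|exact Htd].
  repeat apply Rmult_le_pos; try apply Rabs_pos; apply pow_le; lra.
- rewrite !Rabs_mult, <- !RPow_abs.
  replace (Rabs (a O (S j)) * d ^ 0 * d ^ S j * (t / d))
    with (Rabs (a O (S j)) * d ^ 0 * (t / d * d ^ S j)) by ring.
  apply Hq; auto using Rabs_pos.
- rewrite !Rabs_mult, <- !RPow_abs.
  replace (Rabs (a (S i) j) * d ^ S i * d ^ j * (t / d))
    with (Rabs (a (S i) j) * (t / d * d ^ S i) * d ^ j) by ring.
  apply Hq; auto using Rabs_pos.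
Qed.

Lemma pser2_continuous M a F : pser2 s0 x0 d M a F ->
  continuous (fun p : R * R => F (fst p) (snd p)) (s0, x0).
Proof.
intros H; apply filterlim_locally; intros eps.
assert (HM : 0 <= M).
{ eapply Rle_trans; [|apply (proj1 H O)]; apply dsum_nonneg; intros.
  repeat apply Rmult_le_pos; try apply Rabs_pos; apply pow_le; lra. }
(* With radius 0 the estimate identifies the value at the centre with the constant coefficient. *)
assert (H0 := pser2_lipschitz M a F 0 0 0 H).
rewrite Rabs_R0, !Rplus_0_r in H0; unfold Rdiv in H0; rewrite !Rmult_0_l in H0.
assert (H0' : F s0 x0 = a O O).
{ specialize (H0 ltac:(lra) ltac:(lra) ltac:(lra)).
  pose proof (Rabs_pos (F s0 x0 - a O O)).
  apply Rminus_diag_uniq, Rabs_eq_0; lra. }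
(* Ensures t < d and t / d * M < eps; the denominator uses M + 1 because M may be 0. *)
set (t := Rmin (d / 2) (d * eps / (2 * (M + 1)))).
pose proof (cond_pos eps) as He.
assert (Ht : 0 < t).
{ apply Rmin_pos; [lra|]. apply Rdiv_lt_0_compat; nra. }
assert (Ht1 : t <= d / 2) by apply Rmin_l.
assert (Ht2 : t <= d * eps / (2 * (M + 1))) by apply Rmin_r.
exists (mkposreal t Ht); intros [s x] [Hs Hx]; simpl in Hs, Hx.
change (Rabs (s - s0) < t) in Hs; change (Rabs (x - x0) < t) in Hx.
change (Rabs (F s x - F s0 x0) < eps).
rewrite H0'; replace s with (s0 + (s - s0)) by ring; replace x with (x0 + (x - x0)) by ring.
eapply Rle_lt_trans; [apply (pser2_lipschitz M a F _ _ t); [exact H|lra|lra|lra]|].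
apply Rle_lt_trans with (eps / (2 * (M + 1)) * M).
- apply Rmult_le_compat_r; [exact HM|].
  apply Rle_div_l; [lra|]; eapply Rle_trans; [exact Ht2|]; apply Req_le; field; lra.
- apply Rmult_lt_reg_r with (2 * (M + 1)); [lra|].
  replace (eps / (2 * (M + 1)) * M * (2 * (M + 1))) with (eps * M) by (field; lra); nra.
Qed.

End Pser2.

(** * Second derivatives and integrals of polynomials in the cosine *)

Definition is_derive2 (f g : R -> R) : Prop :=
  exists f', (forall x, is_derive f x (f' x)) /\ (forall x, is_derive f' x (g x)).

Lemma is_derive2_ext f f1 g g1 :
  (forall x, f x = f1 x) -> (forall x, g x = g1 x) -> is_derive2 f g -> is_derive2 f1 g1.
Proof.
intros Hf Hg [f' [H1 H2]]; exists f'; split; intros x.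
- now apply (is_derive_ext f).
- rewrite <- Hg; apply H2.
Qed.

Lemma is_derive2_plus f g f1 g1 : is_derive2 f g -> is_derive2 f1 g1 ->
  is_derive2 (fun x => f x + f1 x) (fun x => g x + g1 x).
Proof.
intros [f' [H1 H2]] [f1' [K1 K2]]; exists (fun x => f' x + f1' x); split; intros x.
- now apply (is_derive_plus f f1).
- now apply (is_derive_plus f' f1').
Qed.

Lemma is_derive2_scal c f g : is_derive2 f g ->
  is_derive2 (fun x => c * f x) (fun x => c * g x).
Proof.
intros [f' [H1 H2]]; exists (fun x => c * f' x); split; intros x.
- now apply (is_derive_scal f).
- now apply (is_derive_scal f').
Qed.

Lemma is_derive2_cos_pow n :
  is_derive2 (fun x => cos x ^ S (S n))
    (fun x => - (INR n + 2) ^ 2 * cos x ^ S (S n)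
              + (INR n + 2) * (INR n + 1) * cos x ^ n).
Proof.
assert (H : forall m x, is_derive (fun x => cos x ^ m) x
                          (- INR m * sin x * cos x ^ pred m)).
{ intros m x; auto_derive; [easy|]; ring. }
exists (fun x => - (INR n + 2) * (cos x ^ S n * sin x)); split; intros x.
- replace (- (INR n + 2) * (cos x ^ S n * sin x))
    with (- INR (S (S n)) * sin x * cos x ^ pred (S (S n)));
    [apply H|rewrite !S_INR; simpl pred; ring].
- replace (- (INR n + 2) ^ 2 * cos x ^ S (S n) + (INR n + 2) * (INR n + 1) * cos x ^ n)
    with (- (INR n + 2) * (- INR (S n) * sin x * cos x ^ pred (S n) * sin x
                           + cos x ^ S n * cos x)).
  + apply (is_derive_scal (fun x => cos x ^ S n * sin x)).
    apply (is_derive_mult (fun x => cos x ^ S n) sin x);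
      [apply H|apply is_derive_sin|intros; apply Rmult_comm].
  + pose proof (sin2_cos2 x) as H2; unfold Rsqr in H2.
    rewrite S_INR; simpl pred; simpl pow.
    set (p := cos x ^ n).
    replace (- (INR n + 1) * sin x * p * sin x)
      with (- (INR n + 1) * p * (sin x * sin x)) by ring.
    replace (sin x * sin x) with (1 - cos x * cos x) by lra; ring.
Qed.

Lemma pow_sqr_peval_cons x j c p :
  cos x ^ (2 * j + 1) * peval (c :: p) (cos x ^ 2)
  = c * cos x ^ (2 * j + 1) + cos x ^ (2 * S j + 1) * peval p (cos x ^ 2).
Proof.
replace (2 * S j + 1)%nat with (2 * j + 1 + 2)%nat by lia.
rewrite (pow_add _ (2 * j + 1)); cbn [peval]; ring.
Qed.

(** A list starting at power 2j+3 solves the equation up to a residue in cos^(2j+1). In the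
    induction step the diagonal term of the new head absorbs the residue of the tail, and its
    off-diagonal term leaves a new residue one step lower. *)
Lemma is_derive2_backsolve p j :
  is_derive2
    (fun x => cos x ^ (2 * S j + 1) * peval (backsolve (S j) p) (cos x ^ 2))
    (fun x => - (cos x ^ (2 * S j + 1) * peval (backsolve (S j) p) (cos x ^ 2))
              - cos x ^ (2 * S j + 1) * peval p (cos x ^ 2)
              + wallis j * lam (S j) p * cos x ^ (2 * j + 1)).
Proof.
revert j; induction p as [|c p IH]; intros j.
- exists (fun _ => 0); split; intros x; simpl peval.
  + apply (is_derive_ext (fun _ => 0)); [intros; now rewrite Rmult_0_r|].
    apply @is_derive_const.
  + simpl lam; replace (- _ - _ + _) with 0 by ring; apply @is_derive_const.
- assert (Hj : 0 <= INR j) by apply pos_INR.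
  cbn [backsolve]; set (kap := lam (S j) (c :: p) / (4 * INR (S j) * (INR (S j) + 1))).
  eapply is_derive2_ext; [| |apply is_derive2_plus;
    [apply (is_derive2_scal kap), (is_derive2_cos_pow (2 * j + 1))|apply (IH (S j))]].
  + intros x; rewrite pow_sqr_peval_cons.
    now replace (S (S (2 * j + 1))) with (2 * S j + 1)%nat by lia.
  + intros x; cbv beta; rewrite !pow_sqr_peval_cons.
    replace (S (S (2 * j + 1))) with (2 * S j + 1)%nat by lia.
    replace (2 * S j + 1)%nat with (2 * j + 1 + 2)%nat by lia.
    assert (Hl : lam (S j) (c :: p) = c + wallis (S j) * lam (S (S j)) p) by easy.
    assert (Hk : kap * (4 * INR (S j) * (INR (S j) + 1)) = lam (S j) (c :: p)).
    { unfold kap; field; rewrite S_INR; split; lra. }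
    assert (Hw : wallis j * (2 * INR j + 4) = 2 * INR j + 3).
    { unfold wallis; field; lra. }
    rewrite Hl in *; rewrite S_INR in Hk; rewrite plus_INR, mult_INR; simpl INR.
    rewrite pow_add.
    set (q := cos x ^ (2 * j + 1)); set (L := lam (S (S j)) p) in *.
    set (y := cos x ^ 2).
    set (T1 := cos x ^ (2 * S (S j) + 1) * peval (backsolve (S (S j)) p) y).
    set (T2 := cos x ^ (2 * S (S j) + 1) * peval p y).
    set (w := wallis j) in *; set (v := wallis (S j)) in *; set (J := INR j) in *.
    clearbody kap q y w v J L T1 T2.
    (* The factors of [kap] in [E1] and [E2] are the entries m^2 - 1 and m (m - 1) of the operator
       for m = 2 J + 3. *)
    assert (E1 : c + v * L = kap * (4 * (J + 1) * (J + 1 + 1))) by lra.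
    assert (E2 : w * (c + v * L) = kap * ((2 * J + 3) * (2 * (J + 1)))).
    { rewrite E1, <- Hw; ring. }
    rewrite E2; replace (v * L) with (kap * (4 * (J + 1) * (J + 1 + 1)) - c) by lra.
    ring.
Qed.

(** Solvability at work: [lam 0 p = 0] says that the last residue, in cos x, is exactly the one
    produced by the constant coefficient [c], which back substitution skips. The added multiple of
    cos x lies in the kernel. *)
Lemma is_derive2_psolve p : lam 0 p = 0 ->
  is_derive2 (fun x => cos x * peval (psolve p) (cos x ^ 2))
             (fun x => - (cos x * peval (psolve p) (cos x ^ 2))
                       - cos x * peval p (cos x ^ 2)).
Proof.
destruct p as [|c p]; simpl lam; intros Hl.
- exists (fun _ => 0); split; intros x; simpl peval.
  + apply (is_derive_ext (fun _ => 0)); [intros; now rewrite Rmult_0_r|].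
    apply @is_derive_const.
  + replace (- _ - _) with 0 by ring; apply @is_derive_const.
- simpl psolve; set (m := - wallis 0 * lam 1 (backsolve 1 p)).
  assert (Hc : is_derive2 cos (fun x => - cos x)).
  { exists (fun x => - sin x); split; intros x; [apply is_derive_cos|].
    apply (is_derive_opp sin x (cos x)), is_derive_sin. }
  eapply is_derive2_ext; [| |apply is_derive2_plus;
    [apply (is_derive2_scal m), Hc|apply (is_derive2_backsolve p 0)]].
  + intros x; simpl; ring.
  + intros x; simpl; replace c with (- (wallis 0 * lam 1 p)) by lra; ring.
Qed.

Lemma is_RInt_zero (f : R -> R) (u v : R) : (forall x, f x = 0) -> is_RInt f u v 0.
Proof.
intros Hf; apply (is_RInt_ext (fun _ => 0)); [intros x _; now rewrite Hf|].
pose proof (is_RInt_const (V := R_NormedModule) u v 0) as H0.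
unfold scal in H0; simpl in H0; unfold mult in H0; simpl in H0.
rewrite Rmult_0_r in H0; exact H0.
Qed.

Lemma is_RInt_cos_sqr : is_RInt (fun x => cos x ^ 2) (- (PI / 2)) (PI / 2) (PI / 2).
Proof.
replace (PI / 2) with ((PI / 2 + sin (PI / 2) * cos (PI / 2)) / 2
  - (- (PI / 2) + sin (- (PI / 2)) * cos (- (PI / 2))) / 2) at 3.
2: { rewrite cos_neg, cos_PI2; field. }
apply (is_RInt_derive (V := R_CompleteNormedModule) (fun x => (x + sin x * cos x) / 2)).
- intros x _; auto_derive; [easy|].
  pose proof (sin2_cos2 x) as H; unfold Rsqr in H; nra.
- intros x _; apply (ex_derive_continuous (V := R_NormedModule)); auto_derive; easy.
Qed.

(** The ratio comes from the primitive sin x cos^(2j+3) x, which vanishes at both ends and has the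
    derivative (2j+4) cos^(2j+4) x - (2j+3) cos^(2j+2) x. *)
Lemma is_RInt_cos_pow :
  exists I : nat -> R, forall j : nat,
    is_RInt (fun x => cos x ^ (2 * j + 2)) (- (PI / 2)) (PI / 2) (I j) /\
    I (S j) = wallis j * I j.
Proof.
assert (Hex : forall m, ex_RInt (fun x => cos x ^ m) (- (PI / 2)) (PI / 2)).
{ intros m; apply (ex_RInt_continuous (V := R_CompleteNormedModule)); intros z _.
  apply (ex_derive_continuous (V := R_NormedModule)); auto_derive; easy. }
exists (fun j => RInt (fun x => cos x ^ (2 * j + 2)) (- (PI / 2)) (PI / 2)).
intros j; split; [apply (RInt_correct (V := R_CompleteNormedModule)), Hex|].
set (I := fun j => RInt (fun x => cos x ^ (2 * j + 2)) (- (PI / 2)) (PI / 2)).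
assert (HI : forall j, is_RInt (fun x => cos x ^ (2 * j + 2)) (- (PI / 2)) (PI / 2) (I j))
  by (intros; apply (RInt_correct (V := R_CompleteNormedModule)), Hex).
fold (I (S j)); fold (I j).
pose proof (is_RInt_plus _ _ _ _ _ _
  (is_RInt_scal _ _ _ (2 * INR j + 4) _ (HI (S j)))
  (is_RInt_scal _ _ _ (- (2 * INR j + 3)) _ (HI j))) as H1.
assert (H2 : is_RInt (fun x => (2 * INR j + 4) * cos x ^ (2 * S j + 2)
    + - (2 * INR j + 3) * cos x ^ (2 * j + 2)) (- (PI / 2)) (PI / 2)
    (sin (PI / 2) * cos (PI / 2) ^ (2 * j + 3)
     - sin (- (PI / 2)) * cos (- (PI / 2)) ^ (2 * j + 3))).
{ apply (is_RInt_derive (V := R_CompleteNormedModule)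
    (fun x => sin x * cos x ^ (2 * j + 3))).
  - intros x _.
    assert (H : is_derive (fun x => cos x ^ (2 * j + 3)) x
                  (- (2 * INR j + 3) * sin x * cos x ^ (2 * j + 2))).
    { assert (Hm : forall m, is_derive (fun x => cos x ^ m) x
                               (- INR m * sin x * cos x ^ pred m))
        by (intros m; auto_derive; [easy|]; ring).
      replace (- (2 * INR j + 3) * sin x * cos x ^ (2 * j + 2))
        with (- INR (2 * j + 3) * sin x * cos x ^ pred (2 * j + 3)); [apply Hm|].
      rewrite plus_INR, mult_INR; simpl INR.
      replace (pred (2 * j + 3)) with (2 * j + 2)%nat by lia; ring. }
    replace ((2 * INR j + 4) * cos x ^ (2 * S j + 2)
        + - (2 * INR j + 3) * cos x ^ (2 * j + 2))
      with (cos x * cos x ^ (2 * j + 3)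
            + sin x * (- (2 * INR j + 3) * sin x * cos x ^ (2 * j + 2))).
    + apply (is_derive_mult sin (fun x => cos x ^ (2 * j + 3)) x);
        [apply is_derive_sin|exact H|intros; apply Rmult_comm].
    + pose proof (sin2_cos2 x) as Hs; unfold Rsqr in Hs.
      replace (2 * j + 3)%nat with (S (2 * j + 2)) by lia.
      replace (2 * S j + 2)%nat with (S (S (2 * j + 2))) by lia.
      rewrite <- !tech_pow_Rmult; set (q := cos x ^ (2 * j + 2)).
      replace (sin x * (- (2 * INR j + 3) * sin x * q))
        with (- (2 * INR j + 3) * q * (sin x * sin x)) by ring.
      replace (sin x * sin x) with (1 - cos x * cos x) by lra. ring.
  - intros x _; apply (ex_derive_continuous (V := R_NormedModule)).
    auto_derive; easy. }
assert (H3 := is_RInt_unique _ _ _ _ H1); assert (H4 := is_RInt_unique _ _ _ _ H2).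
assert (H5 : scal (2 * INR j + 4) (I (S j)) + scal (- (2 * INR j + 3)) (I j) = 0).
{ etransitivity; [symmetry; exact H3|]; etransitivity; [exact H4|].
  rewrite cos_neg, cos_PI2, !pow_i by lia; rewrite !Rmult_0_r; apply Rminus_diag. }
unfold scal in H5; simpl in H5; unfold mult in H5; simpl in H5.
unfold wallis; pose proof (pos_INR j).
apply Rmult_eq_reg_l with (2 * INR j + 4); [|lra].
field_simplify; lra.
Qed.

(** * Summation of the formal solution *)

Definition gev (c : nat -> list R) (s x : R) : R :=
  Series (fun k => s ^ k * peval (c k) (cos x ^ 2)).

(* [36] is a bound, uniform in [x0], for the coefficient norm on the unit disk
   of the Taylor series of [cos^2] at [x0]. *)
Definition term_bound (rad : R) (c : nat -> list R) (k : nat) : R :=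
  rad ^ k * pnorm 36 (c k).

Section Gev.

Variable rad : R.
Hypothesis Hrad : 0 < rad.

Definition admissible (c : nat -> list R) : Prop := ex_series (term_bound rad c).

Lemma term_bound_pos c k : 0 <= term_bound rad c k.
Proof. apply Rmult_le_pos; [apply pow_le; lra|apply pnorm_pos; lra]. Qed.

Lemma admissible_bounded c B : (forall K, snorm 36 rad c K <= B) -> admissible c.
Proof. intros H; apply ex_series_nonneg_bounded with B; [apply term_bound_pos|exact H]. Qed.

Lemma snorm_le_Series c K : admissible c -> snorm 36 rad c K <= Series (term_bound rad c).
Proof.
intros H.
apply (is_lim_seq_incr_compare (fun K => snorm 36 rad c K)).
- apply (is_lim_seq_ext (sum_n (term_bound rad c))); [intros; apply sum_n_Reals|].
  apply Series_correct, H.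
- intros n; unfold snorm; cbn [sum_f_R0]; pose proof (term_bound_pos c (S n)).
  unfold term_bound in *; lra.
Qed.

Lemma admissible_add c c' : admissible c -> admissible c' ->
  admissible (fun k => padd (c k) (c' k)).
Proof.
intros H H'.
apply admissible_bounded with (Series (term_bound rad c) + Series (term_bound rad c')).
intros K; eapply Rle_trans; [apply snorm_add; lra|].
apply Rplus_le_compat; now apply snorm_le_Series.
Qed.

Lemma admissible_scal r c : admissible c -> admissible (fun k => pscal r (c k)).
Proof.
intros H; apply admissible_bounded with (Rabs r * Series (term_bound rad c)).
intros K; rewrite snorm_scal; apply Rmult_le_compat_l; [apply Rabs_pos|].
now apply snorm_le_Series.
Qed.

Lemma admissible_conv c c' : admissible c -> admissible c' -> admissible (conv c c').
Proof.
intros H H'.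
apply admissible_bounded with (Series (term_bound rad c) * Series (term_bound rad c')).
intros K; eapply Rle_trans; [apply snorm_conv; lra|].
apply Rmult_le_compat; try (apply snorm_pos; lra); now apply snorm_le_Series.
Qed.

Lemma admissible_cons0 c : admissible c -> admissible (fun k => 0 :: c k).
Proof.
intros H; apply admissible_bounded with (36 * Series (term_bound rad c)).
intros K; rewrite snorm_cons0; apply Rmult_le_compat_l; [lra|].
now apply snorm_le_Series.
Qed.

Lemma admissible_succ c : admissible c -> admissible (fun k => c (S k)).
Proof.
intros H; apply ex_series_incr_1 in H.
apply (ex_series_ext (fun k => / rad * term_bound rad c (S k))).
- intros k; unfold term_bound; simpl; field; lra.
- apply (ex_series_scal (V := R_NormedModule) (/ rad)); exact H.
Qed.

Section FixedS.

Variable s : R.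
Hypothesis Hs : Rabs s <= rad.

Lemma cos_sqr_bound x : 0 <= cos x ^ 2 <= 1.
Proof. pose proof (COS_bound x); nra. Qed.

Lemma gev_term_le c k x : Rabs (s ^ k * peval (c k) (cos x ^ 2)) <= term_bound rad c k.
Proof.
unfold term_bound; rewrite Rabs_mult, <- RPow_abs; apply Rmult_le_compat.
- apply pow_le, Rabs_pos.
- apply Rabs_pos.
- apply pow_incr; split; [apply Rabs_pos|exact Hs].
- pose proof (cos_sqr_bound x); apply peval_le_pnorm.
  rewrite Rabs_pos_eq; lra.
Qed.

Lemma ex_series_gev c x : admissible c ->
  ex_series (fun k => s ^ k * peval (c k) (cos x ^ 2)).
Proof.
intros H; apply ex_series_dom with (term_bound rad c); [|exact H].
intros; apply gev_term_le.
Qed.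

Lemma ex_series_Rabs_gev c x : admissible c ->
  ex_series (fun k => Rabs (s ^ k * peval (c k) (cos x ^ 2))).
Proof.
intros H; apply ex_series_dom with (term_bound rad c); [|exact H].
intros; rewrite Rabs_Rabsolu; apply gev_term_le.
Qed.

Lemma gev_add c c' x : admissible c -> admissible c' ->
  gev (fun k => padd (c k) (c' k)) s x = gev c s x + gev c' s x.
Proof.
intros H H'; unfold gev; rewrite <- Series_plus by now apply ex_series_gev.
apply Series_ext; intros k; rewrite peval_add; ring.
Qed.

Lemma gev_scal r c x : gev (fun k => pscal r (c k)) s x = r * gev c s x.
Proof.
unfold gev; rewrite <- Series_scal_l.
apply Series_ext; intros k; rewrite peval_scal; ring.
Qed.

Lemma gev_cons0 c x : gev (fun k => 0 :: c k) s x = cos x ^ 2 * gev c s x.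
Proof.
unfold gev; rewrite <- Series_scal_l.
apply Series_ext; intros k; cbn [peval]; ring.
Qed.

Lemma gev_conv c c' x : admissible c -> admissible c' ->
  gev (conv c c') s x = gev c s x * gev c' s x.
Proof.
intros H H'; unfold gev at 1; apply is_series_unique.
eapply is_series_ext; [|apply is_series_mult;
  [apply Series_correct, (ex_series_gev c x H)|apply Series_correct, (ex_series_gev c' x H')
  |now apply ex_series_Rabs_gev|now apply ex_series_Rabs_gev]].
intros k; cbv beta; rewrite peval_conv, scal_sum; apply sum_eq; intros i Hi.
replace (s ^ k) with (s ^ i * s ^ (k - i)) by (rewrite <- pow_add; f_equal; lia); ring.
Qed.

Lemma gev_succ c x : admissible c ->
  gev c s x = peval (c O) (cos x ^ 2) + s * gev (fun k => c (S k)) s x.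
Proof.
intros H; unfold gev; rewrite Series_incr_1 by now apply ex_series_gev.
rewrite <- Series_scal_l; simpl pow at 1; rewrite Rmult_1_l; f_equal.
apply Series_ext; intros k; simpl pow; ring.
Qed.

Section FixedX.

Variables x0 d : R.
Hypothesis Hd : 0 < d <= 1.
Variable ccos : nat -> R.
Hypothesis Hcos : pser x0 d 6 ccos cos.

Lemma pser_gev_term c k :
  pser x0 d (term_bound rad c k)
    (fun i => s ^ k * peval_coef (pow_coef ccos 2) (c k) i)
    (fun x => s ^ k * peval (c k) (cos x ^ 2)).
Proof.
apply pser_le with (Rabs (s ^ k) * pnorm 36 (c k)).
- apply Rmult_le_compat_r; [apply pnorm_pos; lra|].
  rewrite <- RPow_abs; apply pow_incr; split; [apply Rabs_pos|exact Hs].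
- apply pser_scal, (pser_peval x0 d ltac:(lra) 36 36 _ (fun x => cos x ^ 2)); [lra|lra|].
  replace 36 with (6 ^ 2) by ring; apply pser_pow; [lra|exact Hcos].
Qed.

Lemma pser_gev_cos_term c k :
  pser x0 d (6 * term_bound rad c k)
    (PS_mult ccos (fun i => s ^ k * peval_coef (pow_coef ccos 2) (c k) i))
    (fun x => cos x * (s ^ k * peval (c k) (cos x ^ 2))).
Proof. apply pser_mult; [lra|exact Hcos|apply pser_gev_term]. Qed.

Lemma pser_gev c : admissible c ->
  pser x0 d (Series (term_bound rad c))
    (fun i => Series (fun k => s ^ k * peval_coef (pow_coef ccos 2) (c k) i))
    (gev c s).
Proof.
intros H; apply (pser_Series x0 d ltac:(lra)
  (fun k i => s ^ k * peval_coef (pow_coef ccos 2) (c k) i)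
  (fun k x => s ^ k * peval (c k) (cos x ^ 2))); [|exact H].
intros k; apply pser_gev_term.
Qed.

Lemma pser_gev_cos c : admissible c ->
  pser x0 d (6 * Series (term_bound rad c))
    (fun i => Series (fun k =>
       PS_mult ccos (fun i => s ^ k * peval_coef (pow_coef ccos 2) (c k) i) i))
    (fun x => cos x * gev c s x).
Proof.
intros H; rewrite <- Series_scal_l.
apply (pser_ext _ _ _ _ (fun x => Series (fun k =>
         cos x * (s ^ k * peval (c k) (cos x ^ 2))))).
{ intros x; apply Series_scal_l. }
apply (pser_Series x0 d ltac:(lra)
  (fun k => PS_mult ccos (fun i => s ^ k * peval_coef (pow_coef ccos 2) (c k) i))
  (fun k x => cos x * (s ^ k * peval (c k) (cos x ^ 2)))).
- intros k; apply pser_gev_cos_term.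
- apply (ex_series_scal (V := R_NormedModule) 6 _ H).
Qed.

End FixedX.

(* The second derivative of a sum of power series is read off its coefficient
   of order two. *)
Lemma gev_ode c g x0 : admissible c -> admissible g ->
  (exists r, forall y, peval (c O) y = r) ->
  (forall k, lam 0 (g k) = 0) -> (forall k, c (S k) = psolve (g k)) ->
  is_derive (Derive (fun x => cos x * gev c s x)) x0
    (- (cos x0 * gev c s x0) - s * (cos x0 * gev g s x0)).
Proof.
intros Hc Hg [r Hr] Hl HS.
destruct (pser_cos x0 1) as [ccos Hcos]; [lra|].
pose proof (pser_gev_cos x0 1 ltac:(lra) ccos Hcos c Hc) as HP.
destruct (pser_C2 _ _ _ _ _ Rlt_0_1 HP) as (_ & H2 & _ & _).
(* Order k + 1 of [c] has order k of [g] as its source, and the spare factor of s^(k+1) becomes the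
   s in front of [g]. Order 0 is a multiple of cos x and has no source. *)
set (e := fun k => match k with O => 0
                   | S k => s * (cos x0 * (s ^ k * peval (g k) (cos x0 ^ 2))) end).
assert (Ht : forall k,
  2 * PS_mult ccos (fun i => s ^ k * peval_coef (pow_coef ccos 2) (c k) i) 2
  = - (cos x0 * (s ^ k * peval (c k) (cos x0 ^ 2))) - e k).
{ intros k.
  pose proof (pser_gev_cos_term x0 1 ltac:(lra) ccos Hcos c k) as Hk.
  destruct (pser_C2 _ _ _ _ _ Rlt_0_1 Hk) as (_ & Hk2 & _ & _).
  apply is_derive_unique in Hk2; etransitivity; [symmetry; exact Hk2|].
  clear Hk Hk2.
  assert (HD : is_derive2 (fun x => cos x * (s ^ k * peval (c k) (cos x ^ 2)))
    (fun x => - (cos x * (s ^ k * peval (c k) (cos x ^ 2)))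
      - match k with O => 0
        | S k => s * (cos x * (s ^ k * peval (g k) (cos x ^ 2))) end)).
  { destruct k as [|k].
    - eapply is_derive2_ext; [| |apply (is_derive2_scal r cos (fun x => - cos x))].
      + intros x; rewrite Hr; simpl; ring.
      + intros x; rewrite Hr; simpl; ring.
      + exists (fun x => - sin x); split; intros x; [apply is_derive_cos|].
        apply (is_derive_opp sin x (cos x)), is_derive_sin.
    - rewrite HS; eapply is_derive2_ext;
        [| |apply (is_derive2_scal (s ^ S k)), is_derive2_psolve, (Hl k)].
      + intros x; cbv beta; ring.
      + intros x; cbv beta; rewrite <- (tech_pow_Rmult s k); ring. }
  destruct HD as [f' [D1 D2]].
  rewrite (Derive_ext _ f' x0) by (intros t; apply is_derive_unique, D1).
  apply is_derive_unique, D2. }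
rewrite <- Series_scal_l in H2.
rewrite (Series_ext _ _ Ht) in H2.
assert (He : ex_series e /\ Series e = s * (cos x0 * gev g s x0)).
{ assert (HeS : ex_series (fun k => e (S k))).
  { apply (ex_series_scal (V := R_NormedModule) s), (ex_series_scal (V := R_NormedModule) (cos x0)).
    now apply ex_series_gev. }
  split; [now apply ex_series_incr_1|].
  rewrite Series_incr_1 by now apply ex_series_incr_1.
  unfold e; rewrite !Series_scal_l; apply Rplus_0_l. }
destruct He as [He1 He2].
assert (Hc1 : ex_series (fun k => cos x0 * (s ^ k * peval (c k) (cos x0 ^ 2)))).
{ apply (ex_series_scal (V := R_NormedModule) (cos x0)); now apply ex_series_gev. }
rewrite Series_minus in H2; [|now apply (ex_series_opp (V := R_NormedModule))|exact He1].
rewrite Series_opp, Series_scal_l, He2 in H2; exact H2.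
Qed.

(** Every partial sum has integral 0, and convergence is uniform because [term_bound] does not
    involve x. *)
Lemma is_RInt_gev c : admissible c -> (forall k, lam 0 (c k) = 0) ->
  is_RInt (fun x => gev c s x * cos x ^ 2) (- (PI / 2)) (PI / 2) 0.
Proof.
intros Hc Hl.
destruct is_RInt_cos_pow as [I HI].
(* A further factor cos^2 turns the weight cos^(2j+2) into cos^(2j+4); this is why [lam] raises j
   along the list. *)
assert (HP : forall p j, is_RInt (fun x => peval p (cos x ^ 2) * cos x ^ (2 * j + 2))
                           (- (PI / 2)) (PI / 2) (lam j p * I j)).
{ induction p as [|r p IH]; intros j.
  - simpl lam; rewrite Rmult_0_l; apply is_RInt_zero; intros x; apply Rmult_0_l.
  - cbn [lam]; replace ((r + wallis j * lam (S j) p) * I j)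
      with (r * I j + lam (S j) p * I (S j)) by (rewrite (proj2 (HI j)); ring).
    apply (is_RInt_ext (fun x => r * cos x ^ (2 * j + 2)
                                 + peval p (cos x ^ 2) * cos x ^ (2 * S j + 2))).
    + intros x _; replace (2 * S j + 2)%nat with (2 * j + 2 + 2)%nat by lia.
      rewrite (pow_add _ (2 * j + 2)); cbn [peval].
      match goal with |- @eq _ ?u ?v => change (@eq R u v) end; ring.
    + apply (is_RInt_plus (V := R_NormedModule)); [|apply IH].
      apply (is_RInt_scal (V := R_NormedModule)), (proj1 (HI j)). }
destruct (filterlim_RInt (V := R_CompleteNormedModule)
  (fun N x => sum_f_R0 (fun k => s ^ k * peval (c k) (cos x ^ 2)) N * cos x ^ 2)
  (- (PI / 2)) (PI / 2) eventually _ (fun x => gev c s x * cos x ^ 2) (fun _ => 0))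
  as [If [H1 H2]].
- intros N; induction N as [|N IH].
  + specialize (HP (c O) O); rewrite Hl, Rmult_0_l in HP.
    apply (is_RInt_ext (fun x => peval (c O) (cos x ^ 2) * cos x ^ 2)); [|exact HP].
    intros x _; simpl; ring.
  + specialize (HP (c (S N)) O); rewrite Hl, Rmult_0_l in HP.
    apply (is_RInt_scal (V := R_NormedModule) _ _ _ (s ^ S N)) in HP.
    pose proof (is_RInt_plus (V := R_NormedModule) _ _ _ _ _ _ IH HP) as HS.
    replace (plus _ _) with (zero : R) in HS.
    2: { unfold plus, scal, zero; simpl; unfold mult; simpl; ring. }
    revert HS; apply is_RInt_ext; intros x _.
    unfold plus, scal; cbn [sum_f_R0]; simpl; unfold mult; simpl; ring.
- apply filterlim_locally; intros eps.
  assert (HT : is_lim_seq (sum_n (term_bound rad c)) (Series (term_bound rad c)))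
    by apply Series_correct, Hc.
  apply is_lim_seq_spec in HT; destruct (HT eps) as [N0 HN0].
  exists N0; intros N HN x; specialize (HN0 N HN).
  rewrite sum_n_Reals in HN0; unfold ball; simpl; unfold AbsRing_ball; simpl.
  unfold abs, minus, plus, opp; simpl.
  pose proof (ex_series_gev c x Hc) as Hx.
  assert (E1 := Series_incr_n _ (S N) ltac:(lia) Hx); simpl pred in E1.
  assert (E2 := Series_incr_n _ (S N) ltac:(lia) Hc); simpl pred in E2.
  fold (gev c s x) in E1; cbv beta in E1.
  set (P := sum_f_R0 (fun k => s ^ k * peval (c k) (cos x ^ 2)) N) in *.
  assert (HR := Series_dom
    (fun k => s ^ (S N + k) * peval (c (S N + k)%nat) (cos x ^ 2))
    (fun k => term_bound rad c (S N + k)%nat)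
    (fun k => gev_term_le c (S N + k)%nat x)).
  specialize (HR ltac:(now apply (ex_series_incr_n (term_bound rad c) (S N)))).
  set (T := Series (fun k => s ^ (S N + k) * peval (c (S N + k)%nat) (cos x ^ 2))) in *.
  set (T' := Series (fun k => term_bound rad c (S N + k)%nat)) in *.
  pose proof (cos_sqr_bound x) as Hb.
  rewrite E2 in HN0; apply Rabs_def2 in HN0; simpl in HN0; destruct HN0 as [_ HN0].
  change (Rabs (P * cos x ^ 2 + - (gev c s x * cos x ^ 2)) < eps).
  rewrite E1; replace (P * cos x ^ 2 + - ((P + T) * cos x ^ 2)) with (- T * cos x ^ 2) by ring.
  rewrite Rabs_mult, Rabs_Ropp, (Rabs_pos_eq (cos x ^ 2)) by lra.
  pose proof (Rabs_pos T); nra.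
- assert (E : If = 0); [|now rewrite <- E].
  apply (filterlim_locally_unique (fun _ : nat => 0) If 0 H1 (filterlim_const 0)).
Qed.

End FixedS.

(** Recentred at [s0], the power s^k has norm at most (|s0| + d)^k, which rad^k dominates. *)
Lemma pser_gev_s c s0 x d : admissible c -> 0 < d -> Rabs s0 + d <= rad ->
  exists a M, pser s0 d M a (fun s => gev c s x).
Proof.
intros Hc Hd Hs; destruct (pser_id s0 d Hd) as [aid Hid].
exists (fun i => Series (fun k => peval (c k) (cos x ^ 2) * pow_coef aid k i)),
  (Series (term_bound rad c)).
apply (pser_ext _ _ _ _ (fun s => Series (fun k => peval (c k) (cos x ^ 2) * s ^ k))).
{ intros s; apply Series_ext; intros; ring. }
apply (pser_Series s0 d Hd (fun k i => peval (c k) (cos x ^ 2) * pow_coef aid k i)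
  (fun k s => peval (c k) (cos x ^ 2) * s ^ k)); [|exact Hc].
intros k; apply pser_le with (Rabs (peval (c k) (cos x ^ 2)) * (Rabs s0 + d) ^ k).
- unfold term_bound; rewrite Rmult_comm; apply Rmult_le_compat.
  + apply pow_le; pose proof (Rabs_pos s0); lra.
  + apply Rabs_pos.
  + apply pow_incr; pose proof (Rabs_pos s0); lra.
  + pose proof (cos_sqr_bound x); apply peval_le_pnorm.
    rewrite Rabs_pos_eq; lra.
- apply pser_scal, pser_pow; [exact Hd|exact Hid].
Qed.

Lemma pser2_gev c s0 x0 d : admissible c -> 0 < d <= 1 -> Rabs s0 + d <= rad ->
  exists a M, pser2 s0 x0 d M a (gev c).
Proof.
intros Hc Hd Hs; destruct (pser_id s0 d ltac:(lra)) as [aid Hid].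
destruct (pser_cos x0 d Hd) as [ccos Hcos].
exists (fun i j => Series (fun k =>
    pow_coef aid k i * peval_coef (pow_coef ccos 2) (c k) j)),
  (Series (term_bound rad c)).
apply (pser2_Series s0 x0 d ltac:(lra)
  (fun k i j => pow_coef aid k i * peval_coef (pow_coef ccos 2) (c k) j)
  (fun k s x => s ^ k * peval (c k) (cos x ^ 2))); [|exact Hc].
intros k; apply pser2_le with ((Rabs s0 + d) ^ k * pnorm 36 (c k)).
- apply Rmult_le_compat_r; [apply pnorm_pos; lra|].
  apply pow_incr; pose proof (Rabs_pos s0); lra.
- apply (pser2_prod s0 x0 d ltac:(lra) _ _ _ _ (fun s => s ^ k)
    (fun x => peval (c k) (cos x ^ 2))).
  + apply pser_pow; [lra|exact Hid].
  + apply (pser_peval x0 d ltac:(lra) 36 36 _ (fun x => cos x ^ 2)); [lra|lra|].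
    replace 36 with (6 ^ 2) by ring; apply pser_pow; [lra|exact Hcos].
Qed.

End Gev.

(** * Uniqueness *)

Lemma mvt_bound (f f' : R -> R) (a b K : R) :
  (forall x, is_derive f x (f' x)) ->
  (forall x, Rmin a b <= x <= Rmax a b -> Rabs (f' x) <= K) ->
  Rabs (f b - f a) <= K * Rabs (b - a).
Proof.
intros Hf HK.
destruct (MVT_gen f a b f') as [c [Hc E]].
- intros x _; apply Hf.
- intros x _; apply continuity_pt_filterlim, (ex_derive_continuous (V := R_NormedModule)).
  exists (f' x); apply Hf.
- rewrite E, Rabs_mult; apply Rmult_le_compat_r; [apply Rabs_pos|now apply HK].
Qed.

Lemma Rabs_cos_le x : Rabs (cos x) <= 1.
Proof. apply Rabs_le, COS_bound. Qed.

Lemma is_derive_cont (f : R -> R) x l : is_derive f x l -> continuous f x.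
Proof. intros H; apply (ex_derive_continuous (V := R_NormedModule)); now exists l. Qed.

(* [p] and [m] below are the coordinates of [(u, u')] in the basis of solutions
   of the homogeneous equation. *)
Lemma dirichlet_estimate (u u' u'' g : R -> R) (e G : R) :
  (forall x, is_derive u x (u' x)) -> (forall x, is_derive u' x (u'' x)) ->
  (forall x, continuous u'' x) -> (forall x, u'' x = - u x - g x) ->
  u (- (PI / 2)) = 0 -> u (PI / 2) = 0 ->
  (forall x, - (PI / 2) <= x <= PI / 2 -> Rabs (g x) <= G) ->
  is_RInt (fun x => u x * cos x) (- (PI / 2)) (PI / 2) (e * (PI / 2)) ->
  (forall x, - (PI / 2) <= x <= PI / 2 -> Rabs (u x - e * cos x) <= 18 * G) /\
  is_RInt (fun x => g x * cos x) (- (PI / 2)) (PI / 2) 0.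
Proof.
intros Du Du' Cu'' Hg Hl Hr HG He.
pose proof PI_RGT_0 as Hpi; pose proof PI_4 as Hpi4.
assert (HG0 : 0 <= G).
{ eapply Rle_trans; [apply Rabs_pos|apply (HG 0)]; lra. }
set (p := fun x => u' x * cos x + u x * sin x).
set (m := fun x => u' x * sin x - u x * cos x).
assert (Hu2 : forall x, is_derive u' x (- u x - g x)).
{ intros x; rewrite <- Hg; apply Du'. }
assert (Dp : forall x, is_derive p x (- g x * cos x)).
{ intros x.
  replace (- g x * cos x) with
    (((- u x - g x) * cos x + u' x * - sin x) + (u' x * sin x + u x * cos x)) by ring.
  apply (is_derive_plus (fun x => u' x * cos x) (fun x => u x * sin x)).
  - apply (is_derive_mult u' cos x); [apply Hu2|apply is_derive_cos|intros; apply Rmult_comm].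
  - apply (is_derive_mult u sin x); [apply Du|apply is_derive_sin|intros; apply Rmult_comm]. }
assert (Dm : forall x, is_derive m x (- g x * sin x)).
{ intros x.
  replace (- g x * sin x) with
    (((- u x - g x) * sin x + u' x * cos x) - (u' x * cos x + u x * - sin x)) by ring.
  apply (is_derive_minus (fun x => u' x * sin x) (fun x => u x * cos x)).
  - apply (is_derive_mult u' sin x); [apply Hu2|apply is_derive_sin|intros; apply Rmult_comm].
  - apply (is_derive_mult u cos x); [apply Du|apply is_derive_cos|intros; apply Rmult_comm]. }
(* Both u and cos vanish at the ends, hence so does p. Integrating p' = - g cos then gives the
   orthogonality of g to cos. *)
assert (Hp0 : p (- (PI / 2)) = 0).
{ unfold p; rewrite Hl, cos_neg, cos_PI2; ring. }
assert (Hp1 : p (PI / 2) = 0).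
{ unfold p; rewrite Hr, cos_PI2; ring. }
assert (Bc := Rabs_cos_le).
assert (Bs : forall x, Rabs (sin x) <= 1) by (intros; apply Rabs_le, SIN_bound).
(* |p'| <= G on an interval of length PI <= 4. For m the distance is measured from 0, so it is at
   most 2. *)
assert (Bp : forall x, - (PI / 2) <= x <= PI / 2 -> Rabs (p x) <= 4 * G).
{ intros x Hx; rewrite <- (Rminus_0_r (p x)), <- Hp0.
  eapply Rle_trans; [apply (mvt_bound p (fun x => - g x * cos x) _ _ G Dp)|].
  - intros t Ht; rewrite Rmin_left, Rmax_right in Ht by lra.
    rewrite Rabs_mult, Rabs_Ropp; specialize (HG t ltac:(lra)); specialize (Bc t).
    pose proof (Rabs_pos (g t)); pose proof (Rabs_pos (cos t)); nra.
  - rewrite Rabs_pos_eq by lra; nra. }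
assert (Bm : forall x, - (PI / 2) <= x <= PI / 2 -> Rabs (m x - m 0) <= 2 * G).
{ intros x Hx.
  eapply Rle_trans; [apply (mvt_bound m (fun x => - g x * sin x) _ _ G Dm)|].
  - intros t Ht; assert (- (PI / 2) <= t <= PI / 2).
    { revert Ht; unfold Rmin, Rmax; destruct (Rle_dec 0 x); lra. }
    rewrite Rabs_mult, Rabs_Ropp; specialize (HG t ltac:(lra)); specialize (Bs t).
    pose proof (Rabs_pos (g t)); pose proof (Rabs_pos (sin t)); nra.
  - assert (Rabs (x - 0) <= 2) by (apply Rabs_le; lra); nra. }
assert (Bu : forall x, - (PI / 2) <= x <= PI / 2 -> Rabs (u x - - m 0 * cos x) <= 6 * G).
{ intros x Hx.
  replace (u x - - m 0 * cos x) with (p x * sin x - (m x - m 0) * cos x).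
  - unfold Rminus at 1; eapply Rle_trans; [apply Rabs_triang|].
    rewrite Rabs_Ropp, !Rabs_mult.
    specialize (Bp x Hx); specialize (Bm x Hx); specialize (Bc x); specialize (Bs x).
    pose proof (Rabs_pos (p x)); pose proof (Rabs_pos (m x - m 0)).
    pose proof (Rabs_pos (cos x)); pose proof (Rabs_pos (sin x)); nra.
  - unfold p; replace (m x) with (u' x * sin x - u x * cos x) by easy.
    pose proof (sin2_cos2 x) as H; unfold Rsqr in H.
    replace (u x - - m 0 * cos x) with (u x * (sin x * sin x + cos x * cos x) - - m 0 * cos x)
      by (rewrite H; ring).
    ring. }
split.
- assert (HI := is_RInt_minus (V := R_NormedModule) _ _ _ _ _ _ He
    (is_RInt_scal (V := R_NormedModule) _ _ _ (- m 0) _ is_RInt_cos_sqr)).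
  (* Integrating the bound 6 G against cos and dividing by PI / 2 puts e within 12 G of - m 0; hence
     18 = 6 + 12. *)
  assert (HB : Rabs (e * (PI / 2) - - m 0 * (PI / 2)) <= PI * (6 * G)).
  { replace (PI * (6 * G)) with ((PI / 2 - - (PI / 2)) * (6 * G)) by field.
    apply (norm_RInt_le_const (V := R_NormedModule)
      (fun x => u x * cos x - - m 0 * cos x ^ 2) (- (PI / 2)) (PI / 2)).
    - lra.
    - intros x Hx; change (Rabs (u x * cos x - - m 0 * cos x ^ 2) <= 6 * G).
      replace (u x * cos x - - m 0 * cos x ^ 2)
        with ((u x - - m 0 * cos x) * cos x) by ring.
      rewrite Rabs_mult; specialize (Bu x Hx); specialize (Bc x).
      pose proof (Rabs_pos (u x - - m 0 * cos x)); pose proof (Rabs_pos (cos x)); nra.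
    - exact HI. }
  assert (HB2 : Rabs (e - - m 0) <= 12 * G).
  { replace (e * (PI / 2) - - m 0 * (PI / 2)) with ((e - - m 0) * (PI / 2)) in HB by ring.
    rewrite Rabs_mult, (Rabs_pos_eq (PI / 2)) in HB by lra; nra. }
  intros x Hx.
  replace (u x - e * cos x) with ((u x - - m 0 * cos x) + - ((e - - m 0) * cos x)) by ring.
  eapply Rle_trans; [apply Rabs_triang|]; rewrite Rabs_Ropp, Rabs_mult.
  specialize (Bu x Hx); specialize (Bc x).
  pose proof (Rabs_pos (e - - m 0)); pose proof (Rabs_pos (cos x)); nra.
- assert (Cg : forall x, continuous g x).
  { intros x; apply (continuous_ext (fun x => - u x - u'' x)).
    - intros t; rewrite Hg; change (- u t - (- u t - g t) = g t)%R; lra.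
    - apply (continuous_minus (V := R_NormedModule)); [|apply Cu''].
      apply (continuous_opp (V := R_NormedModule)), (is_derive_cont _ _ _ (Du x)). }
  replace 0 with (- p (PI / 2) - - p (- (PI / 2))) by (rewrite Hp0, Hp1; ring).
  apply (is_RInt_derive (V := R_CompleteNormedModule) (fun x => - p x)).
  + intros x _; replace (g x * cos x) with (- (- g x * cos x)) by ring.
    apply (is_derive_opp p), Dp.
  + intros x _; apply (continuous_mult (K := R_AbsRing) g cos); [apply Cg|].
    apply (is_derive_cont _ _ _ (is_derive_cos x)).
Qed.

(** E(t) exp(-K t) is nonincreasing and E(t) exp(K t) nondecreasing, so E vanishes to the right of 0
    by the first and to the left by the second. *)
Lemma gronwall_zero (E E' : R -> R) (K : R) :
  (forall x, is_derive E x (E' x)) -> (forall x, Rabs (E' x) <= K * E x) ->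
  (forall x, 0 <= E x) -> E 0 = 0 -> forall x, E x = 0.
Proof.
intros HD HK HE H0 x.
assert (H : forall k, (forall t, is_derive (fun t => E t * exp (k * t)) t
                         ((E' t + k * E t) * exp (k * t)))).
{ intros k t; replace ((E' t + k * E t) * exp (k * t))
    with (E' t * exp (k * t) + E t * (k * exp (k * t))) by ring.
  apply (is_derive_mult E (fun t => exp (k * t)) t);
    [apply HD|auto_derive; [easy|ring]|intros; apply Rmult_comm]. }
assert (HM : forall k, exists c, E x * exp (k * x) = (E' c + k * E c) * exp (k * c) * x).
{ intros k; destruct (MVT_gen (fun t => E t * exp (k * t)) 0 x
    (fun t => (E' t + k * E t) * exp (k * t))) as [c [_ Hc]].
  - intros t _; apply H.
  - intros t _; apply continuity_pt_filterlim, (is_derive_cont _ _ _ (H k t)).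
  - exists c; rewrite H0 in Hc; lra. }
assert (HP : forall t, 0 < exp t) by apply exp_pos.
apply Rle_antisym; [|apply HE].
destruct (Rle_dec 0 x) as [Hx|Hx].
- destruct (HM (- K)) as [c Hc]; specialize (HK c); apply Rabs_le_between in HK.
  pose proof (HP (- K * x)); pose proof (HP (- K * c)).
  assert ((E' c + - K * E c) * exp (- K * c) <= 0) by nra.
  assert (E x * exp (- K * x) <= 0) by (rewrite Hc; nra).
  nra.
- destruct (HM K) as [c Hc]; specialize (HK c); apply Rabs_le_between in HK.
  pose proof (HP (K * x)); pose proof (HP (K * c)).
  assert (0 <= (E' c + K * E c) * exp (K * c)) by nra.
  assert (E x * exp (K * x) <= 0) by (rewrite Hc; nra).
  nra.
Qed.

(** * Complex-valued functions and their mean against the cosine *)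

Lemma Cmod_sqr (z : C) : Cmod z ^ 2 = Re z ^ 2 + Im z ^ 2.
Proof. unfold Cmod; rewrite pow2_sqrt; [easy|]. pose proof (pow2_ge_0 (fst z)); pose proof (pow2_ge_0 (snd z)); lra. Qed.

Lemma Re_le_Cmod (z : C) : Rabs (Re z) <= Cmod z.
Proof.
rewrite <- (Rabs_pos_eq (Cmod z)) by apply Cmod_ge_0; apply Rsqr_le_abs_0.
rewrite !Rsqr_pow2, Cmod_sqr; pose proof (pow2_ge_0 (Im z)); lra.
Qed.

Lemma Im_le_Cmod (z : C) : Rabs (Im z) <= Cmod z.
Proof.
rewrite <- (Rabs_pos_eq (Cmod z)) by apply Cmod_ge_0; apply Rsqr_le_abs_0.
rewrite !Rsqr_pow2, Cmod_sqr; pose proof (pow2_ge_0 (Re z)); lra.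
Qed.

Lemma Cmod_le_Re_Im (z : C) : Cmod z <= Rabs (Re z) + Rabs (Im z).
Proof.
pose proof (Rabs_pos (Re z)); pose proof (Rabs_pos (Im z)).
rewrite <- (Rabs_pos_eq (Cmod z)) by apply Cmod_ge_0.
rewrite <- (Rabs_pos_eq (Rabs (Re z) + Rabs (Im z))) by lra.
apply Rsqr_le_abs_0; rewrite !Rsqr_pow2, Cmod_sqr.
rewrite <- (pow2_abs (Re z)), <- (pow2_abs (Im z)); nra.
Qed.

Definition cderiv (f f' : R -> C) : Prop :=
  forall x, is_derive (fun t => Re (f t)) x (Re (f' x)) /\
            is_derive (fun t => Im (f t)) x (Im (f' x)).

Lemma cderiv_minus f f' g g' : cderiv f f' -> cderiv g g' ->
  cderiv (fun x => f x - g x)%C (fun x => f' x - g' x)%C.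
Proof.
intros H K x; destruct (H x) as [H1 H2]; destruct (K x) as [K1 K2]; split.
- apply (is_derive_minus (fun t => Re (f t)) (fun t => Re (g t)) x _ _ H1 K1).
- apply (is_derive_minus (fun t => Im (f t)) (fun t => Im (g t)) x _ _ H2 K2).
Qed.

(* The amplitude: by (ii), [cmean (branch_U Phi eps) = eps]. *)
Definition cmean (f : R -> C) : C :=
  (2 / PI * RInt (fun x => Re (f x) * cos x) (- (PI / 2)) (PI / 2),
   2 / PI * RInt (fun x => Im (f x) * cos x) (- (PI / 2)) (PI / 2)).

Definition ccont (f : R -> C) : Prop :=
  forall x, continuous (fun t => Re (f t)) x /\ continuous (fun t => Im (f t)) x.

Lemma ccont_cderiv f f' : cderiv f f' -> ccont f.
Proof.
intros H x; destruct (H x) as [H1 H2]; split;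
  [apply (is_derive_cont _ _ _ H1)|apply (is_derive_cont _ _ _ H2)].
Qed.

Lemma ccont_minus f g : ccont f -> ccont g -> ccont (fun x => f x - g x)%C.
Proof.
intros H K x; destruct (H x) as [H1 H2]; destruct (K x) as [K1 K2]; split.
- apply (continuous_minus (V := R_NormedModule) (fun t => Re (f t)) (fun t => Re (g t)) x H1 K1).
- apply (continuous_minus (V := R_NormedModule) (fun t => Im (f t)) (fun t => Im (g t)) x H2 K2).
Qed.

Lemma ccont_plus f g : ccont f -> ccont g -> ccont (fun x => f x + g x)%C.
Proof.
intros H K x; destruct (H x) as [H1 H2]; destruct (K x) as [K1 K2]; split.
- apply (continuous_plus (V := R_NormedModule) (fun t => Re (f t)) (fun t => Re (g t)) x H1 K1).
- apply (continuous_plus (V := R_NormedModule) (fun t => Im (f t)) (fun t => Im (g t)) x H2 K2).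
Qed.

Lemma ccont_mult f g : ccont f -> ccont g -> ccont (fun x => f x * g x)%C.
Proof.
intros H K x; destruct (H x) as [H1 H2]; destruct (K x) as [K1 K2]; split.
- apply (continuous_minus (V := R_NormedModule)
    (fun t => Re (f t) * Re (g t)) (fun t => Im (f t) * Im (g t)) x).
  + now apply (continuous_mult (K := R_AbsRing) (fun t => Re (f t)) (fun t => Re (g t))).
  + now apply (continuous_mult (K := R_AbsRing) (fun t => Im (f t)) (fun t => Im (g t))).
- apply (continuous_plus (V := R_NormedModule)
    (fun t => Re (f t) * Im (g t)) (fun t => Im (f t) * Re (g t)) x).
  + now apply (continuous_mult (K := R_AbsRing) (fun t => Re (f t)) (fun t => Im (g t))).
  + now apply (continuous_mult (K := R_AbsRing) (fun t => Im (f t)) (fun t => Re (g t))).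
Qed.

Lemma ccont_const c : ccont (fun _ => c).
Proof. intros x; split; apply continuous_const. Qed.

Lemma ccont_Cmod_sqr f : ccont f -> ccont (fun x => RtoC (Cmod (f x) ^ 2)).
Proof.
intros H x; destruct (H x) as [H1 H2]; split; [|apply continuous_const].
apply (continuous_ext (fun t => Re (f t) * Re (f t) + Im (f t) * Im (f t))).
- intros t; change (Re (f t) * Re (f t) + Im (f t) * Im (f t) = Cmod (f t) ^ 2).
  rewrite Cmod_sqr; ring.
- apply (continuous_plus (V := R_NormedModule)
    (fun t => Re (f t) * Re (f t)) (fun t => Im (f t) * Im (f t)) x).
  + now apply (continuous_mult (K := R_AbsRing) (fun t => Re (f t)) (fun t => Re (f t))).
  + now apply (continuous_mult (K := R_AbsRing) (fun t => Im (f t)) (fun t => Im (f t))).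
Qed.

Lemma ex_RInt_cos (f : R -> R) : (forall x, continuous f x) ->
  ex_RInt (fun x => f x * cos x) (- (PI / 2)) (PI / 2).
Proof.
intros H; apply (ex_RInt_continuous (V := R_CompleteNormedModule)); intros z _.
apply (continuous_mult (K := R_AbsRing) f cos); [apply H|].
apply (is_derive_cont _ _ _ (is_derive_cos z)).
Qed.

Lemma is_RInt_cmean f : ccont f ->
  is_RInt (fun x => Re (f x) * cos x) (- (PI / 2)) (PI / 2) (Re (cmean f) * (PI / 2)) /\
  is_RInt (fun x => Im (f x) * cos x) (- (PI / 2)) (PI / 2) (Im (cmean f) * (PI / 2)).
Proof.
intros H; pose proof PI_RGT_0.
assert (E : forall I, 2 / PI * I * (PI / 2) = I) by (intros; field; lra).
unfold cmean; simpl Re; simpl Im; unfold Re at 2, Im at 2; simpl; rewrite !E.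
split; apply (RInt_correct (V := R_CompleteNormedModule)), ex_RInt_cos; intros x; apply H.
Qed.

Lemma cmean_unique f a b :
  is_RInt (fun x => Re (f x) * cos x) (- (PI / 2)) (PI / 2) (a * (PI / 2)) ->
  is_RInt (fun x => Im (f x) * cos x) (- (PI / 2)) (PI / 2) (b * (PI / 2)) ->
  cmean f = (a, b).
Proof.
intros Ha Hb; unfold cmean; pose proof PI_RGT_0.
apply (is_RInt_unique (V := R_CompleteNormedModule)) in Ha, Hb; f_equal; [rewrite Ha|rewrite Hb]; field; lra.
Qed.

Lemma cmean_minus f g : ccont f -> ccont g ->
  cmean (fun x => f x - g x)%C = (cmean f - cmean g)%C.
Proof.
intros H K; destruct (is_RInt_cmean f H) as [H1 H2]; destruct (is_RInt_cmean g K) as [K1 K2].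
apply cmean_unique.
- pose proof (is_RInt_minus (V := R_NormedModule) _ _ _ _ _ _ H1 K1) as I.
  replace (_ * (PI / 2)) with (minus (Re (cmean f) * (PI / 2)) (Re (cmean g) * (PI / 2))).
  + revert I; apply is_RInt_ext; intros x _; unfold minus, plus, opp; simpl; unfold Re; ring.
  + unfold minus, plus, opp; simpl; unfold Re; ring.
- pose proof (is_RInt_minus (V := R_NormedModule) _ _ _ _ _ _ H2 K2) as I.
  replace (_ * (PI / 2)) with (minus (Im (cmean f) * (PI / 2)) (Im (cmean g) * (PI / 2))).
  + revert I; apply is_RInt_ext; intros x _; unfold minus, plus, opp; simpl; unfold Im; ring.
  + unfold minus, plus, opp; simpl; unfold Im; ring.
Qed.

Lemma cmean_scal (c : C) f : ccont f -> cmean (fun x => c * f x)%C = (c * cmean f)%C.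
Proof.
intros H; destruct (is_RInt_cmean f H) as [H1 H2].
apply cmean_unique.
- pose proof (is_RInt_minus (V := R_NormedModule) _ _ _ _ _ _
   (is_RInt_scal (V := R_NormedModule) _ _ _ (Re c) _ H1)
   (is_RInt_scal (V := R_NormedModule) _ _ _ (Im c) _ H2)) as I.
  replace (_ * (PI / 2)) with
    (minus (scal (Re c) (Re (cmean f) * (PI / 2))) (scal (Im c) (Im (cmean f) * (PI / 2)))).
  + revert I; apply is_RInt_ext; intros x _; unfold minus, plus, opp, scal; simpl.
    unfold mult; simpl; unfold Re, Im; ring.
  + unfold minus, plus, opp, scal; simpl; unfold mult; simpl; unfold Re, Im; ring.
- pose proof (is_RInt_plus (V := R_NormedModule) _ _ _ _ _ _
   (is_RInt_scal (V := R_NormedModule) _ _ _ (Re c) _ H2)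
   (is_RInt_scal (V := R_NormedModule) _ _ _ (Im c) _ H1)) as I.
  replace (_ * (PI / 2)) with
    (plus (scal (Re c) (Im (cmean f) * (PI / 2))) (scal (Im c) (Re (cmean f) * (PI / 2)))).
  + revert I; apply is_RInt_ext; intros x _; unfold minus, plus, opp, scal; simpl.
    unfold mult; simpl; unfold Re, Im; ring.
  + unfold minus, plus, opp, scal; simpl; unfold mult; simpl; unfold Re, Im; ring.
Qed.

Lemma cmean_bound f G : ccont f ->
  (forall x, - (PI / 2) <= x <= PI / 2 -> Cmod (f x) <= G) -> Cmod (cmean f) <= 4 * G.
Proof.
intros H HG; pose proof PI_RGT_0.
assert (HR : forall (g : R -> R) a,
  (forall x, - (PI / 2) <= x <= PI / 2 -> Rabs (g x) <= G) ->
  is_RInt (fun x => g x * cos x) (- (PI / 2)) (PI / 2) (a * (PI / 2)) ->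
  Rabs a <= 2 * G).
{ intros g a Hg Ha.
  assert (HB : Rabs (a * (PI / 2)) <= (PI / 2 - - (PI / 2)) * G).
  { apply (norm_RInt_le_const (V := R_NormedModule) (fun x => g x * cos x)
      (- (PI / 2)) (PI / 2)); [lra| |exact Ha].
    intros x Hx; change (Rabs (g x * cos x) <= G); rewrite Rabs_mult.
    specialize (Hg x Hx); pose proof (Rabs_cos_le x).
    pose proof (Rabs_pos (g x)); pose proof (Rabs_pos (cos x)); nra. }
  rewrite Rabs_mult, (Rabs_pos_eq (PI / 2)) in HB by lra.
  apply Rmult_le_reg_r with (PI / 2); lra. }
destruct (is_RInt_cmean f H) as [H1 H2].
eapply Rle_trans; [apply Cmod_le_Re_Im|].
replace (4 * G) with (2 * G + 2 * G) by ring; apply Rplus_le_compat.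
- apply (HR (fun x => Re (f x))); [|exact H1].
  intros x Hx; eapply Rle_trans; [apply Re_le_Cmod|now apply HG].
- apply (HR (fun x => Im (f x))); [|exact H2].
  intros x Hx; eapply Rle_trans; [apply Im_le_Cmod|now apply HG].
Qed.

(** The linear problem is real, so real and imaginary parts are estimated separately, at 18 G
    each. *)
Lemma cdirichlet_estimate (f f1 f2 g : R -> C) (G : R) :
  cderiv f f1 -> cderiv f1 f2 -> ccont f2 -> (forall x, f2 x = - f x - g x)%C ->
  f (- (PI / 2)) = RtoC 0 -> f (PI / 2) = RtoC 0 ->
  (forall x, - (PI / 2) <= x <= PI / 2 -> Cmod (g x) <= G) ->
  (forall x, - (PI / 2) <= x <= PI / 2 ->
     Cmod (f x - cmean f * RtoC (cos x))%C <= 36 * G) /\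
  cmean g = RtoC 0.
Proof.
intros D1 D2 C2 E Hl Hr HG.
destruct (is_RInt_cmean f (ccont_cderiv _ _ D1)) as [I1 I2].
destruct (dirichlet_estimate (fun x => Re (f x)) (fun x => Re (f1 x)) (fun x => Re (f2 x))
  (fun x => Re (g x)) (Re (cmean f)) G) as [B1 Z1].
- intros x; apply D1.
- intros x; apply D2.
- intros x; apply C2.
- intros x; rewrite E; reflexivity.
- now rewrite Hl.
- now rewrite Hr.
- intros x Hx; eapply Rle_trans; [apply Re_le_Cmod|now apply HG].
- exact I1.
- destruct (dirichlet_estimate (fun x => Im (f x)) (fun x => Im (f1 x)) (fun x => Im (f2 x))
    (fun x => Im (g x)) (Im (cmean f)) G) as [B2 Z2].
  + intros x; apply D1.
  + intros x; apply D2.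
  + intros x; apply C2.
  + intros x; rewrite E; reflexivity.
  + now rewrite Hl.
  + now rewrite Hr.
  + intros x Hx; eapply Rle_trans; [apply Im_le_Cmod|now apply HG].
  + exact I2.
  + split.
    * intros x Hx; eapply Rle_trans; [apply Cmod_le_Re_Im|].
      specialize (B1 x Hx); specialize (B2 x Hx).
      replace (Re (f x - cmean f * RtoC (cos x)))%C
        with (Re (f x) - Re (cmean f) * cos x) by (unfold Re; simpl; ring).
      replace (Im (f x - cmean f * RtoC (cos x)))%C
        with (Im (f x) - Im (cmean f) * cos x) by (unfold Im; simpl; ring).
      lra.
    * apply cmean_unique; rewrite Rmult_0_l; assumption.
Qed.

(** Supplies the supremum for the contraction arguments: being least, m inherits a pointwise bound c
    + m / 2, and so m <= 2 c. *)
Lemma least_bound (I : R -> Prop) (f : R -> R) (x0 B : R) : I x0 ->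
  (forall x, I x -> 0 <= f x <= B) ->
  exists m, 0 <= m /\ (forall x, I x -> f x <= m) /\
    forall m', (forall x, I x -> f x <= m') -> m <= m'.
Proof.
intros H0 HB.
destruct (completeness (fun y => exists x, I x /\ y = f x)) as [m [H1 H2]].
- exists B; intros y [x [Hx ->]]; now apply HB.
- now exists (f x0), x0.
- assert (Hm : forall x, I x -> f x <= m) by (intros x Hx; apply H1; now exists x).
  exists m; split; [|split; [exact Hm|]].
  + specialize (HB x0 H0); specialize (Hm x0 H0); lra.
  + intros m' Hm'; apply H2; intros y [x [Hx ->]]; now apply Hm'.
Qed.

Definition nonlin (r z : C) : C := ((r - RtoC (Cmod z ^ 2)) * z)%C.

Lemma ccont_nonlin r f : ccont f -> ccont (fun x => nonlin r (f x)).
Proof.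
intros H; apply (ccont_mult (fun x => r - RtoC (Cmod (f x) ^ 2))%C f); [|exact H].
apply (ccont_minus (fun _ => r)); [apply ccont_const|now apply ccont_Cmod_sqr].
Qed.

Lemma nonlin_le r z eta m : Cmod r <= eta -> Cmod z <= eta -> Cmod z <= m ->
  Cmod (nonlin r z) <= (eta + eta ^ 2) * m.
Proof.
intros Hr Hz Hm; unfold nonlin; rewrite Cmod_mult.
pose proof (Cmod_ge_0 z); pose proof (Cmod_ge_0 r).
apply Rmult_le_compat; [apply Cmod_ge_0|easy| |easy].
unfold Cminus; eapply Rle_trans; [apply Cmod_triangle|].
rewrite Cmod_opp, Cmod_R, Rabs_pos_eq by (apply pow2_ge_0).
apply Rplus_le_compat; [easy|]. apply pow_incr; lra.
Qed.

(** From |z|^2 z - |w|^2 w = |z|^2 (z - w) + (|z|^2 - |w|^2) w, whose two terms contribute 1 and 2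
    to the constant. *)
Lemma cubic_lipschitz (z w : C) eta : Cmod z <= eta -> Cmod w <= eta ->
  Cmod (RtoC (Cmod z ^ 2) * z - RtoC (Cmod w ^ 2) * w)%C <= 3 * eta ^ 2 * Cmod (z - w)%C.
Proof.
intros Hz Hw.
pose proof (Cmod_ge_0 z) as Z; pose proof (Cmod_ge_0 w) as W.
pose proof (Cmod_ge_0 (z - w)%C) as D.
assert (H : Rabs (Cmod z ^ 2 - Cmod w ^ 2) <= 2 * eta * Cmod (z - w)%C).
{ replace (Cmod z ^ 2 - Cmod w ^ 2) with ((Cmod z + Cmod w) * (Cmod z - Cmod w)) by ring.
  rewrite Rabs_mult, (Rabs_pos_eq (Cmod z + Cmod w)) by lra.
  assert (Rabs (Cmod z - Cmod w) <= Cmod (z - w)%C).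
  { apply Rabs_le; split.
    - pose proof (Cmod_triangle (- (z - w)) z)%C as T.
      replace (- (z - w) + z)%C with w in T by ring.
      rewrite Cmod_opp in T; lra.
    - pose proof (Cmod_triangle (z - w) w)%C as T.
      replace (z - w + w)%C with z in T by ring; lra. }
  pose proof (Rabs_pos (Cmod z - Cmod w)); nra. }
replace (RtoC (Cmod z ^ 2) * z - RtoC (Cmod w ^ 2) * w)%C
  with (RtoC (Cmod z ^ 2) * (z - w) + RtoC (Cmod z ^ 2 - Cmod w ^ 2) * w)%C
  by (rewrite RtoC_minus; ring).
eapply Rle_trans; [apply Cmod_triangle|]; rewrite !Cmod_mult, !Cmod_R.
rewrite (Rabs_pos_eq (Cmod z ^ 2)) by apply pow2_ge_0.
pose proof (Rabs_pos (Cmod z ^ 2 - Cmod w ^ 2)).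
assert (Cmod z ^ 2 * Cmod (z - w)%C <= eta ^ 2 * Cmod (z - w)%C).
{ apply Rmult_le_compat_r; [easy|]. apply pow_incr; lra. }
assert (Rabs (Cmod z ^ 2 - Cmod w ^ 2) * Cmod w <= (2 * eta * Cmod (z - w)%C) * eta).
{ apply Rmult_le_compat; easy. }
nra.
Qed.

(* [U1], [U2] are the derivatives of [U]; only the zeros [-pi/2, pi/2] of
   [cos] matter. *)
Definition bvp_sol (rho r : C) (U U1 U2 : R -> C) : Prop :=
  cderiv U U1 /\ cderiv U1 U2 /\ ccont U2 /\
  (forall x, U2 x = - U x - rho * nonlin r (U x))%C /\
  U (- (PI / 2)) = RtoC 0 /\ U (PI / 2) = RtoC 0.

Section Uniqueness.

Variables (rho : C) (eta : R).
Hypothesis Hrho : rho <> RtoC 0.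
Hypothesis Heta : 0 < eta.
Hypothesis Hsmall : 648 * Cmod rho * (eta + 3 * eta ^ 2) <= 1.

(** With m the supremum of |U|, the linear estimate gives m <= |cmean U| + m / 2. A bound
    proportional to the amplitude is what later compensates the weak control of r - r'. *)
Lemma bvp_bound r U U1 U2 : bvp_sol rho r U U1 U2 -> Cmod r <= eta ->
  (forall x, - (PI / 2) <= x <= PI / 2 -> Cmod (U x) <= eta) ->
  forall x, - (PI / 2) <= x <= PI / 2 -> Cmod (U x) <= 2 * Cmod (cmean U).
Proof.
intros (D1 & D2 & C2 & E & Hl & Hr) Hreta HU.
pose proof PI_RGT_0; pose proof (Cmod_ge_0 rho).
destruct (least_bound (fun x => - (PI / 2) <= x <= PI / 2) (fun x => Cmod (U x)) 0 eta)
  as [m [Hm0 [Hm1 Hm2]]].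
- lra.
- intros x Hx; split; [apply Cmod_ge_0|now apply HU].
- destruct (cdirichlet_estimate U U1 U2 (fun x => rho * nonlin r (U x))%C
    (Cmod rho * ((eta + eta ^ 2) * m)) D1 D2 C2 E Hl Hr) as [B _].
  { intros x Hx; rewrite Cmod_mult; apply Rmult_le_compat_l; [easy|].
    apply nonlin_le; auto. }
  assert (Hm : m <= Cmod (cmean U) + m / 2).
  { apply Hm2; intros x Hx; specialize (B x Hx).
    replace (U x) with ((U x - cmean U * RtoC (cos x)) + cmean U * RtoC (cos x))%C by ring.
    eapply Rle_trans; [apply Cmod_triangle|]; rewrite Cmod_mult, Cmod_R.
    pose proof (Rabs_cos_le x); pose proof (Rabs_pos (cos x)).
    pose proof (Cmod_ge_0 (cmean U)).
    assert (Cmod rho * (eta + eta ^ 2) <= / 648).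
    { assert (0 <= eta ^ 2) by apply pow2_ge_0.
      assert (Cmod rho * (eta + eta ^ 2) <= Cmod rho * (eta + 3 * eta ^ 2)) by nra.
      lra. }
    assert (36 * (Cmod rho * ((eta + eta ^ 2) * m)) <= m / 2) by nra.
    nra. }
  intros x Hx; specialize (Hm1 x Hx); lra.
Qed.

Lemma bvp_unique r r' U U1 U2 V V1 V2 :
  bvp_sol rho r U U1 U2 -> bvp_sol rho r' V V1 V2 -> Cmod r <= eta -> Cmod r' <= eta ->
  (forall x, - (PI / 2) <= x <= PI / 2 -> Cmod (U x) <= eta) ->
  (forall x, - (PI / 2) <= x <= PI / 2 -> Cmod (V x) <= eta) ->
  cmean U = cmean V -> cmean U <> RtoC 0 ->
  r = r' /\ forall x, - (PI / 2) <= x <= PI / 2 -> U x = V x.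
Proof.
intros HU HV Hr Hr' BU BV Hm Hm0.
pose proof (bvp_bound r U U1 U2 HU Hr BU) as BU2.
destruct HU as (D1 & D2 & CU2 & E & Hl & Hrt).
destruct HV as (F1 & F2 & CV2 & E' & Hl' & Hrt').
pose proof PI_RGT_0; pose proof (Cmod_ge_0 rho) as Hrho0.
pose proof (ccont_cderiv _ _ D1) as CU; pose proof (ccont_cderiv _ _ F1) as CV.
assert (Hcd : ccont (fun x => U x - V x)%C) by now apply ccont_minus.
assert (Heps : 0 < Cmod (cmean U)) by now apply Cmod_gt_0.
(* Orthogonality of the nonlinear term to cos, with the nonzero factor [rho] divided out. *)
assert (Hmean : forall r U U1 U2, cderiv U U1 -> cderiv U1 U2 -> ccont U2 ->
  (forall x, U2 x = - U x - rho * nonlin r (U x))%C ->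
  U (- (PI / 2)) = RtoC 0 -> U (PI / 2) = RtoC 0 -> Cmod r <= eta ->
  (forall x, - (PI / 2) <= x <= PI / 2 -> Cmod (U x) <= eta) ->
  cmean (fun x => nonlin r (U x)) = RtoC 0).
{ clear - Hrho Hrho0; intros r U U1 U2 D1 D2 C2 E Hl Hrt Hr BU.
  destruct (cdirichlet_estimate U U1 U2 (fun x => rho * nonlin r (U x))%C
    (Cmod rho * ((eta + eta ^ 2) * eta)) D1 D2 C2 E Hl Hrt) as [_ Z].
  { intros x Hx; rewrite Cmod_mult; apply Rmult_le_compat_l; [easy|].
    apply nonlin_le; auto. }
  rewrite cmean_scal in Z by apply ccont_nonlin, (ccont_cderiv _ _ D1).
  apply (f_equal (Cmult (/ rho))) in Z.
  rewrite Cmult_assoc, Cinv_l, Cmult_1_l, Cmult_0_r in Z by exact Hrho; exact Z. }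
pose proof (Hmean r U U1 U2 D1 D2 CU2 E Hl Hrt Hr BU) as MU.
pose proof (Hmean r' V V1 V2 F1 F2 CV2 E' Hl' Hrt' Hr' BV) as MV.
clear Hmean.
(* The nonlinear terms differ by (r - r') U + h, where h is Lipschitz in U - V. Taking means, (r -
   r') times the amplitude is minus the mean of h. *)
set (h := fun x => (r' * (U x - V x)
            - (RtoC (Cmod (U x) ^ 2) * U x - RtoC (Cmod (V x) ^ 2) * V x))%C).
assert (Ch : ccont h).
{ apply (ccont_minus (fun x => r' * (U x - V x))%C).
  - apply ccont_mult; [apply ccont_const|exact Hcd].
  - apply (ccont_minus (fun x => RtoC (Cmod (U x) ^ 2) * U x)%C
      (fun x => RtoC (Cmod (V x) ^ 2) * V x)%C);
      apply ccont_mult; try apply ccont_Cmod_sqr; assumption. }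
assert (Hn : forall x, (nonlin r (U x) - nonlin r' (V x) = (r - r') * U x + h x)%C).
{ intros x; unfold nonlin, h; ring. }
assert (Hrr : ((r - r') * cmean U = - cmean h)%C).
{ assert (Z : cmean h = (cmean (fun x => nonlin r (U x))
      - cmean (fun x => nonlin r' (V x)) - (r - r') * cmean U)%C).
  { rewrite <- cmean_minus, <- cmean_scal, <- cmean_minus; auto using ccont_nonlin.
    - f_equal; apply functional_extensionality; intros x; rewrite Hn; ring.
    - apply ccont_minus; now apply ccont_nonlin.
    - apply ccont_mult; [apply ccont_const|exact CU]. }
  rewrite Z, MU, MV; ring. }
destruct (least_bound (fun x => - (PI / 2) <= x <= PI / 2)
  (fun x => Cmod (U x - V x)%C) 0 (2 * eta)) as [D [HD0 [HD1 HD2]]].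
{ lra. }
{ intros x Hx; split; [apply Cmod_ge_0|].
  unfold Cminus; eapply Rle_trans; [apply Cmod_triangle|]; rewrite Cmod_opp.
  specialize (BU x Hx); specialize (BV x Hx); lra. }
assert (Bh : forall x, - (PI / 2) <= x <= PI / 2 -> Cmod (h x) <= (eta + 3 * eta ^ 2) * D).
{ intros x Hx; unfold h; unfold Cminus at 1.
  eapply Rle_trans; [apply Cmod_triangle|]; rewrite Cmod_opp, Cmod_mult.
  pose proof (cubic_lipschitz _ _ eta (BU x Hx) (BV x Hx)).
  pose proof (HD1 x Hx) as HDx; cbv beta in HDx.
  pose proof (Cmod_ge_0 (U x - V x)%C); pose proof (Cmod_ge_0 r').
  pose proof (pow2_ge_0 eta).
  assert (Cmod r' * Cmod (U x - V x)%C <= eta * D) by (apply Rmult_le_compat; easy).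
  assert (3 * eta ^ 2 * Cmod (U x - V x)%C <= 3 * eta ^ 2 * D) by nra.
  lra. }
assert (Br : Cmod (r - r')%C * Cmod (cmean U) <= 4 * ((eta + 3 * eta ^ 2) * D)).
{ rewrite <- Cmod_mult, Hrr, Cmod_opp; now apply cmean_bound. }
assert (Ed : forall x, (U2 x - V2 x
   = - (U x - V x) - rho * (nonlin r (U x) - nonlin r' (V x)))%C).
{ intros x; rewrite E, E'; ring. }
(* 9 = 2 * 4 + 1: since |U| is at most twice the amplitude, the factor 4 in [Br] becomes 8 for (r -
   r') U, and h adds 1. As 36 * 9 is half of 648, [Hsmall] yields the contraction factor 1/2. *)
destruct (cdirichlet_estimate (fun x => U x - V x)%C (fun x => U1 x - V1 x)%C
  (fun x => U2 x - V2 x)%C (fun x => rho * (nonlin r (U x) - nonlin r' (V x)))%C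
  (Cmod rho * (9 * ((eta + 3 * eta ^ 2) * D)))) as [B _].
- now apply cderiv_minus.
- now apply cderiv_minus.
- now apply ccont_minus.
- exact Ed.
- rewrite Hl, Hl'; ring.
- rewrite Hrt, Hrt'; ring.
- intros x Hx; rewrite Cmod_mult, Hn; apply Rmult_le_compat_l; [easy|].
  eapply Rle_trans; [apply Cmod_triangle|]; rewrite Cmod_mult.
  specialize (Bh x Hx); specialize (BU2 x Hx).
  pose proof (Cmod_ge_0 (r - r')%C); nra.
- assert (HD : D <= D / 2).
  { apply HD2; intros x Hx; specialize (B x Hx).
    rewrite cmean_minus, Hm in B by assumption.
    replace (U x - V x - (cmean V - cmean V) * RtoC (cos x))%C with (U x - V x)%C in B by ring.
    eapply Rle_trans; [exact B|]. nra. }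
  assert (D = 0) as -> by lra.
  split.
  + assert (Z : Cmod (r - r')%C = 0).
    { pose proof (Cmod_ge_0 (r - r')%C); nra. }
    apply Cmod_eq_0 in Z; replace r with ((r - r') + r')%C by ring; rewrite Z; ring.
  + intros x Hx; specialize (HD1 x Hx); cbv beta in HD1.
    pose proof (Cmod_ge_0 (U x - V x)%C).
    assert (Z : Cmod (U x - V x)%C = 0) by lra.
    apply Cmod_eq_0 in Z; replace (U x) with ((U x - V x) + V x)%C by ring; rewrite Z; ring.
Qed.

End Uniqueness.

(** Boundedness of U and V gives the cubic term one Lipschitz constant on the whole line, so an
    energy estimate applies globally. *)
Lemma ivp_unique rho r U U1 U2 V V1 V2 M :
  cderiv U U1 -> cderiv U1 U2 -> cderiv V V1 -> cderiv V1 V2 ->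
  (forall x, U2 x = - U x - rho * nonlin r (U x))%C ->
  (forall x, V2 x = - V x - rho * nonlin r (V x))%C ->
  (forall x, Cmod (U x) <= M) -> (forall x, Cmod (V x) <= M) ->
  U 0 = V 0 -> U1 0 = V1 0 -> forall x, U x = V x.
Proof.
intros D1 D2 F1 F2 E E' BU BV H0 H1 x.
set (d := fun x => (U x - V x)%C); set (d1 := fun x => (U1 x - V1 x)%C).
set (d2 := fun x => (U2 x - V2 x)%C).
assert (Dd : cderiv d d1) by now apply cderiv_minus.
assert (Dd1 : cderiv d1 d2) by now apply cderiv_minus.
set (K := Cmod rho * (Cmod r + 3 * M ^ 2)).
assert (HK : 0 <= K).
{ apply Rmult_le_pos; [apply Cmod_ge_0|].
  pose proof (Cmod_ge_0 r); pose proof (pow2_ge_0 M); lra. }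
assert (Hd2 : forall x, Cmod (d2 x + d x)%C <= K * Cmod (d x)).
{ intros t; unfold d2, d; rewrite E, E'.
  replace (- U t - rho * nonlin r (U t) - (- V t - rho * nonlin r (V t)) + (U t - V t))%C
    with (- (rho * (r * (U t - V t)
            + - (RtoC (Cmod (U t) ^ 2) * U t - RtoC (Cmod (V t) ^ 2) * V t))))%C
    by (unfold nonlin; ring).
  rewrite Cmod_opp, Cmod_mult; unfold K; rewrite Rmult_assoc.
  apply Rmult_le_compat_l; [apply Cmod_ge_0|].
  eapply Rle_trans; [apply Cmod_triangle|]; rewrite Cmod_opp, Cmod_mult.
  pose proof (cubic_lipschitz _ _ M (BU t) (BV t)); lra. }
(* The energy |d|^2 + |d'|^2 is conserved by d'' = - d, so its derivative involves only d'' + d,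
   which [Hd2] bounds by K |d|. *)
set (En := fun x => Re (d x) * Re (d x) + Im (d x) * Im (d x)
                    + (Re (d1 x) * Re (d1 x) + Im (d1 x) * Im (d1 x))).
assert (HE : forall x, En x = 0).
{ apply (gronwall_zero En (fun x =>
    2 * Re (d x) * Re (d1 x) + 2 * Im (d x) * Im (d1 x)
    + (2 * Re (d1 x) * Re (d2 x) + 2 * Im (d1 x) * Im (d2 x))) (2 * K)).
  - assert (Hsq : forall (f f' : R -> R) t, is_derive f t (f' t) ->
      is_derive (fun t => f t * f t) t (2 * f t * f' t)).
    { intros f f' t Hf; replace (2 * f t * f' t) with (f' t * f t + f t * f' t) by ring.
      apply (is_derive_mult f f t); [exact Hf|exact Hf|intros; apply Rmult_comm]. }
    intros t; destruct (Dd t) as [A1 A2]; destruct (Dd1 t) as [A3 A4].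
    apply (is_derive_plus (fun x => Re (d x) * Re (d x) + Im (d x) * Im (d x))
             (fun x => Re (d1 x) * Re (d1 x) + Im (d1 x) * Im (d1 x))).
    + apply (is_derive_plus (fun x => Re (d x) * Re (d x)) (fun x => Im (d x) * Im (d x))).
      * apply (Hsq (fun t => Re (d t)) (fun t => Re (d1 t)) t A1).
      * apply (Hsq (fun t => Im (d t)) (fun t => Im (d1 t)) t A2).
    + apply (is_derive_plus (fun x => Re (d1 x) * Re (d1 x)) (fun x => Im (d1 x) * Im (d1 x))).
      * apply (Hsq (fun t => Re (d1 t)) (fun t => Re (d2 t)) t A3).
      * apply (Hsq (fun t => Im (d1 t)) (fun t => Im (d2 t)) t A4).
  - intros t; specialize (Hd2 t).
    pose proof (Re_le_Cmod (d2 t + d t)%C) as R1; pose proof (Im_le_Cmod (d2 t + d t)%C) as R2.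
    change (Re (d2 t + d t)%C) with (Re (d2 t) + Re (d t)) in R1.
    change (Im (d2 t + d t)%C) with (Im (d2 t) + Im (d t)) in R2.
    pose proof (Cmod_sqr (d t)) as Q; pose proof (Cmod_ge_0 (d t)) as Q0.
    unfold En; set (n := Cmod (d t)) in *.
    set (a := Re (d t)) in *; set (b := Im (d t)) in *.
    set (a1 := Re (d1 t)); set (b1 := Im (d1 t)).
    set (h1 := Re (d2 t) + a) in *; set (h2 := Im (d2 t) + b) in *.
    replace (2 * a * a1 + 2 * b * b1 + (2 * a1 * Re (d2 t) + 2 * b1 * Im (d2 t)))
      with (2 * (a1 * h1) + 2 * (b1 * h2)) by (unfold h1, h2; ring).
    (* By 2 |y| n <= y^2 + n^2; the two components of d' then add up to K (|d'|^2 + 2 |d|^2) <= 2 K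
       En. *)
    assert (Hy : forall y h, Rabs h <= K * n -> Rabs (2 * (y * h)) <= K * (y * y + n * n)).
    { intros y h Hh; rewrite !Rabs_mult, (Rabs_pos_eq 2) by lra.
      assert (Rabs y * Rabs h <= Rabs y * (K * n)).
      { apply Rmult_le_compat_l; [apply Rabs_pos|exact Hh]. }
      replace (y * y) with (Rabs y * Rabs y) by (rewrite <- Rabs_mult; apply Rabs_pos_eq; nra).
      assert (0 <= K * (Rabs y - n) ^ 2) by (apply Rmult_le_pos; [easy|apply pow2_ge_0]).
      nra. }
    eapply Rle_trans; [apply Rabs_triang|].
    pose proof (Hy a1 h1 ltac:(lra)); pose proof (Hy b1 h2 ltac:(lra)).
    assert (0 <= K * (a1 * a1 + b1 * b1)) by (apply Rmult_le_pos; nra).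
    replace (n * n) with (a * a + b * b) in * by lra.
    nra.
  - intros t; unfold En; nra.
  - unfold En, d, d1; rewrite H0, H1.
    replace (V 0 - V 0)%C with (RtoC 0) by ring; replace (V1 0 - V1 0)%C with (RtoC 0) by ring.
    simpl; ring. }
specialize (HE x); unfold En in HE.
assert (Z1 : Re (d x) = 0) by nra; assert (Z2 : Im (d x) = 0) by nra.
replace (U x) with (d x + V x)%C by (unfold d; ring).
replace (d x) with (RtoC 0); [ring|].
destruct (d x) as [a b]; unfold Re, Im in Z1, Z2; simpl in Z1, Z2; now rewrite Z1, Z2.
Qed.

(** * The bifurcating branch *)

(** What is kept of the formal solution once it is summed: A + i B = w / cos x, R1 + i R2 = R and F1
    + i F2 = (R - |w|^2) w / cos x. The lists [c1 k] and [c2 k] are constants, so R does not depend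
    on x. *)
Definition branch_data (rho1 rho2 rad : R) (a b c1 c2 : nat -> list R) : Prop :=
  0 < rad <= 1 /\
  admissible rad a /\ admissible rad b /\ admissible rad c1 /\ admissible rad c2 /\
  a O = [1] /\ b O = [] /\ c1 O = [3 / 4] /\ c2 O = [0] /\
  (forall k, exists r, c1 k = [r]) /\ (forall k, exists r, c2 k = [r]) /\
  (forall k, lam 0 (a (S k)) = 0) /\ (forall k, lam 0 (b k) = 0) /\
  forall s x, Rabs s <= rad ->
    let A := gev a s x in let B := gev b s x in
    let R1 := gev c1 s x in let R2 := gev c2 s x in
    let F1 := R1 * A - R2 * B - cos x ^ 2 * (A * A + B * B) * A in
    let F2 := R1 * B + R2 * A - cos x ^ 2 * (A * A + B * B) * B in
    is_derive (Derive (fun x => cos x * gev a s x)) x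
      (- (cos x * A) - s * (cos x * (rho1 * F1 - rho2 * F2))) /\
    is_derive (Derive (fun x => cos x * gev b s x)) x
      (- (cos x * B) - s * (cos x * (rho1 * F2 + rho2 * F1))).

Lemma branch_data_exists (rho1 rho2 : R) :
  exists rad a b c1 c2, branch_data rho1 rho2 rad a b c1 c2.
Proof.
destruct (profile_exists rho1 rho2) as (a & b & Ha0 & Hb0 & HaS & HbS).
set (t := Rabs rho1 + Rabs rho2).
assert (Ht : 0 <= t) by (pose proof (Rabs_pos rho1); pose proof (Rabs_pos rho2); unfold t; lra).
(* 160 * 36 is the constant of [Hsmall] for Y = 36; t + 1 allows t = 0 and keeps rad <= 1. *)
set (rad := / (160 * 36 * (t + 1))).
assert (Hr0 : 0 < rad) by (apply Rinv_0_lt_compat; lra).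
assert (Hr1 : rad * (160 * 36 * (t + 1)) = 1) by (unfold rad; field; lra).
assert (Hr2 : rad * (160 * 36 * t) <= 1) by nra.
assert (Y1 : 1 <= 36) by lra.
assert (HN := snorm_profile rho1 rho2 a b Ha0 Hb0 HaS HbS 36 rad Y1 Hr0 Hr2).
assert (HP := fun c K => snorm_pos 36 rad Y1 Hr0 c K).
assert (Ba : forall K, snorm 36 rad a K <= 2).
{ intros K; pose proof (HN K); pose proof (HP b K); lra. }
assert (Bb : forall K, snorm 36 rad b K <= 2).
{ intros K; pose proof (HN K); pose proof (HP a K); lra. }
assert (Aa : admissible rad a) by now apply admissible_bounded with 2.
assert (Ab : admissible rad b) by now apply admissible_bounded with 2.
assert (Ac : forall c, (forall K, snorm 36 rad c K <= 2) -> admissible rad (resc a b c)).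
{ intros c Hc; apply admissible_bounded with (16 * 36); [exact Hr0|]; intros K.
  pose proof (snorm_resc_le a b 36 rad Y1 Hr0 c K (HN K) (Hc K)).
  specialize (Hc K); lra. }
assert (A1 := Ac a Ba); assert (A2 := Ac b Bb).
assert (Asq : admissible rad (fun k => padd (conv a a k) (conv b b k))).
{ apply admissible_add; try apply admissible_conv; assumption. }
assert (Acu : forall c, admissible rad c -> admissible rad (cubic a b c)).
{ intros c Hc; apply admissible_cons0; [exact Hr0|].
  apply admissible_conv; assumption. }
assert (Are : admissible rad (rhs_re a b)).
{ unfold rhs_re; repeat (apply admissible_add || apply admissible_scal
    || apply admissible_conv || apply Acu); assumption. }
assert (Aim : admissible rad (rhs_im a b)).
{ unfold rhs_im; repeat (apply admissible_add || apply admissible_scal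
    || apply admissible_conv || apply Acu); assumption. }
assert (Gcu : forall c s x, Rabs s <= rad -> admissible rad c ->
  gev (cubic a b c) s x = cos x ^ 2 *
    ((gev a s x * gev a s x + gev b s x * gev b s x) * gev c s x)).
{ intros c s x Hs Hc; unfold cubic.
  rewrite (gev_cons0 s (conv (fun i => padd (conv a a i) (conv b b i)) c)).
  rewrite (gev_conv rad s Hs) by assumption.
  rewrite (gev_add rad s Hs) by (apply admissible_conv; assumption).
  now rewrite !(gev_conv rad s Hs) by assumption. }
assert (Gre : forall s x, Rabs s <= rad -> gev (rhs_re a b) s x =
  gev (resc a b a) s x * gev a s x - gev (resc a b b) s x * gev b s x
  - cos x ^ 2 * (gev a s x * gev a s x + gev b s x * gev b s x) * gev a s x).
{ intros s x Hs; unfold rhs_re.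
  rewrite !(gev_add rad s Hs) by (repeat (apply admissible_add || apply admissible_scal
    || apply admissible_conv || apply Acu); assumption).
  rewrite !gev_scal, !(gev_conv rad s Hs), Gcu by assumption; ring. }
assert (Gim : forall s x, Rabs s <= rad -> gev (rhs_im a b) s x =
  gev (resc a b a) s x * gev b s x + gev (resc a b b) s x * gev a s x
  - cos x ^ 2 * (gev a s x * gev a s x + gev b s x * gev b s x) * gev b s x).
{ intros s x Hs; unfold rhs_im.
  rewrite !(gev_add rad s Hs) by (repeat (apply admissible_add || apply admissible_scal
    || apply admissible_conv || apply Acu); assumption).
  rewrite !gev_scal, !(gev_conv rad s Hs), Gcu by assumption; ring. }
assert (Lre := lam_rhs_re rho1 rho2 a b Ha0 Hb0 HaS HbS).
assert (Lim := lam_rhs_im rho1 rho2 a b Ha0 Hb0 HaS HbS).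
exists rad, a, b, (resc a b a), (resc a b b); unfold branch_data.
repeat match goal with |- _ /\ _ => split end; try assumption.
- nra.
(* The 3/4 in the expansion of r: the mean of cos^2 for the weight cos^2, that is [wallis 0]. *)
- unfold resc, cubic, conv; simpl; rewrite Ha0, Hb0; simpl.
  unfold wallis; simpl; f_equal; field.
- unfold resc, cubic, conv; simpl; rewrite Ha0, Hb0; simpl; f_equal; ring.
- intros k; now eexists.
- intros k; now eexists.
- exact (lam_a rho1 rho2 a b HaS).
- exact (lam_b rho1 rho2 a b Hb0 HbS).
- intros s x Hs; split.
  + rewrite <- Gre, <- Gim by assumption.
    replace (rho1 * gev (rhs_re a b) s x - rho2 * gev (rhs_im a b) s x)
      with (gev (fun k => padd (pscal rho1 (rhs_re a b k)) (pscal (- rho2) (rhs_im a b k))) s x).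
    2: { rewrite (gev_add rad s Hs) by (apply admissible_scal; assumption).
         rewrite !gev_scal; ring. }
    apply (gev_ode rad s Hs); try assumption.
    * apply admissible_add; try apply admissible_scal; assumption.
    * exists 1; intros y; rewrite Ha0; simpl; ring.
    * intros k; rewrite lam_add, !lam_scal, Lre, Lim; ring.
  + rewrite <- Gre, <- Gim by assumption.
    replace (rho1 * gev (rhs_im a b) s x + rho2 * gev (rhs_re a b) s x)
      with (gev (fun k => padd (pscal rho1 (rhs_im a b k)) (pscal rho2 (rhs_re a b k))) s x).
    2: { rewrite (gev_add rad s Hs) by (apply admissible_scal; assumption).
         rewrite !gev_scal; ring. }
    apply (gev_ode rad s Hs); try assumption.
    * apply admissible_add; try apply admissible_scal; assumption.
    * exists 0; intros y; now rewrite Hb0.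
    * intros k; rewrite lam_add, !lam_scal, Lre, Lim; ring.
Qed.

(** * Passing between complex functions and their components *)

Lemma is_derive_C (f1 f2 : R -> R) x l1 l2 :
  is_derive f1 x l1 -> is_derive f2 x l2 ->
  is_derive (V := C_R_NormedModule) (fun t => (f1 t, f2 t) : C) x ((l1, l2) : C).
Proof.
intros H1 H2.
apply (filterdiff_ext_lin _ (fun y : R => (scal y l1, scal y l2) : C_R_NormedModule)).
- apply (filterdiff_comp'_2 (W := C_R_NormedModule) f1 f2 (fun u v => (u, v) : C_R_NormedModule) x
    (fun y => scal y l1) (fun y => scal y l2) (fun u v => (u, v) : C_R_NormedModule) H1 H2).
  apply (filterdiff_ext_lin _ (fun t : C_R_NormedModule => t)).
  + apply (filterdiff_ext (fun t : C_R_NormedModule => t)); [now intros []|].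
    apply filterdiff_id.
  + now intros [].
- easy.
Qed.

Lemma continuous_C (f : R -> C) x :
  continuous (fun t => Re (f t)) x -> continuous (fun t => Im (f t)) x -> continuous f x.
Proof.
intros H1 H2; apply filterlim_locally; intros eps.
generalize (proj1 (filterlim_locally _ _) H1 eps) (proj1 (filterlim_locally _ _) H2 eps).
intros K1 K2; generalize (filter_and _ _ K1 K2); apply filter_imp.
intros t [T1 T2]; split; assumption.
Qed.

Lemma continuous_Re_Im (f : R -> C) x : continuous f x ->
  continuous (fun t => Re (f t)) x /\ continuous (fun t => Im (f t)) x.
Proof.
intros H; split; apply filterlim_locally; intros eps;
  generalize (proj1 (filterlim_locally _ _) H eps); apply filter_imp; intros t [T1 T2]; assumption.
Qed.

Lemma cderiv_CDerive f f' : cderiv f f' -> CDerive f = f'.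
Proof.
intros H; apply functional_extensionality; intros x; destruct (H x) as [H1 H2].
apply is_derive_unique in H1, H2; rewrite (surjective_pairing (f' x)).
exact (f_equal2 pair H1 H2).
Qed.

Lemma is_C2_cderiv f f1 f2 : cderiv f f1 -> cderiv f1 f2 -> ccont f2 -> is_C2 f.
Proof.
intros D1 D2 C2.
assert (H : forall g g', cderiv g g' -> forall x, ex_derive (V := C_R_NormedModule) g x).
{ intros g g' D x; destruct (D x) as [A B]; exists ((Re (g' x), Im (g' x)) : C).
  apply (is_derive_ext (fun t => (Re (g t), Im (g t)) : C)); [intros t; now destruct (g t)|].
  now apply is_derive_C. }
split; [|split].
- now apply H with f1.
- rewrite (cderiv_CDerive _ _ D1); now apply H with f2.
- rewrite (cderiv_CDerive _ _ D1), (cderiv_CDerive _ _ D2); intros x.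
  destruct (C2 x); now apply continuous_C.
Qed.

Lemma ex_derive_cderiv f : (forall x, ex_derive (V := C_R_NormedModule) f x) ->
  cderiv f (CDerive f).
Proof.
intros H x; pose proof (CDerive_correct f x (H x)) as D; split.
- apply (filterdiff_comp f (fun z : C_R_NormedModule => fst z)
           _ (fun z : C_R_NormedModule => fst z) D).
  apply filterdiff_linear, (is_linear_fst (K := R_AbsRing)
    (U := R_NormedModule) (V := R_NormedModule)).
- apply (filterdiff_comp f (fun z : C_R_NormedModule => snd z)
           _ (fun z : C_R_NormedModule => snd z) D).
  apply filterdiff_linear, (is_linear_snd (K := R_AbsRing)
    (U := R_NormedModule) (V := R_NormedModule)).
Qed.

Lemma C2R_cderiv (U : C2R) :
  cderiv U (CDerive U) /\ cderiv (CDerive U) (CDerive (CDerive U)) /\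
  ccont (CDerive (CDerive U)).
Proof.
destruct (C2R_prop U) as (H1 & H2 & H3); split; [|split].
- now apply ex_derive_cderiv.
- now apply ex_derive_cderiv.
- intros x; now apply continuous_Re_Im.
Qed.

Lemma cderiv_scal (c : C) f f' : cderiv f f' ->
  cderiv (fun x => c * f x)%C (fun x => c * f' x)%C.
Proof.
intros H x; destruct (H x) as [H1 H2]; split.
- apply (is_derive_minus (fun t => Re c * Re (f t)) (fun t => Im c * Im (f t)) x).
  + now apply (is_derive_scal (fun t => Re (f t))).
  + now apply (is_derive_scal (fun t => Im (f t))).
- apply (is_derive_plus (fun t => Re c * Im (f t)) (fun t => Im c * Re (f t)) x).
  + now apply (is_derive_scal (fun t => Im (f t))).
  + now apply (is_derive_scal (fun t => Re (f t))).
Qed.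

Lemma cderiv_eq_at (f f' g g' : R -> C) (x d : R) : 0 < d ->
  cderiv f f' -> cderiv g g' -> (forall t, Rabs (t - x) < d -> f t = g t) -> f' x = g' x.
Proof.
intros Hd D1 D2 E; destruct (D1 x) as [A1 B1]; destruct (D2 x) as [A2 B2].
assert (HL : locally x (fun t => f t = g t)).
{ exists (mkposreal d Hd); intros t Ht; apply E; exact Ht. }
assert (H1 : Re (f' x) = Re (g' x)).
{ apply is_derive_unique in A1; rewrite <- A1; apply is_derive_unique.
  apply (is_derive_ext_loc (fun t => Re (g t))); [|exact A2].
  revert HL; apply filter_imp; intros t ->; easy. }
assert (H2 : Im (f' x) = Im (g' x)).
{ apply is_derive_unique in B1; rewrite <- B1; apply is_derive_unique.
  apply (is_derive_ext_loc (fun t => Im (g t))); [|exact B2].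
  revert HL; apply filter_imp; intros t ->; easy. }
destruct (f' x), (g' x); unfold Re, Im in H1, H2; simpl in H1, H2; now rewrite H1, H2.
Qed.

Lemma solves_E_iff mu nu n r (U : C2R) : solves_E mu nu n r U <->
  forall x, CDerive (CDerive U) x = (- U x - rho mu nu n * nonlin r (U x))%C.
Proof.
unfold solves_E, nonlin; split; intros H x; specialize (H x).
- rewrite Cmult_assoc, <- H; ring.
- rewrite H, Cmult_assoc; ring.
Qed.

Lemma rho_neq_0 mu nu n : (0 < n)%nat -> rho mu nu n <> RtoC 0.
Proof.
intros Hn; unfold rho.
assert (H : forall t : R, (1 + Ci * t)%C <> RtoC 0).
{ intros t E; apply (f_equal Re) in E; unfold Re in E; simpl in E; lra. }
assert (Hd : ((1 + Ci * nu) * RtoC (INR n ^ 2))%C <> RtoC 0).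
{ apply Cmult_neq_0; [apply H|].
  intros E; apply RtoC_inj in E; revert E; apply pow_nonzero, not_0_INR; lia. }
intros E; apply (H mu); unfold Cdiv in E.
apply (f_equal (fun z => z * ((1 + Ci * nu) * RtoC (INR n ^ 2)))%C) in E.
rewrite <- Cmult_assoc, Cinv_l, Cmult_0_l, Cmult_1_r in E by exact Hd; exact E.
Qed.

(** * The branch as a function of the amplitude *)

Section Branch.

Variables (rho : C) (rad : R) (a b c1 c2 : nat -> list R).
Hypothesis Hdata : branch_data (Re rho) (Im rho) rad a b c1 c2.

(** The function w of the ansatz U = eps w, at s = |eps|^2. *)
Definition prof (s x : R) : C := (cos x * gev a s x, cos x * gev b s x).

Definition prof1 (s x : R) : C :=
  (Derive (fun x => cos x * gev a s x) x, Derive (fun x => cos x * gev b s x) x).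

Definition prof2 (s x : R) : C :=
  (Derive (Derive (fun x => cos x * gev a s x)) x,
   Derive (Derive (fun x => cos x * gev b s x)) x).

(** The function R in r = s R, read at x = 0 because its series is constant in x. *)
Definition param (s : R) : C := (gev c1 s 0, gev c2 s 0).

(** From R = (3/4) (1 + s phi): shifting the series by one order divides by s without a singularity
    at s = 0. [Phi_of] arises likewise from w / cos x = 1 + s Phi. *)
Definition phi_of (s : R) : C :=
  (4 / 3 * gev (fun k => c1 (S k)) s 0, 4 / 3 * gev (fun k => c2 (S k)) s 0).

Definition Phi_of (p : R * R) : C :=
  (gev (fun k => a (S k)) (fst p) (snd p), gev (fun k => b (S k)) (fst p) (snd p)).

(** The expansions at all points x share one norm bound, whence the uniformity; 12 = 2 * 6 because
    the second derivative is 2 a_2. The plain series serves Phi, its product with cos x serves w. *)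
Lemma gev_C2 c : admissible rad c -> exists M, 0 <= M /\ forall s x, Rabs s <= rad ->
  (forall f, (f = gev c s \/ f = (fun x => cos x * gev c s x)) ->
  ex_derive f x /\ ex_derive (Derive f) x /\ continuous (Derive (Derive f)) x /\
  Rabs (f x) <= M /\ Rabs (Derive f x) <= M /\ Rabs (Derive (Derive f) x) <= M).
Proof.
clear Hdata; intros Hc.
set (B := Series (term_bound rad c)); exists (12 * Rabs B).
split; [pose proof (Rabs_pos B); lra|].
intros s x Hs.
destruct (pser_cos x 1) as [ccos Hcos]; [lra|].
assert (HP : forall A f, pser x 1 (6 * Rabs B) A f ->
  ex_derive f x /\ ex_derive (Derive f) x /\ continuous (Derive (Derive f)) x /\
  Rabs (f x) <= 12 * Rabs B /\ Rabs (Derive f x) <= 12 * Rabs B /\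
  Rabs (Derive (Derive f) x) <= 12 * Rabs B).
{ intros A f H; destruct (pser_C2 x 1 _ _ _ Rlt_0_1 H) as (D1 & D2 & C2 & E0).
  pose proof (Rabs_pos B).
  assert (HA : forall i, Rabs (A i) <= 6 * Rabs B).
  { intros i; pose proof (pser_coef_le x 1 Rlt_0_1 _ _ _ i H) as K.
    rewrite pow1, Rmult_1_r in K; exact K. }
  split; [exact (ex_intro _ _ D1)|]. split; [exact (ex_intro _ _ D2)|].
  split; [exact C2|].
  rewrite (is_derive_unique _ _ _ D1), (is_derive_unique _ _ _ D2), E0.
  rewrite Rabs_mult, (Rabs_pos_eq 2) by lra.
  pose proof (HA 0%nat); pose proof (HA 1%nat); pose proof (HA 2%nat).
  repeat split; lra. }
intros f [-> | ->].
- eapply HP, pser_le; [|apply (pser_gev rad s Hs x 1 ltac:(lra) ccos Hcos c Hc)].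
  fold B; pose proof (Rle_abs B); pose proof (Rabs_pos B); lra.
- eapply HP, pser_le; [|apply (pser_gev_cos rad s Hs x 1 ltac:(lra) ccos Hcos c Hc)].
  fold B; pose proof (Rle_abs B); lra.
Qed.

Lemma prof_cderiv s : Rabs s <= rad ->
  cderiv (prof s) (prof1 s) /\ cderiv (prof1 s) (prof2 s) /\ ccont (prof2 s).
Proof.
intros Hs; destruct Hdata as (_ & Aa & Ab & _).
destruct (gev_C2 a Aa) as [Ma [_ Ha]]; destruct (gev_C2 b Ab) as [Mb [_ Hb]].
split; [|split]; intros x;
  destruct (Ha s x Hs _ (or_intror eq_refl)) as (A1 & A2 & A3 & _);
  destruct (Hb s x Hs _ (or_intror eq_refl)) as (B1 & B2 & B3 & _).
- split; [apply (Derive_correct _ x A1)|apply (Derive_correct _ x B1)].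
- split; [apply (Derive_correct _ x A2)|apply (Derive_correct _ x B2)].
- split; [exact A3|exact B3].
Qed.

Lemma prof_bounded : exists K, 0 <= K /\ forall s x, Rabs s <= rad ->
  Cmod (prof s x) <= K /\ Cmod (prof1 s x) <= K /\ Cmod (prof2 s x) <= K.
Proof.
destruct Hdata as (_ & Aa & Ab & _).
destruct (gev_C2 a Aa) as [Ma [Ma0 Ha]]; destruct (gev_C2 b Ab) as [Mb [Mb0 Hb]].
exists (Ma + Mb); split; [lra|]; intros s x Hs.
destruct (Ha s x Hs _ (or_intror eq_refl)) as (_ & _ & _ & A1 & A2 & A3).
destruct (Hb s x Hs _ (or_intror eq_refl)) as (_ & _ & _ & B1 & B2 & B3).
repeat split; (eapply Rle_trans; [apply Cmod_le_Re_Im|]); apply Rplus_le_compat; assumption.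
Qed.

Lemma param_bounded : exists K, 0 <= K /\ forall s, Rabs s <= rad -> Cmod (param s) <= K.
Proof.
destruct Hdata as (_ & _ & _ & A1 & A2 & _).
destruct (gev_C2 c1 A1) as [M1 [M10 H1]]; destruct (gev_C2 c2 A2) as [M2 [M20 H2]].
exists (M1 + M2); split; [lra|]; intros s Hs.
destruct (H1 s 0 Hs _ (or_introl eq_refl)) as (_ & _ & _ & K1 & _).
destruct (H2 s 0 Hs _ (or_introl eq_refl)) as (_ & _ & _ & K2 & _).
eapply Rle_trans; [apply Cmod_le_Re_Im|]; apply Rplus_le_compat; assumption.
Qed.

Lemma param_phi_of s : Rabs s <= rad ->
  param s = (RtoC (3 / 4) * (1 + RtoC s * phi_of s))%C.
Proof.
intros Hs; destruct Hdata as (_ & _ & _ & A1 & A2 & _ & _ & E1 & E2 & _).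
unfold param, phi_of; rewrite (gev_succ rad s Hs c1 0 A1), (gev_succ rad s Hs c2 0 A2), E1, E2.
apply injective_projections; simpl; field.
Qed.

Lemma prof_Phi_of s x : Rabs s <= rad ->
  prof s x = ((1 + RtoC s * Phi_of (s, x)) * RtoC (cos x))%C.
Proof.
intros Hs; destruct Hdata as (_ & Aa & Ab & _ & _ & E1 & E2 & _).
unfold prof, Phi_of; rewrite (gev_succ rad s Hs a x Aa), (gev_succ rad s Hs b x Ab), E1, E2.
apply injective_projections; simpl; ring.
Qed.

Lemma prof_ode s x : Rabs s <= rad ->
  prof2 s x = (- prof s x - rho * (RtoC s * nonlin (param s) (prof s x)))%C.
Proof.
intros Hs; destruct Hdata as (_ & _ & _ & _ & _ & _ & _ & _ & _ & K1 & K2 & _ & _ & H).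
specialize (H s x Hs); cbv zeta in H; destruct H as [Ha Hb].
assert (Hconst : forall c, (forall k, exists r, c k = [r]) -> gev c s x = gev c s 0).
{ intros c Hc; apply Series_ext; intros k; destruct (Hc k) as [r ->]; simpl; ring. }
rewrite (Hconst c1 K1), (Hconst c2 K2) in Ha, Hb.
unfold prof2, nonlin; rewrite Cmod_sqr.
rewrite (is_derive_unique _ _ _ Ha), (is_derive_unique _ _ _ Hb).
unfold prof, param; destruct rho as [p q]; apply injective_projections; simpl; ring.
Qed.

Lemma is_RInt_Phi_of s : Rabs s <= rad ->
  is_RInt (fun x => Re (Phi_of (s, x)) * cos x ^ 2) (- (PI / 2)) (PI / 2) 0 /\
  is_RInt (fun x => Im (Phi_of (s, x)) * cos x ^ 2) (- (PI / 2)) (PI / 2) 0.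
Proof.
intros Hs; destruct Hdata as (Hr & Aa & Ab & _ & _ & _ & _ & _ & _ & _ & _ & L1 & L2 & _).
split.
- apply (is_RInt_gev rad s Hs (fun k => a (S k))); [apply admissible_succ; [lra|exact Aa]|exact L1].
- apply (is_RInt_gev rad s Hs (fun k => b (S k))); [apply admissible_succ; [lra|exact Ab]|].
  intros k; apply L2.
Qed.

Lemma cmean_prof s : Rabs s <= rad -> cmean (prof s) = RtoC 1.
Proof.
intros Hs; destruct (is_RInt_Phi_of s Hs) as [I1 I2].
destruct Hdata as (_ & Aa & Ab & _ & _ & E1 & E2 & _).
pose proof PI_RGT_0.
apply (cmean_unique (prof s) 1 0).
- rewrite Rmult_1_l.
  pose proof (is_RInt_plus (V := R_NormedModule) _ _ _ _ _ _ is_RInt_cos_sqr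
    (is_RInt_scal (V := R_NormedModule) _ _ _ s _ I1)) as HI.
  replace (plus _ _) with (PI / 2) in HI.
  2: { unfold plus, scal; simpl; unfold mult; simpl; ring. }
  revert HI; apply is_RInt_ext; intros x _; rewrite (prof_Phi_of s x Hs).
  unfold plus, scal; simpl; unfold mult; simpl; unfold Re; simpl; ring.
- rewrite Rmult_0_l.
  pose proof (is_RInt_scal (V := R_NormedModule) _ _ _ s _ I2) as HI.
  replace (scal _ _) with 0 in HI.
  2: { unfold scal; simpl; unfold mult; simpl; ring. }
  revert HI; apply is_RInt_ext; intros x _; rewrite (prof_Phi_of s x Hs).
  unfold plus, scal; simpl; unfold mult; simpl; unfold Im; simpl; ring.
Qed.

Lemma branch_r_param eps : Cmod eps ^ 2 <= rad ->
  branch_r phi_of eps = (RtoC (Cmod eps ^ 2) * param (Cmod eps ^ 2))%C.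
Proof.
intros He; unfold branch_r; rewrite param_phi_of.
- rewrite RtoC_mult; ring.
- rewrite Rabs_pos_eq; [exact He|apply pow2_ge_0].
Qed.

Lemma branch_U_prof eps x : Cmod eps ^ 2 <= rad ->
  branch_U Phi_of eps x = (eps * prof (Cmod eps ^ 2) x)%C.
Proof.
intros He; unfold branch_U; rewrite prof_Phi_of.
- ring.
- rewrite Rabs_pos_eq; [exact He|apply pow2_ge_0].
Qed.

(** Since |eps w|^2 eps w = s eps |w|^2 w, both parts of the nonlinearity carry the factor s eps,
    and the equation for w becomes (E). *)
Lemma branch_U_bvp eps : Cmod eps ^ 2 <= rad ->
  bvp_sol rho (branch_r phi_of eps) (branch_U Phi_of eps)
    (fun x => eps * prof1 (Cmod eps ^ 2) x)%C (fun x => eps * prof2 (Cmod eps ^ 2) x)%C.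
Proof.
intros He.
assert (Hs : Rabs (Cmod eps ^ 2) <= rad).
{ rewrite Rabs_pos_eq; [exact He|apply pow2_ge_0]. }
replace (branch_U Phi_of eps) with (fun x => eps * prof (Cmod eps ^ 2) x)%C.
2: { apply functional_extensionality; intros x; symmetry; now apply branch_U_prof. }
destruct (prof_cderiv _ Hs) as (D1 & D2 & C2).
split; [now apply cderiv_scal|]. split; [now apply cderiv_scal|].
split; [now apply ccont_mult; [apply ccont_const|]|].
split; [|split].
- intros x; rewrite branch_r_param by exact He; rewrite (prof_ode _ x Hs).
  unfold nonlin; rewrite Cmod_mult, Rpow_mult_distr, RtoC_mult; ring.
- unfold prof; rewrite cos_neg, cos_PI2, !Rmult_0_l; apply Cmult_0_r.
- unfold prof; rewrite cos_PI2, !Rmult_0_l; apply Cmult_0_r.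
Qed.

Lemma cmean_branch_U eps : Cmod eps ^ 2 <= rad -> cmean (branch_U Phi_of eps) = eps.
Proof.
intros He.
assert (Hs : Rabs (Cmod eps ^ 2) <= rad).
{ rewrite Rabs_pos_eq; [exact He|apply pow2_ge_0]. }
replace (branch_U Phi_of eps) with (fun x => eps * prof (Cmod eps ^ 2) x)%C.
2: { apply functional_extensionality; intros x; symmetry; now apply branch_U_prof. }
rewrite cmean_scal, cmean_prof by (exact Hs || apply (ccont_cderiv _ _ (proj1 (prof_cderiv _ Hs)))).
apply Cmult_1_r.
Qed.

Lemma is_C2_Phi_of s : Rabs s <= rad -> is_C2 (fun x => Phi_of (s, x)).
Proof.
intros Hs; destruct Hdata as (Hr & Aa & Ab & _).
destruct (gev_C2 (fun k => a (S k))) as [Ma [_ Ha]]; [apply admissible_succ; [lra|exact Aa]|].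
destruct (gev_C2 (fun k => b (S k))) as [Mb [_ Hb]]; [apply admissible_succ; [lra|exact Ab]|].
set (f := gev (fun k => a (S k)) s) in *; set (g := gev (fun k => b (S k)) s) in *.
apply (is_C2_cderiv (fun x => (f x, g x)) (fun x => (Derive f x, Derive g x))
  (fun x => (Derive (Derive f) x, Derive (Derive g) x)));
  intros x; destruct (Ha s x Hs f (or_introl eq_refl)) as (A1 & A2 & A3 & _);
  destruct (Hb s x Hs g (or_introl eq_refl)) as (B1 & B2 & B3 & _).
- split; [apply (Derive_correct _ x A1)|apply (Derive_correct _ x B1)].
- split; [apply (Derive_correct _ x A2)|apply (Derive_correct _ x B2)].
- split; [exact A3|exact B3].
Qed.

(** For 0 <= s0 < rad / 2 the interval of radius rad / 2 around s0 stays within [-rad, rad]; this is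
    why delta is kept below rad / 2. *)
Lemma gev_analytic_on c x delta k : admissible rad c -> 0 < rad <= 1 -> delta <= rad / 2 ->
  analytic_on (fun s => 0 <= s < delta) (fun s => k * gev c s x).
Proof.
clear Hdata; intros Hc Hr Hd s0 Hs0; cbv beta in Hs0.
destruct (pser_gev_s rad c s0 x (rad / 2) Hc) as [A [M HA]];
  [lra|rewrite Rabs_pos_eq; lra|].
exists (fun i => k * A i), (rad / 2); split; [lra|]; intros s _ Hs.
replace s with (s0 + (s - s0)) at 2 by ring.
apply (pser_scal s0 (rad / 2) _ _ _ k HA); exact Hs.
Qed.

Lemma gev_analytic2_on c delta : admissible rad c -> 0 < rad <= 1 -> delta <= rad / 2 ->
  analytic2_on (fun p => 0 <= fst p < delta) (fun p => gev c (fst p) (snd p)).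
Proof.
clear Hdata; intros Hc Hr Hd p0 Hp0; cbv beta in Hp0.
destruct (pser2_gev rad c (fst p0) (snd p0) (rad / 2) Hc) as [A [M HA]];
  [lra|rewrite Rabs_pos_eq; lra|].
exists A, (rad / 2); split; [lra|]; intros p _ H1 H2.
pose proof (pser2_is_pseries2 _ _ _ _ _ _ _ _ HA H1 H2) as K.
replace (fst p0 + (fst p - fst p0)) with (fst p) in K by ring.
replace (snd p0 + (snd p - snd p0)) with (snd p) in K by ring.
exact K.
Qed.

Lemma continuous_continuous_on {T V : UniformSpace} (D : T -> Prop) (f : T -> V) :
  (forall x, D x -> continuous f x) -> continuous_on D f.
Proof.
intros H x Hx; apply (filterlim_filter_le_1 (F := locally x)); [|now apply H].
apply filter_le_within.
Qed.

Lemma continuous_pair_C {T : UniformSpace} (f g : T -> R) (x : T) :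
  continuous f x -> continuous g x -> continuous (fun t => (f t, g t) : C) x.
Proof.
intros H1 H2; apply filterlim_locally; intros eps.
generalize (filter_and _ _ (proj1 (filterlim_locally _ _) H1 eps)
                           (proj1 (filterlim_locally _ _) H2 eps)).
apply filter_imp; intros t [T1 T2]; split; assumption.
Qed.

Lemma phi_of_continuous_on delta : delta <= rad / 2 ->
  continuous_on (fun s => 0 <= s < delta) phi_of.
Proof.
intros Hd; destruct Hdata as (Hr & _ & _ & A1 & A2 & _).
apply continuous_continuous_on; intros s Hs.
assert (H : forall c, admissible rad c -> continuous (fun s => 4 / 3 * gev c s 0) s).
{ intros c Hc; destruct (pser_gev_s rad c s 0 (rad / 2) Hc) as [A [M HA]];
    [lra|rewrite Rabs_pos_eq; lra|].
  apply (pser_scal s (rad / 2) _ _ _ (4 / 3)) in HA.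
  apply (is_derive_cont _ _ _ (proj1 (pser_C2 s (rad / 2) _ _ _ ltac:(lra) HA))). }
apply continuous_pair_C; apply H; apply admissible_succ; lra || assumption.
Qed.

Lemma Phi_of_continuous_on delta : delta <= rad / 2 ->
  continuous_on (fun p : R * R => 0 <= fst p < delta) Phi_of.
Proof.
intros Hd; destruct Hdata as (Hr & Aa & Ab & _).
apply continuous_continuous_on; intros [s x] Hs; simpl in Hs.
assert (H : forall c, admissible rad c ->
  continuous (fun p : R * R => gev c (fst p) (snd p)) (s, x)).
{ intros c Hc; destruct (pser2_gev rad c s x (rad / 2) Hc) as [A [M HA]];
    [lra|rewrite Rabs_pos_eq; lra|].
  apply (pser2_continuous s x (rad / 2) ltac:(lra) M A (gev c) HA). }
apply continuous_pair_C; apply H; apply admissible_succ; lra || assumption.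
Qed.

End Branch.

(** * The neighbourhood of the origin and the comparison of solutions in it *)

Lemma Gamma_bvp mu nu n r (U : C2R) : Gamma mu nu n r U ->
  bvp_sol (rho mu nu n) r U (CDerive U) (CDerive (CDerive U)) /\
  exists M, forall x, Cmod (U x) <= M.
Proof.
intros (_ & HE & v & _ & [M HM] & Hv).
destruct (C2R_cderiv U) as (D1 & D2 & C2).
split.
- split; [exact D1|]. split; [exact D2|]. split; [exact C2|].
  split; [now apply solves_E_iff|].
  split; rewrite Hv; [rewrite cos_neg|]; rewrite cos_PI2; apply Cmult_0_r.
- exists M; intros x; rewrite Hv, Cmod_mult, Cmod_R.
  pose proof (Rabs_cos_le x); pose proof (Rabs_pos (cos x)); pose proof (Cmod_ge_0 (v x)).
  specialize (HM x); nra.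
Qed.

Lemma cmean_zero : cmean (fun _ => RtoC 0) = RtoC 0.
Proof.
apply (cmean_unique _ 0 0); rewrite Rmult_0_l; apply is_RInt_zero; intros x; apply Rmult_0_l.
Qed.

Lemma nontrivial_cmean (U : C2R) : cmean U <> RtoC 0 -> nontrivial U.
Proof.
intros H; apply NNPP; intros HN; apply H.
rewrite <- cmean_zero; f_equal; apply functional_extensionality; intros x.
apply NNPP; intros Hx; apply HN; now exists x.
Qed.

(** [-2, 2] contains [-pi/2, pi/2], where the estimates take place. The slack eta' < eta makes the
    condition on U open, and the condition on the mean keeps the amplitude of every member below
    gamma. *)
Definition small_nbhd (eta gamma : R) (p : C * C2R) : Prop :=
  Cmod (fst p) < eta /\
  (exists eta', eta' < eta /\ forall x, Rabs x <= 2 -> Cmod (snd p x) <= eta') /\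
  Cmod (cmean (snd p)) < gamma.

Lemma open_small_nbhd eta gamma : open (small_nbhd eta gamma).
Proof.
intros [r U] (H1 & [eta' [He H2]] & H3); simpl in H1, H2, H3.
(* 1/2 makes the ball control [-2, 2]. The divisors leave room for changes of at most 2 e in r, e in
   the bound on U and 4 e in its mean. *)
set (e := Rmin (Rmin (1 / 2) ((eta - Cmod r) / 4)) (Rmin ((eta - eta') / 2)
            ((gamma - Cmod (cmean U)) / 8))).
assert (He0 : 0 < e) by (unfold e; repeat apply Rmin_pos; lra).
assert (E1 : e <= 1 / 2) by (eapply Rle_trans; [apply Rmin_l|apply Rmin_l]).
assert (E2 : e <= (eta - Cmod r) / 4) by (eapply Rle_trans; [apply Rmin_l|apply Rmin_r]).
assert (E3 : e <= (eta - eta') / 2) by (eapply Rle_trans; [apply Rmin_r|apply Rmin_l]).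
assert (E4 : e <= (gamma - Cmod (cmean U)) / 8)
  by (eapply Rle_trans; [apply Rmin_r|apply Rmin_r]).
exists (mkposreal e He0); intros [r' V] [[B1 B2] [_ B3]]; simpl in B1, B2, B3.
change (Rabs (Re r' - Re r) < e) in B1; change (Rabs (Im r' - Im r) < e) in B2.
assert (HV : forall x, Rabs x <= 2 -> Cmod (U x - V x)%C < e).
{ intros x Hx; apply B3; pose proof (Rabs_pos x); nra. }
split; [|split]; simpl.
- replace r' with (r + (r' - r))%C by ring.
  eapply Rle_lt_trans; [apply Cmod_triangle|].
  pose proof (Cmod_le_Re_Im (r' - r)%C) as K.
  change (Re (r' - r)%C) with (Re r' - Re r) in K.
  change (Im (r' - r)%C) with (Im r' - Im r) in K; lra.
- exists (eta' + e); split; [lra|]; intros x Hx.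
  replace (V x) with (U x + - (U x - V x))%C by ring.
  eapply Rle_trans; [apply Cmod_triangle|]; rewrite Cmod_opp.
  specialize (H2 x Hx); specialize (HV x Hx); lra.
- pose proof (ccont_cderiv _ _ (proj1 (C2R_cderiv U))) as CU.
  pose proof (ccont_cderiv _ _ (proj1 (C2R_cderiv V))) as CV.
  assert (K : Cmod (cmean U - cmean V)%C <= 4 * e).
  { rewrite <- cmean_minus by assumption; apply cmean_bound; [now apply ccont_minus|].
    intros x Hx; apply Rlt_le, HV, Rabs_le; pose proof PI_4; lra. }
  replace (cmean V) with (cmean U + - (cmean U - cmean V))%C by ring.
  eapply Rle_lt_trans; [apply Cmod_triangle|]; rewrite Cmod_opp; lra.
Qed.

Lemma CDerive_zero : CDerive (fun _ => RtoC 0) = (fun _ => RtoC 0).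
Proof.
apply cderiv_CDerive; intros x; split; apply @is_derive_const.
Qed.

(** With mean 0, [bvp_bound] makes U vanish on [-pi/2, pi/2]; its data at 0 are then those of the
    zero solution, so U vanishes everywhere, against nontriviality. *)
Lemma bvp_zero_of_cmean_zero mu nu n r (U : C2R) eta :
  648 * Cmod (rho mu nu n) * (eta + 3 * eta ^ 2) <= 1 -> Gamma mu nu n r U ->
  Cmod r <= eta -> (forall x, - (PI / 2) <= x <= PI / 2 -> Cmod (U x) <= eta) ->
  cmean U <> RtoC 0.
Proof.
intros Hsm HG Hr HU H0.
destruct (Gamma_bvp _ _ _ _ _ HG) as [HB [M HM]].
pose proof (bvp_bound _ _ Hsm _ _ _ _ HB Hr HU) as HZ; rewrite H0, Cmod_0 in HZ.
pose proof PI2_1 as Hpi.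
assert (HI : forall x, Rabs (x - 0) < 1 -> U x = RtoC 0).
{ intros x Hx; apply Cmod_eq_0; apply Rabs_def2 in Hx.
  specialize (HZ x ltac:(lra)); pose proof (Cmod_ge_0 (U x)); lra. }
assert (Dz : cderiv (fun _ => RtoC 0) (fun _ => RtoC 0)).
{ intros x; split; apply @is_derive_const. }
destruct HB as (D1 & D2 & _ & E & _).
destruct (proj1 HG) as [x Hx]; apply Hx.
apply (ivp_unique (rho mu nu n) r U (CDerive U) (CDerive (CDerive U))
  (fun _ => RtoC 0) (fun _ => RtoC 0) (fun _ => RtoC 0) M); auto.
- intros t; unfold nonlin; ring.
- intros t; rewrite Cmod_0; eapply Rle_trans; [apply Cmod_ge_0|apply (HM t)].
- apply HI; rewrite Rminus_0_r, Rabs_R0; lra.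
- apply (cderiv_eq_at U _ (fun _ => RtoC 0) (fun _ => RtoC 0) 0 1 Rlt_0_1 D1 Dz HI).
Qed.

Lemma Gamma_unique mu nu n r r' (U V : C2R) eta : (0 < n)%nat ->
  648 * Cmod (rho mu nu n) * (eta + 3 * eta ^ 2) <= 1 ->
  Gamma mu nu n r U -> Gamma mu nu n r' V -> Cmod r <= eta -> Cmod r' <= eta ->
  (forall x, - (PI / 2) <= x <= PI / 2 -> Cmod (U x) <= eta) ->
  (forall x, - (PI / 2) <= x <= PI / 2 -> Cmod (V x) <= eta) ->
  cmean U = cmean V -> r = r' /\ forall x, U x = V x.
Proof.
intros Hn Hsm HU HV Hr Hr' BU BV Hm.
pose proof (bvp_zero_of_cmean_zero _ _ _ _ _ _ Hsm HU Hr BU) as H0.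
destruct (Gamma_bvp _ _ _ _ _ HU) as [SU [M1 HM1]].
destruct (Gamma_bvp _ _ _ _ _ HV) as [SV [M2 HM2]].
destruct (bvp_unique _ _ (rho_neq_0 mu nu n Hn) Hsm _ _ _ _ _ _ _ _ SU SV Hr Hr' BU BV Hm H0)
  as [<- HI].
split; [easy|].
destruct SU as (D1 & D2 & _ & E & _); destruct SV as (F1 & F2 & _ & E' & _).
pose proof PI2_1 as Hpi.
apply (ivp_unique (rho mu nu n) r U (CDerive U) (CDerive (CDerive U))
  V (CDerive V) (CDerive (CDerive V)) (Rmax M1 M2)); auto.
- intros t; eapply Rle_trans; [apply HM1|apply Rmax_l].
- intros t; eapply Rle_trans; [apply HM2|apply Rmax_r].
- apply HI; lra.
- apply (cderiv_eq_at U _ V _ 0 1 Rlt_0_1 D1 F1).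
  intros t Ht; apply HI; apply Rabs_def2 in Ht; lra.
Qed.

(** [K1] and [K2] stand for bounds on w and R, so that e K1 and e^2 K2 bound U and r at amplitude e.
    The square of gamma is at most rad / 2 because gamma <= 1 and gamma <= rad / 2. *)
Lemma small_radius (K1 K2 eta rad : R) : 0 <= K1 -> 0 <= K2 -> 0 < eta -> 0 < rad ->
  exists gamma, 0 < gamma /\ gamma ^ 2 <= rad / 2 /\
    forall e, 0 <= e < gamma -> e * K1 < eta /\ e ^ 2 * K2 < eta.
Proof.
intros HK1 HK2 Heta Hrad.
set (g := Rmin (Rmin 1 (rad / 2)) (Rmin (eta / (K1 + 1)) (eta / (K2 + 1)))).
assert (Hg : 0 < g).
{ unfold g; repeat apply Rmin_pos; try lra; apply Rdiv_lt_0_compat; lra. }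
assert (G1 : g <= 1) by (eapply Rle_trans; [apply Rmin_l|apply Rmin_l]).
assert (G2 : g <= rad / 2) by (eapply Rle_trans; [apply Rmin_l|apply Rmin_r]).
assert (G3 : g <= eta / (K1 + 1)) by (eapply Rle_trans; [apply Rmin_r|apply Rmin_l]).
assert (G4 : g <= eta / (K2 + 1)) by (eapply Rle_trans; [apply Rmin_r|apply Rmin_r]).
apply Rle_div_r in G3; [|lra]; apply Rle_div_r in G4; [|lra].
exists g; split; [exact Hg|]; split; [nra|].
intros e He.
assert (e * K1 <= g * K1) by nra; assert (e ^ 2 <= g) by nra.
assert (e ^ 2 * K2 <= g * K2) by nra; split; lra.
Qed.

Theorem theorem3p1 (mu nu : R) (n : nat) (hn : (0 < n)%nat) :
  bifurcation_point_origin mu nu n /\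
  exists (O : C * C2R -> Prop) (delta : R) (phi : R -> C) (Phi : R * R -> C),
    open O /\ O (RtoC 0, C2R_zero) /\ 0 < delta /\
    continuous_on (fun s => 0 <= s < delta) phi /\
    continuous_on (fun p : R * R => 0 <= fst p < delta) Phi /\
    (forall (r : C) (U : C2R),
       (Gamma mu nu n r U /\ O (r, U)) <->
       (exists eps : C, 0 < Cmod eps ^ 2 < delta /\
          r = branch_r phi eps /\ forall x, U x = branch_U Phi eps x)) /\
    (forall eps : C, 0 < Cmod eps ^ 2 < delta ->
       exists U : C2R, (forall x, U x = branch_U Phi eps x) /\
                       Gamma mu nu n (branch_r phi eps) U) /\
    (forall s, 0 < s < delta ->
       is_C2 (fun x => Phi (s, x)) /\
       is_RInt (V := C_R_NormedModule)
         (fun x => (Phi (s, x) * RtoC (cos x ^ 2))%C) (- (PI / 2)) (PI / 2)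
         (RtoC 0)) /\
    analytic_on (fun s => 0 <= s < delta) (fun s => Re (phi s)) /\
    analytic_on (fun s => 0 <= s < delta) (fun s => Im (phi s)) /\
    analytic2_on (fun p => 0 <= fst p < delta) (fun p => Re (Phi p)) /\
    analytic2_on (fun p => 0 <= fst p < delta) (fun p => Im (Phi p)).
Proof.
destruct (branch_data_exists (Re (rho mu nu n)) (Im (rho mu nu n)))
  as (rad & a & b & c1 & c2 & Hdata).
destruct (prof_bounded _ _ _ _ _ _ Hdata) as [K1 [K10 HK1]].
destruct (param_bounded _ _ _ _ _ _ Hdata) as [K2 [K20 HK2]].
pose proof (proj1 Hdata) as Hrad.
pose proof (Cmod_ge_0 (rho mu nu n)) as Hrho.
set (phi := phi_of c1 c2); set (Phi := Phi_of a b).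
assert (Hsq : forall eps : C, Cmod eps ^ 2 <= rad -> Rabs (Cmod eps ^ 2) <= rad).
{ intros eps He; rewrite Rabs_pos_eq; [exact He|apply pow2_ge_0]. }
assert (HC2 : forall eps, Cmod eps ^ 2 <= rad -> is_C2 (branch_U Phi eps)).
{ intros eps He.
  destruct (branch_U_bvp _ _ _ _ _ _ Hdata eps He) as (D1 & D2 & C2 & _).
  now apply is_C2_cderiv with (1 := D1) (2 := D2). }
assert (HGam : forall (U : C2R) eps, 0 < Cmod eps ^ 2 <= rad ->
  (forall x, U x = branch_U Phi eps x) -> Gamma mu nu n (branch_r phi eps) U).
{ intros U eps [He0 He] HU.
  assert (E : C2R_fun U = branch_U Phi eps) by now apply functional_extensionality.
  destruct (branch_U_bvp _ _ _ _ _ _ Hdata eps He) as (D1 & D2 & _ & HE & _).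
  fold phi Phi in D1, HE.
  split; [|split].
  - apply nontrivial_cmean; rewrite E.
    unfold Phi; rewrite (cmean_branch_U _ _ _ _ _ _ Hdata eps He).
    intros Z; rewrite Z, Cmod_0 in He0; lra.
  - apply solves_E_iff; intros x; rewrite E.
    rewrite (cderiv_CDerive _ _ D1), (cderiv_CDerive _ _ D2); apply HE.
  - exists (fun x => eps * (1 + RtoC (Cmod eps ^ 2) * Phi ((Cmod eps ^ 2)%R, x)))%C.
    destruct (C2R_cderiv (mkC2R _ (is_C2_Phi_of _ _ _ _ _ _ Hdata _ (Hsq eps He))))
      as (DP & _).
    simpl in DP; pose proof (ccont_cderiv _ _ DP) as CP.
    assert (HPB : exists M, forall x, Cmod (Phi ((Cmod eps ^ 2)%R, x)) <= M).
    { destruct Hdata as (_ & Aa & Ab & _).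
      destruct (gev_C2 rad (fun k => a (S k))) as [Ma [_ Ha]];
        [apply admissible_succ; [lra|exact Aa]|].
      destruct (gev_C2 rad (fun k => b (S k))) as [Mb [_ Hb]];
        [apply admissible_succ; [lra|exact Ab]|].
      exists (Ma + Mb); intros x.
      destruct (Ha _ x (Hsq eps He) _ (or_introl eq_refl)) as (_ & _ & _ & L1 & _).
      destruct (Hb _ x (Hsq eps He) _ (or_introl eq_refl)) as (_ & _ & _ & L2 & _).
      eapply Rle_trans; [apply Cmod_le_Re_Im|]; apply Rplus_le_compat; assumption. }
    split; [|split].
    + assert (Cv : ccont (fun x => eps * (1 + RtoC (Cmod eps ^ 2) * Phi ((Cmod eps ^ 2)%R, x)))%C).
      { apply ccont_mult; [apply ccont_const|].
        apply ccont_plus; [apply ccont_const|].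
        apply ccont_mult; [apply ccont_const|exact CP]. }
      intros x; destruct (Cv x); now apply continuous_C.
    + destruct HPB as [M HM]; exists (Cmod eps * (1 + Cmod eps ^ 2 * M)); intros x.
      rewrite Cmod_mult; apply Rmult_le_compat_l; [apply Cmod_ge_0|].
      eapply Rle_trans; [apply Cmod_triangle|].
      rewrite Cmod_1, Cmod_mult, Cmod_R, (Rabs_pos_eq (Cmod eps ^ 2)) by lra.
      apply Rplus_le_compat_l, Rmult_le_compat_l; [lra|apply HM].
    + intros x; rewrite HU; reflexivity. }
assert (HUb : forall eps x, Cmod eps ^ 2 <= rad ->
  Cmod (branch_U Phi eps x) <= Cmod eps * K1 /\
  Cmod (CDerive (branch_U Phi eps) x) <= Cmod eps * K1 /\
  Cmod (CDerive (CDerive (branch_U Phi eps)) x) <= Cmod eps * K1).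
{ intros eps x He.
  destruct (branch_U_bvp _ _ _ _ _ _ Hdata eps He) as (D1 & D2 & _).
  fold phi Phi in D1.
  rewrite (cderiv_CDerive _ _ D1), (cderiv_CDerive _ _ D2).
  unfold Phi; rewrite (branch_U_prof _ _ _ _ _ _ Hdata eps x He), !Cmod_mult.
  destruct (HK1 _ x (Hsq eps He)) as (L0 & L1 & L2).
  pose proof (Cmod_ge_0 eps); repeat split; now apply Rmult_le_compat_l. }
assert (Hrb : forall eps, Cmod eps ^ 2 <= rad ->
  Cmod (branch_r phi eps) <= Cmod eps ^ 2 * K2).
{ intros eps He; unfold phi; rewrite (branch_r_param _ _ _ _ _ _ Hdata eps He).
  rewrite Cmod_mult, Cmod_R, Rabs_pos_eq by apply pow2_ge_0.
  apply Rmult_le_compat_l; [apply pow2_ge_0|]; apply HK2, Hsq, He. }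
split.
- intros P [e He].
  (* The profile and its first two derivatives are bounded on the whole line, so a small amplitude
     meets the ball condition for every x. *)
  destruct (small_radius K1 K2 e rad) as (gamma & Hg & Hgr & Hge);
    try lra; try apply cond_pos.
  set (eps := RtoC (gamma / 2)).
  assert (Heps : Cmod eps = gamma / 2) by (unfold eps; rewrite Cmod_R, Rabs_pos_eq; lra).
  assert (Her : 0 < Cmod eps ^ 2 <= rad) by (rewrite Heps; nra).
  set (U := mkC2R _ (HC2 eps (proj2 Her))).
  pose proof (HGam U eps Her (fun _ => eq_refl)) as HG.
  exists (branch_r phi eps), U; split; [|split; apply HG].
  destruct (Hge (Cmod eps)) as [E1 E2]; [rewrite Heps; lra|].
  assert (Hm0 : forall z, Cmod z < e -> Cmod (RtoC 0 - z)%C < e).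
  { intros z Hz; replace (RtoC 0 - z)%C with (- z)%C by ring; now rewrite Cmod_opp. }
  apply He; split; [|split; [apply cond_pos|]].
  + pose proof (Hrb eps (proj2 Her)) as Hr1.
    pose proof (Re_le_Cmod (branch_r phi eps)); pose proof (Im_le_Cmod (branch_r phi eps)).
    split.
    * change (Rabs (Re (branch_r phi eps) - 0) < e); rewrite Rminus_0_r; lra.
    * change (Rabs (Im (branch_r phi eps) - 0) < e); rewrite Rminus_0_r; lra.
  + intros x _; simpl; rewrite !CDerive_zero.
    destruct (HUb eps x (proj2 Her)) as (L0 & L1 & L2).
    repeat split; apply Hm0; lra.
(* 2592 = 4 * 648, since eta + 3 eta^2 <= 4 eta for eta <= 1; the + 1 guarantees eta <= 1. *)
- set (eta := / (2592 * (Cmod (rho mu nu n) + 1))).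
  assert (Heta : 0 < eta) by (apply Rinv_0_lt_compat; lra).
  assert (Heta' : eta * (2592 * (Cmod (rho mu nu n) + 1)) = 1) by (unfold eta; field; lra).
  assert (Heta1 : eta <= 1) by nra.
  assert (Hsm : 648 * Cmod (rho mu nu n) * (eta + 3 * eta ^ 2) <= 1).
  { assert (eta + 3 * eta ^ 2 <= 4 * eta) by nra. nra. }
  destruct (small_radius K1 K2 eta rad) as (gamma & Hg & Hgr & Hge); try lra.
  assert (Hdel : forall eps : C, 0 < Cmod eps ^ 2 < gamma ^ 2 ->
    0 < Cmod eps ^ 2 <= rad /\ Cmod eps < gamma).
  { intros eps He; pose proof (Cmod_ge_0 eps); split; nra. }
  pose proof PI_4 as Hpi4.
  (* With delta = gamma^2 the mean condition of the neighbourhood is exactly the upper bound on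
     |eps|^2. *)
  exists (small_nbhd eta gamma), (gamma ^ 2), phi, Phi.
  split; [apply open_small_nbhd|].
  split.
  { split; [|split]; simpl.
    - rewrite Cmod_0; exact Heta.
    - exists 0; split; [exact Heta|]; intros x _; rewrite Cmod_0; lra.
    - rewrite cmean_zero, Cmod_0; exact Hg. }
  split; [nra|].
  split; [apply (phi_of_continuous_on _ _ _ _ _ _ Hdata _ Hgr)|].
  split; [apply (Phi_of_continuous_on _ _ _ _ _ _ Hdata _ Hgr)|].
  assert (HO : forall (U : C2R) eps, 0 < Cmod eps ^ 2 < gamma ^ 2 ->
    (forall x, U x = branch_U Phi eps x) -> small_nbhd eta gamma (branch_r phi eps, U)).
  { intros U eps He HU; destruct (Hdel eps He) as [Her Hlt].
    destruct (Hge (Cmod eps)) as [E1 E2]; [split; [apply Cmod_ge_0|exact Hlt]|].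
    split; [|split]; simpl.
    - eapply Rle_lt_trans; [apply Hrb, Her|exact E2].
    - exists (Cmod eps * K1); split; [exact E1|]; intros x _; rewrite HU.
      apply HUb, Her.
    - replace (C2R_fun U) with (branch_U Phi eps)
        by (symmetry; now apply functional_extensionality).
      unfold Phi; rewrite (cmean_branch_U _ _ _ _ _ _ Hdata eps (proj2 Her)); exact Hlt. }
  split.
  { intros r U; split.
    - intros [HG (N1 & [eta' [N2 N3]] & N4)]; simpl in N1, N3, N4.
      assert (BU : forall x, - (PI / 2) <= x <= PI / 2 -> Cmod (U x) <= eta).
      { intros x Hx; apply Rle_trans with eta'; [|lra]; apply N3, Rabs_le; lra. }
      pose proof (bvp_zero_of_cmean_zero _ _ _ _ _ _ Hsm HG (Rlt_le _ _ N1) BU) as H0.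
      (* The amplitude is read off the given solution. The branch member [V] of the same amplitude
         lies in the neighbourhood too, so uniqueness identifies the two. *)
      set (eps := cmean U) in *.
      assert (He : 0 < Cmod eps ^ 2 < gamma ^ 2).
      { apply Cmod_gt_0 in H0; split; nra. }
      destruct (Hdel eps He) as [Her _].
      set (V := mkC2R _ (HC2 eps (proj2 Her))).
      assert (HGV := HGam V eps Her (fun _ => eq_refl)).
      destruct (HO V eps He (fun _ => eq_refl)) as (M1 & [eta2 [M2 M3]] & _).
      simpl in M1, M3.
      exists eps; split; [exact He|].
      apply (Gamma_unique mu nu n r (branch_r phi eps) U V eta hn Hsm HG HGV); try lra.
      + exact BU.
      + intros x Hx; apply Rle_trans with eta2; [|lra]; apply M3, Rabs_le; lra.
      + symmetry; apply (cmean_branch_U _ _ _ _ _ _ Hdata eps (proj2 Her)).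
    - intros [eps (He & -> & HU)]; split; [|now apply HO].
      apply HGam; [apply (Hdel eps He)|exact HU]. }
  split.
  { intros eps He; destruct (Hdel eps He) as [Her _].
    exists (mkC2R _ (HC2 eps (proj2 Her))); split; [easy|].
    now apply HGam. }
  split.
  { intros s Hs; assert (Hsr : Rabs s <= rad) by (rewrite Rabs_pos_eq; lra).
    split; [apply (is_C2_Phi_of _ _ _ _ _ _ Hdata s Hsr)|].
    destruct (is_RInt_Phi_of _ _ _ _ _ _ Hdata s Hsr) as [I1 I2].
    apply (is_RInt_fct_extend_pair (U := R_NormedModule) (V := R_NormedModule)
      (fun x => (Phi (s, x) * RtoC (cos x ^ 2))%C) (- (PI / 2)) (PI / 2) 0 0).
    - revert I1; apply is_RInt_ext; intros x _; unfold Phi; simpl; unfold Re; simpl; ring.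
    - revert I2; apply is_RInt_ext; intros x _; unfold Phi; simpl; unfold Im; simpl; ring. }
  destruct Hdata as (_ & Aa & Ab & A1 & A2 & _).
  repeat split.
  + apply (gev_analytic_on rad (fun k => c1 (S k)) 0 (gamma ^ 2) (4 / 3));
      [apply admissible_succ; [lra|exact A1]|exact Hrad|exact Hgr].
  + apply (gev_analytic_on rad (fun k => c2 (S k)) 0 (gamma ^ 2) (4 / 3));
      [apply admissible_succ; [lra|exact A2]|exact Hrad|exact Hgr].
  + apply (gev_analytic2_on rad (fun k => a (S k)) (gamma ^ 2));
      [apply admissible_succ; [lra|exact Aa]|exact Hrad|exact Hgr].
  + apply (gev_analytic2_on rad (fun k => b (S k)) (gamma ^ 2));
      [apply admissible_succ; [lra|exact Ab]|exact Hrad|exact Hgr].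
Qed.
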